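(* Let $G$ be one of the irreducible finite complex reflection groups $G_{12},G_{13},G_{22}$ (rank $2$) or $G_{31}$ (rank $4$) in the Shephard–Todd classification. Then $G$ does not admit any natural almost Saito structure, and hence does not admit any natural Saito structure.
   Context: Let $G\subset GL(V)$, $V=\mathbb{C}^n$ with standard coordinates $u^1,\dots,u^n$, be a finite complex reflection group. A set of basic invariants is a set of homogeneous generators $x^1,\dots,x^n$ of $\mathbb{C}[V]^G$; their degrees $d_1\ge\dots\ge d_n$ are the degrees of $G$ (for $G_{12},G_{13},G_{22},G_{31}$: $(8,6)$, $(12,8)$, $(20,12)$, $(24,20,12,8)$). $M=\mathrm{Spec}\,\mathbb{C}[V]^G$; $M_0\subset M$ is the complement of the discriminant locus, i.e. of the image of the union of the reflection hyperplanes. $E_{\mathrm{deg}}=\sum_\alpha d_\alpha x^\alpha\partial_{x^\alpha}$. $\boldsymbol{\nabla}^V$ is the torsion-free flat connection on $TM_0$ induced from the trivial connection on $TV$ via the orbit map $V\to M$. Almost Saito structure on a complex manifold $N$ with parameter $r\in\mathbb{C}$: a triple $(\boldsymbol{\nabla},\star,e)$ of a torsion-free flat connection on $TN$, an associative commutative $\mathcal{O}_N$-bilinear multiplication $\star$ on $TN$ with unit vector field $E$, and a nonzero vector field $e$, such that for local vector fields $x,y,z$: (ASS1) $\boldsymbol{\nabla}_x(y\star z)-y\star\boldsymbol{\nabla}_xz-\boldsymbol{\nabla}_y(x\star z)+x\star\boldsymbol{\nabla}_yz=[x,y]\star z$; (ASS2) $[e,x\star y]-[e,x]\star y-x\star[e,y]+e\star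 x\star y=0$; (ASS3) $\boldsymbol{\nabla}_xE=rx$; (ASS4) $\boldsymbol{\nabla}_x\boldsymbol{\nabla}_ye-\boldsymbol{\nabla}_{\boldsymbol{\nabla}_xy}e+\boldsymbol{\nabla}_{x\star y}e=0$. Natural almost Saito structure for $G$: an almost Saito structure $(\boldsymbol{\nabla},\star,e)$ on $M_0$ with $\boldsymbol{\nabla}=\boldsymbol{\nabla}^V$, unit of $\star$ equal to $\frac{1}{d_1}E_{\mathrm{deg}}$ (hence parameter $r=\frac1{d_1}$), and $e$ a nonzero polynomial vector field on $M$ of degree $-d_1$ (grading $\deg x^\alpha=d_\alpha$). Saito structure on $M$: a triple $(\nabla,\ast,E)$ of a torsion-free flat connection, an associative commutative multiplication with unit $e$ and a vector field $E$ with (SS1) $\nabla_x(y\ast z)-y\ast\nabla_xz-\nabla_y(x\ast z)+x\ast\nabla_yz=[x,y]\ast z$; (SS2) $[E,x\ast y]-[E,x]\ast y-x\ast[E,y]=x\ast y$; (SS3) $\nabla e=0$; (SS4) $\nabla_x\nabla_yE-\nabla_{\nabla_xy}E=0$. Its dual almost Saito structure with parameter $r$ is $(\boldsymbol{\nabla}^{(0,r)},\star_0,e)$ on the open set where $\mathcal{U}_0=E\ast$ is invertible, with $x\star_0y=\mathcal{U}_0^{-1}(x\ast y)$, $\boldsymbol{\nabla}^{(0,r)}_xy=\nabla_xy+r\,x\star_0y-\nabla_{x\star_0y}E$. Natural Saito structure for $G$: a Saito structure on an open subset of $M$ whose dual almost Saito structure with parameter $r=\frac{1}{d_1}$ is a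 natural almost Saito structure for $G$. *)

(* Defs.v *)
From HB Require Import structures.
From mathcomp Require Import all_boot all_order all_algebra.
From mathcomp Require Import all_classical all_reals all_analysis.
From mathcomp Require Import complex.
(* The notations of mpoly clash with those of all_analysis. *)
From mathcomp Require Import -(notations) mpoly.

Set Implicit Arguments.
Unset Strict Implicit.
Unset Printing Implicit Defensive.

Import Order.TTheory GRing.Theory Num.Theory.
Import numFieldNormedType.Exports.

Local Open Scope classical_set_scope.
Local Open Scope complex_scope.
Local Open Scope ring_scope.

(* numFieldNormedType.Exports gives a variable numFieldType its structure of
   normed module over itself; the same for the concrete field R[i]. *)
Section ComplexNormedModule.
Variable R : realType.
#[non_forgetful_inheritance]
HB.instance Definition _ := GRing.ComAlgebra.copy R[i] R[i]^o.
#[non_forgetful_inheritance]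
HB.instance Definition _ := Vector.copy R[i] R[i]^o.
#[non_forgetful_inheritance]
HB.instance Definition _ := NormedModule.copy R[i] R[i]^o.
End ComplexNormedModule.

(** * Connections, multiplications and Saito structures on open sets of C^n

   The manifolds that occur are open subsets N of C^n with its global
   coordinates.  A vector field is a function 'cV_n -> 'cV_n of which only the
   values on N matter; differentiable and 'D_v are taken over the field R[i],
   so that differentiability on an open set is holomorphy. *)

Section ComplexGeometry.
Variables (R : realType) (n : nat).
Local Notation C := R[i].
Local Notation V := 'cV[C]_n.

Definition holomorphic (U : set V) (X : V -> V) :=
  forall p, U p -> differentiable X p.

Definition local_domain (N U : set V) := open U /\ U `<=` N.

Definition lie (X Y : V -> V) : V -> V :=
  fun p => 'D_(X p) Y p - 'D_(Y p) X p.

(* Holomorphic sections over N of Hom(TN (x) TN, TN): the O_N-bilinear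
   multiplications on TN, and also the differences between a connection on TN
   and the trivial connection of the coordinates. *)
Record tensor12 (N : set V) (T : V -> V -> V -> V) : Prop := Tensor12 {
  tensor12_linl : forall p w, N p -> linear (T p ^~ w);
  tensor12_linr : forall p v, N p -> linear (T p v);
  tensor12_holo : forall v w, holomorphic N (fun p => T p v w) }.

Definition mulvf (mul : V -> V -> V -> V) (X Y : V -> V) : V -> V :=
  fun p => mul p (X p) (Y p).

(* The connection with Christoffel tensor Gam. *)
Definition nabla (Gam : V -> V -> V -> V) (X Y : V -> V) : V -> V :=
  fun p => 'D_(X p) Y p + Gam p (X p) (Y p).

Record torsion_free_flat (N : set V) (Gam : V -> V -> V -> V) : Prop :=
  TorsionFreeFlat {
  tff_tensor : tensor12 N Gam;
  tff_torsion : forall U X Y, local_domain N U ->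
    holomorphic U X -> holomorphic U Y ->
    forall p, U p -> nabla Gam X Y p - nabla Gam Y X p = lie X Y p;
  tff_flat : forall U X Y Z, local_domain N U ->
    holomorphic U X -> holomorphic U Y -> holomorphic U Z ->
    forall p, U p ->
      nabla Gam X (nabla Gam Y Z) p - nabla Gam Y (nabla Gam X Z) p
      - nabla Gam (lie X Y) Z p = 0 }.

Record multiplication (N : set V) (mul : V -> V -> V -> V) (E : V -> V) : Prop :=
  Multiplication {
  mul_tensor : tensor12 N mul;
  mul_assoc : forall p u v w, N p -> mul p u (mul p v w) = mul p (mul p u v) w;
  mul_comm : forall p v w, N p -> mul p v w = mul p w v;
  mul_unit_holo : holomorphic N E;
  mul_unit : forall p v, N p -> mul p (E p) v = v }.

(* Common to Saito and almost Saito structures. *)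
Definition potentiality (N : set V) (Gam mul : V -> V -> V -> V) :=
  forall U X Y Z, local_domain N U ->
    holomorphic U X -> holomorphic U Y -> holomorphic U Z ->
    forall p, U p ->
      nabla Gam X (mulvf mul Y Z) p - mul p (Y p) (nabla Gam X Z p)
      - nabla Gam Y (mulvf mul X Z) p + mul p (X p) (nabla Gam Y Z p)
      = mul p (lie X Y p) (Z p).

Record almost_saito (N : set V) (r : C) (Gam mul : V -> V -> V -> V)
    (E e : V -> V) : Prop := AlmostSaito {
  as_open : open N;
  as_conn : torsion_free_flat N Gam;
  as_mul : multiplication N mul E;
  as_holo : holomorphic N e;
  as_neq0 : exists2 p, N p & e p != 0;
  ass1 : potentiality N Gam mul;
  ass2 : forall U X Y, local_domain N U ->
    holomorphic U X -> holomorphic U Y ->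
    forall p, U p ->
      lie e (mulvf mul X Y) p - mul p (lie e X p) (Y p)
      - mul p (X p) (lie e Y p) + mul p (e p) (mul p (X p) (Y p)) = 0;
  ass3 : forall U X, local_domain N U -> holomorphic U X ->
    forall p, U p -> nabla Gam X E p = r *: X p;
  ass4 : forall U X Y, local_domain N U ->
    holomorphic U X -> holomorphic U Y ->
    forall p, U p ->
      nabla Gam X (nabla Gam Y e) p - nabla Gam (nabla Gam X Y) e p
      + nabla Gam (mulvf mul X Y) e p = 0 }.

Record saito (N : set V) (Gam mul : V -> V -> V -> V) (e E : V -> V) : Prop :=
  Saito {
  s_open : open N;
  s_conn : torsion_free_flat N Gam;
  s_mul : multiplication N mul e;
  s_holo : holomorphic N E;
  ss1 : potentiality N Gam mul;
  ss2 : forall U X Y, local_domain N U ->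
    holomorphic U X -> holomorphic U Y ->
    forall p, U p ->
      lie E (mulvf mul X Y) p - mul p (lie E X p) (Y p)
      - mul p (X p) (lie E Y p) = mul p (X p) (Y p);
  ss3 : forall U X, local_domain N U -> holomorphic U X ->
    forall p, U p -> nabla Gam X e p = 0;
  ss4 : forall U X Y, local_domain N U ->
    holomorphic U X -> holomorphic U Y ->
    forall p, U p ->
      nabla Gam X (nabla Gam Y E) p - nabla Gam (nabla Gam X Y) E p = 0 }.

(* The matrix of v |-> E p * v. *)
Definition calU0 (mul : V -> V -> V -> V) (E : V -> V) (p : V) : 'M[C]_n :=
  \matrix_(i, j) mul p (E p) (delta_mx j 0) i 0.

Definition dual_domain (N : set V) mul E : set V :=
  [set p | N p /\ calU0 mul E p \in unitmx].

Definition dual_mul mul (E : V -> V) : V -> V -> V -> V :=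
  fun p v w => invmx (calU0 mul E p) *m mul p v w.

(* The Christoffel tensor of
     nabla^(0,r)_x y = nabla_x y + r x *_0 y - nabla_(x *_0 y) E. *)
Definition dual_conn (r : C) Gam mul E : V -> V -> V -> V :=
  fun p v w =>
    let vw := dual_mul mul E p v w in
    Gam p v w + r *: vw - ('D_vw E p + Gam p vw (E p)).

End ComplexGeometry.

(** * Finite reflection groups and their orbit spaces

   A subgroup of GL_n(C) is a set of matrices, acting on column vectors. *)

Section Groups.
Variables (R : realType) (n : nat).
Local Notation C := R[i].

Record is_mxgroup (G : set 'M[C]_n) : Prop := IsMxGroup {
  mxgroup_unit : G `<=` [set g | g \in unitmx];
  mxgroup1 : G 1%:M;
  mxgroupM : forall g h, G g -> G h -> G (g *m h);
  mxgroupV : forall g, G g -> G (invmx g) }.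

Definition mxgroup_gen (s : seq 'M[C]_n) : set 'M[C]_n :=
  smallest is_mxgroup [set` s].

Definition conjugate_group (H G : set 'M[C]_n) :=
  exists2 P, P \in unitmx & G = [set P *m h *m invmx P | h in H].

Definition reflection (g : 'M[C]_n) := \rank (g - 1%:M) = 1%N.

Definition reflection_hyperplanes (G : set 'M[C]_n) : set 'cV[C]_n :=
  [set u | exists g, [/\ G g, reflection g & g *m u = u]].

Definition mxpoly_eval (f : mpoly n C) (u : 'cV[C]_n) : C :=
  meval (fun i => u i 0) f.

(* f \in C[V]^G; as C is infinite, it is enough to compare values. *)
Definition invariant_mpoly (G : set 'M[C]_n) (f : mpoly n C) :=
  forall g u, G g -> mxpoly_eval f (g *m u) = mxpoly_eval f u.

Record basic_invariants (G : set 'M[C]_n)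
    (d : 'I_n -> nat) (x : 'I_n -> mpoly n C) : Prop := BasicInvariants {
  bi_invariant : forall a, invariant_mpoly G (x a);
  bi_homog : forall a, x a \is ishomog1 (d a) mdeg;
  bi_generate : forall f, invariant_mpoly G f ->
    exists q : mpoly n C, f = comp_mpoly [tuple x a | a < n] q;
  bi_sorted : forall a b : 'I_n, (a <= b)%N -> (d b <= d a)%N }.

(* V -> M = Spec C[V]^G, with M identified with C^n by x^1, ..., x^n. *)
Definition orbit_map (x : 'I_n -> mpoly n C) (u : 'cV[C]_n) : 'cV[C]_n :=
  \col_a mxpoly_eval (x a) u.

Definition M0 (G : set 'M[C]_n) (x : 'I_n -> mpoly n C) : set 'cV[C]_n :=
  ~` (orbit_map x @` reflection_hyperplanes G).

(* Gam is the connection on the open set N of M induced from the trivial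
   connection of V: if the local fields X, Y on V are related to X', Y' on N
   by the orbit map f, then df (D_X Y) = (nabla_X' Y') o f.  Over M0, where f
   is a local isomorphism from V, this determines Gam. *)
Definition induced_connection (x : 'I_n -> mpoly n C)
    (N : set 'cV[C]_n) (Gam : 'cV[C]_n -> 'cV[C]_n -> 'cV[C]_n -> 'cV[C]_n) :=
  let f : 'cV[C]_n -> 'cV[C]_n := orbit_map x in
  forall (W : set 'cV[C]_n) (X Y : 'cV[C]_n -> 'cV[C]_n)
         (U : set 'cV[C]_n) (X' Y' : 'cV[C]_n -> 'cV[C]_n),
    open W -> holomorphic W X -> holomorphic W Y ->
    local_domain N U -> holomorphic U X' -> holomorphic U Y' ->
    f @` W `<=` U ->
    (forall u, W u -> 'D_(X u) f u = X' (f u)) ->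
    (forall u, W u -> 'D_(Y u) f u = Y' (f u)) ->
    forall u, W u -> 'D_('D_(X u) Y u) f u = nabla Gam X' Y' (f u).

End Groups.

(** * Natural structures *)

Section Natural.
Variables (R : realType) (n : nat).
Local Notation C := R[i].
Local Notation V := 'cV[C]_n.+1.

Definition Edeg (d : 'I_n.+1 -> nat) : V -> V := fun p => \col_a ((d a)%:R * p a 0).

(* P = \sum_a P_a d/dx^a has degree -d_1 for deg x^a = d_a: every monomial of
   P_a has weighted degree d_a - d_1. *)
Definition degree_opp_d1 (d : 'I_n.+1 -> nat)
    (P : 'I_n.+1 -> mpoly n.+1 C) :=
  forall a, {in msupp (P a), forall m : multinom n.+1,
    (\sum_b fun_of_multinom m b * d b + d ord0 = d a)%N}.

Record natural_almost_saito (G : set 'M[C]_n.+1)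
    (d : 'I_n.+1 -> nat) (x : 'I_n.+1 -> mpoly n.+1 C)
    (r : C) (Gam mul : V -> V -> V -> V) (e : V -> V) : Prop :=
  NaturalAlmostSaito {
  nas_almost_saito :
    almost_saito (M0 G x) r Gam mul (fun p => (d ord0)%:R^-1 *: Edeg d p) e;
  nas_conn : induced_connection x (M0 G x) Gam;
  nas_poly : exists P : 'I_n.+1 -> mpoly n.+1 C,
    [/\ exists a, P a != 0,
        degree_opp_d1 d P
      & forall p, M0 G x p -> e p = \col_a mxpoly_eval (P a) p] }.

Definition admits_natural_almost_saito (G : set 'M[C]_n.+1) :=
  exists d x r Gam mul e,
    basic_invariants G d x /\ natural_almost_saito G d x r Gam mul e.

Record natural_saito (G : set 'M[C]_n.+1)
    (d : 'I_n.+1 -> nat) (x : 'I_n.+1 -> mpoly n.+1 C)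
    (N : set V) (Gam mul : V -> V -> V -> V) (e E : V -> V) : Prop :=
  NaturalSaito {
  ns_saito : saito N Gam mul e E;
  ns_domain : dual_domain N mul E = M0 G x;
  ns_dual : let r := (d ord0)%:R^-1 in
    natural_almost_saito G d x r (dual_conn r Gam mul E) (dual_mul mul E) e }.

Definition admits_natural_saito (G : set 'M[C]_n.+1) :=
  exists d x N Gam mul e E,
    basic_invariants G d x /\ natural_saito G d x N Gam mul e E.

End Natural.

(** * The groups G12, G13, G22 and G31

   As subgroups of GL_n(C) up to conjugacy. *)

Section ShephardTodd.
Variable R : realType.
Local Notation C := R[i].

Definition mx_of_rows n (rows : seq (seq C)) : 'M[C]_n :=
  \matrix_(i, j) nth 0 (nth [::] rows i) j.

(* a sigma_x + b sigma_y + c sigma_z in the Pauli matrices; for a unit vector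
   (a, b, c) of R^3 it is a reflection of order 2. *)
Definition pauli (a b c : R) : 'M[C]_2 :=
  mx_of_rows 2 [:: [:: c%:C    ; a -i* b ];
                   [:: a +i* b ; (- c)%:C]].

(* G12, G13 and G22 have orders 48, 96 and 240.  Their reflections are the
   pauli v for v in the 12 edge midpoints of a regular octahedron, in these
   together with its 6 vertices, and in the 30 edge midpoints of a regular
   icosahedron, all scaled to length 1. *)
Definition is_G12 : set 'M[C]_2 -> Prop :=
  let h : R := (Num.sqrt 2)^-1 in
  conjugate_group
    (mxgroup_gen [:: pauli h 0 h; pauli (- h) 0 h; pauli h (- h) 0]).

Definition is_G13 : set 'M[C]_2 -> Prop :=
  let h : R := (Num.sqrt 2)^-1 in
  conjugate_group
    (mxgroup_gen [:: pauli 0 0 1; pauli (- h) 0 h; pauli h (- h) 0]).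

Definition is_G22 : set 'M[C]_2 -> Prop :=
  let tau : R := (1 + Num.sqrt 5) / 2 in
  conjugate_group
    (mxgroup_gen [:: pauli 0 0 1; pauli 1 0 0;
                     pauli (tau / 2) (1 / 2) (tau^-1 / 2)]).

(* The unitary reflection of order 2 with root a. *)
Definition root_reflection n (a : 'cV[C]_n) : 'M[C]_n :=
  let a_adj : 'rV[C]_n := (map_mx conjc a)^T in
  1%:M - (2 / (a_adj *m a) 0 0) *: (a *m a_adj).

(* G31, of order 46080, has 60 reflections.  Up to scalars their roots are the
   e_i, the e_i - i^k e_j for i < j, and the (1, i^k, i^l, i^m) for even
   k + l + m; the following five generate the group. *)
Definition is_G31 : set 'M[C]_4 -> Prop :=
  conjugate_group (mxgroup_gen
    [seq root_reflection (\col_i nth 0 r i) | r : seq C <-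
       [:: [:: 1; -1;   0; 0];
           [:: 0;  1;  -1; 0];
           [:: 0;  0;   0; 1];
           [:: 1; 0 -i* 1; 0; 0];
           [:: 1;  1;   1; 1]]]).

End ShephardTodd.

(* Main.v *)
Require Import Defs.
From HB Require Import structures.
From mathcomp Require Import all_boot all_order all_algebra.
From mathcomp Require Import all_classical all_reals all_analysis.
From mathcomp Require Import complex.
From mathcomp Require Import ring zify.
(* The notations of mpoly clash with those of all_analysis. *)
From mathcomp Require Import -(notations) mpoly.
(* The notations of BinInt would capture the delimiters of nat and int. *)
From Stdlib Require Import -(notations) BinInt.
From mathcomp Require Import ssrZ.

Set Implicit Arguments.
Unset Strict Implicit.
Unset Printing Implicit Defensive.

Import Order.TTheory GRing.Theory Num.Theory.
Import numFieldNormedType.Exports.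

Local Open Scope classical_set_scope.
Local Open Scope complex_scope.
Local Open Scope ring_scope.

(** Lift a natural almost Saito structure to V along the orbit map. The field e has
    degree - d_1, hence constant components in the basic invariants
    (unit_field_const). Let X be its lift and A the lift of the multiplication by
    e. As the connection becomes trivial on V, an invariant h of degree less than
    d_1 satisfies D h(X) = 0 and D^2 h(X, v) = - D h(D_v X), and axiom (ASS4) becomes
    the differential equation

      X(D^2 h(X, v)) = - D^2 h(X, A v) - D^2 h(X, D_v X)

    of is_derive_pdiff2_frame. Therefore, where the row D^2 h(X, -) vanishes, its
    derivative along X vanishes too (jet_obstruction). Two general facts give
    access to this on explicit invariants: the order of an eigenvalue of a group
    element bounds d_1 from below (degree_bound), and a vector at which the
    Jacobian determinant of some invariants does not vanish lies over M_0
    (regular_point).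

    For G12 and G22 the invariants come from the axes of a tetrahedron and of an
    icosahedron. On a line adapted to a rotation of order three the invariant f of
    the lower degree has the jet f_0 + f_3 t^3 with f_0 and f_3 nonzero; at t = 0
    the field X is tangent to the line, so D^2 f(X, -) vanishes while
    D^3 f(X, X, X) does not (rank2_obstruction).

    For G31 the invariants are sums of powers of the 60 root forms. At an
    eigenvector of a regular element of order 20 the invariants of degrees 20, 12
    and 8 force X to be a multiple of another eigenvector, for which
    D^2 h(X, -) = 0 with h of degree 20. The first derivative of X is known well
    enough to see that D^2 h(X, -) has a nonzero derivative along X
    (G31_contradiction). The numbers involved are sums in the ring generated by a
    root of unity, evaluated on lists of integers (zp_val).

    For G13, with f and h of degrees 8 and 12, one integrates the equations. They
    also involve X(D f(A X)) = - D f(A (A X)), from axiom (ASS2), and make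
    F D^2 h(X, X) an affine function of h along X, where h F is the square of the
    Jacobian determinant; explicitly it is al' h + ga f^3 / h, with f constant
    along X and ga nonzero (rank2_rigidity).

    The dual of a natural Saito structure is a natural almost Saito structure, so
    the second claim follows from the first. *)
(** * Calculus of polynomial maps *)

Section Calculus.
Variable K : numFieldType.

Section Rules.
Variable V : normedModType K.
Implicit Types (p v : V).

Lemma is_derive_bigsum (I : Type) (r : seq I) (f : I -> V -> K) (df : I -> K) p v :
  (forall i, is_derive p v (f i) (df i)) ->
  is_derive p v (fun q => \sum_(i <- r) f i q) (\sum_(i <- r) df i).
Proof.
move=> H; elim: r => [|i r IH].
  rewrite big_nil; have -> : (fun q => \sum_(i <- [::]) f i q) = cst 0.
    by apply/funext => q; rewrite big_nil.
  exact: is_derive_cst.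
rewrite big_cons.
have -> : (fun q => \sum_(j <- i :: r) f j q)
        = f i \+ (fun q => \sum_(j <- r) f j q).
  by apply/funext => q; rewrite big_cons.
exact: is_deriveD.
Qed.

Lemma is_derive_mul (f g : V -> K) (df dg : K) p v :
  is_derive p v f df -> is_derive p v g dg ->
  is_derive p v (fun q => f q * g q) (f p * dg + g p * df).
Proof. by move=> Hf Hg; apply: (is_deriveM Hf Hg). Qed.

Lemma is_derive_add (f g : V -> K) (df dg : K) p v :
  is_derive p v f df -> is_derive p v g dg ->
  is_derive p v (fun q => f q + g q) (df + dg).
Proof. by move=> Hf Hg; apply: (is_deriveD Hf Hg). Qed.

Lemma differentiable_bigsum (W : normedModType K) (I : Type) (r : seq I)
    (f : I -> V -> W) p :
  (forall i, differentiable (f i) p) ->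
  differentiable (fun q => \sum_(i <- r) f i q) p.
Proof.
move=> H; elim: r => [|i r IH].
  have -> : (fun q => \sum_(i <- [::]) f i q) = cst 0.
    by apply/funext => q; rewrite big_nil.
  exact: differentiable_cst.
have -> : (fun q => \sum_(j <- i :: r) f j q)
        = f i \+ (fun q => \sum_(j <- r) f j q).
  by apply/funext => q; rewrite big_cons.
exact: differentiableD.
Qed.

Lemma differentiable_mx m n (M : V -> 'M[K]_(m, n)) p :
  (forall i j, differentiable (fun q => M q i j) p) -> differentiable M p.
Proof.
move=> H.
have -> : M = fun q => \sum_i \sum_j M q i j *: delta_mx i j.
  by apply/funext => q; exact: matrix_sum_delta.
apply: differentiable_bigsum => i; apply: differentiable_bigsum => j.
by apply: differentiableZl.
Qed.

End Rules.
Section Rules2.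
Variables (V W : normedModType K).

Lemma is_derive_diff (f : V -> W) p v : differentiable f p ->
  is_derive p v f ('d f p v).
Proof.
by move=> df; apply: DeriveDef; [exact: diff_derivable | rewrite deriveE].
Qed.

Lemma is_derive_unique (f : V -> W) p v a b :
  is_derive p v f a -> is_derive p v f b -> a = b.
Proof. by move=> [_ <-] [_ <-]. Qed.

Lemma is_derive_val (f : V -> W) p v a b :
  is_derive p v f a -> a = b -> is_derive p v f b.
Proof. by move=> H <-. Qed.

Lemma is_derive_near (f g : V -> W) p v a :
  (\forall q \near p, f q = g q) -> is_derive p v f a -> is_derive p v g a.
Proof.
move=> fg; have [->|v0] := eqVneq v 0.
  move=> [_ <-]; rewrite derive0; exact: is_derive0.
exact: near_eq_is_derive.
Qed.

Lemma is_derive_entry m n (M : V -> 'M[K]_(m, n)) p v dM i j :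
  is_derive p v M dM -> is_derive p v (fun q => M q i j) (dM i j).
Proof.
move=> [dM1 dM2].
have H : (fun h => h^-1 *: (M (h *: v + p) i j - M p i j)) @ 0^' --> dM i j.
  have -> : (fun h => h^-1 *: (M (h *: v + p) i j - M p i j)) =
    (fun N : 'M[K]_(m, n) => N i j) \o
      (fun h => h^-1 *: ((M \o shift p) (h *: v) - M p)).
    by apply/funext => h; rewrite /= !mxE.
  apply: (@cvg_comp _ _ _ _ _ _ (nbhs dM)).
    rewrite -dM2; exact: dM1.
  exact: coord_continuous.
apply: DeriveDef; first by apply/cvg_ex; exists (dM i j).
by apply: cvg_lim => //; exact: Rhausdorff.
Qed.

Lemma is_derive_comp (U : normedModType K) (f : U -> V) (g : V -> W) p v w dg :
  differentiable f p -> differentiable g (f p) -> is_derive p v f w ->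
  is_derive (f p) w g dg -> is_derive p v (g \o f) dg.
Proof.
move=> df dg' [_ fw] [_ gw].
have d := differentiable_comp df dg'.
apply: DeriveDef; first exact: diff_derivable.
by rewrite deriveE // diff_comp //= -gw deriveE //= -fw deriveE.
Qed.

End Rules2.
End Calculus.

(** * Directional derivatives of polynomials *)

Section PolynomialCalculus.
Variable K : numFieldType.

(** The derivatives of f at u along given vectors are formal, so that their
    symmetry and Euler's relation hold by algebra; the lemmas is_derive_mpoly and
    is_derive_pdiff identify them with derivatives of functions. *)
Definition pdiff n (f : mpoly n K) (u v : 'cV[K]_n) : K :=
  \sum_i v i 0 * meval (u ^~ 0) (mderiv i f).
Definition pdiff2 n (f : mpoly n K) (u v w : 'cV[K]_n) : K :=
  \sum_i v i 0 * pdiff (mderiv i f) u w.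
Definition pdiff3 n (f : mpoly n K) (u v w x : 'cV[K]_n) : K :=
  \sum_i v i 0 * pdiff2 (mderiv i f) u w x.

Section ChainRule.
Variables (V : normedModType K) (n : nat) (p v : V).
Variables (phi : 'I_n -> V -> K).

Lemma mpoly_ring_ind (P : mpoly n K -> Prop) :
  (forall c, P (mpolyC n c)) -> (forall i, P (mpolyX K (mnm1 i))) ->
  (forall f g, P f -> P g -> P (f + g)) ->
  (forall f g, P f -> P g -> P (f * g)) -> forall f, P f.
Proof.
move=> PC PX PD PM; elim/mpolyind => [|c m f _ _ Pf].
  by rewrite -mpolyC0.
apply: (PD) => //; rewrite -mul_mpolyC; apply: (PM) => //.
rewrite mpolyXE_id; apply: big_ind; [exact: PC | exact: PM | move=> i _].
elim: (m i) => [|k IH]; first exact: PC.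
by rewrite exprS; apply: (PM).
Qed.

Lemma differentiable_meval (f : mpoly n K) :
  (forall i, differentiable (phi i) p) ->
  differentiable (fun q => meval (phi ^~ q) f) p.
Proof.
move=> dphi; elim/mpoly_ring_ind: f => [c|i|f g|f g].
- have -> : (fun q => meval (phi ^~ q) (mpolyC n c)) = cst c.
    by apply/funext => q; rewrite mevalC.
  exact: differentiable_cst.
- have -> : (fun q => meval (phi ^~ q) (mpolyX K (mnm1 i))) = phi i.
    by apply/funext => q; rewrite mevalXU.
  exact: dphi.
- move=> df dg.
  have -> : (fun q => meval (phi ^~ q) (f + g))
     = (fun q => meval (phi ^~ q) f) \+ (fun q => meval (phi ^~ q) g).
    by apply/funext => q; rewrite mevalD.
  exact: differentiableD.
- move=> df dg.
  have -> : (fun q => meval (phi ^~ q) (f * g))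
     = (fun q => meval (phi ^~ q) f) * (fun q => meval (phi ^~ q) g).
    by apply/funext => q; rewrite mevalM.
  exact: differentiableM.
Qed.

Lemma is_derive_meval (dphi : 'I_n -> K) (f : mpoly n K) :
  (forall i, is_derive p v (phi i) (dphi i)) ->
  is_derive p v (fun q => meval (phi ^~ q) f)
    (\sum_i dphi i * meval (phi ^~ p) (mderiv i f)).
Proof.
move=> dphi_; elim/mpoly_ring_ind: f => [c|i|f g Hf Hg|f g Hf Hg].
- have -> : (fun q => meval (phi ^~ q) (mpolyC n c)) = cst c.
    by apply/funext => q; rewrite mevalC.
  rewrite big1 => [|i _]; first exact: is_derive_cst.
  by rewrite mderivC meval0 mulr0.
- have -> : (fun q => meval (phi ^~ q) (mpolyX K (mnm1 i))) = phi i.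
    by apply/funext => q; rewrite mevalXU.
  rewrite (bigD1 i) //= big1 => [|j ji]; last first.
    by rewrite mderivX mnm1E eq_sym (negbTE ji) scale0r meval0 mulr0.
  rewrite mderivX mnm1E eqxx scale1r addr0.
  have -> : mnm_sub (mnm1 i) (mnm1 i) = mnm0.
    by apply/mnmP => j; rewrite !mnmE subnn.
  by rewrite mpolyX0 meval1 mulr1.
- have -> : (fun q => meval (phi ^~ q) (f + g))
     = (fun q => meval (phi ^~ q) f + meval (phi ^~ q) g).
    by apply/funext => q; rewrite mevalD.
  apply: (is_derive_val (is_derive_add Hf Hg)).
  rewrite -big_split /=; apply: eq_bigr => i _.
  by rewrite mderivD mevalD mulrDr.
- have -> : (fun q => meval (phi ^~ q) (f * g))
     = (fun q => meval (phi ^~ q) f * meval (phi ^~ q) g).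
    by apply/funext => q; rewrite mevalM.
  apply: (is_derive_val (is_derive_mul Hf Hg)).
  rewrite !mulr_sumr -big_split /=; apply: eq_bigr => i _.
  by rewrite mderivM mevalD !mevalM; ring.
Qed.
End ChainRule.

Section Points.
Variable n : nat.
Implicit Types (f g : mpoly n K) (u v w x : 'cV[K]_n).

Lemma differentiable_coord_cV u i : differentiable (fun q : 'cV[K]_n => q i 0) u.
Proof. exact: differentiable_coord. Qed.

Lemma is_derive_coord_cV u v i : is_derive u v (fun q : 'cV[K]_n => q i 0) (v i 0).
Proof. by apply: is_derive_entry; exact: is_derive_id. Qed.

Lemma differentiable_mpoly f u : differentiable (fun q : 'cV[K]_n => meval (q ^~ 0) f) u.
Proof.
by apply: (@differentiable_meval _ _ u (fun i q => q i 0)) => i;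
  exact: differentiable_coord_cV.
Qed.

Lemma is_derive_mpoly f u v :
  is_derive u v (fun q : 'cV[K]_n => meval (q ^~ 0) f) (pdiff f u v).
Proof.
by apply: (@is_derive_meval _ _ u v (fun i q => q i 0) (fun i => v i 0)) => i;
  exact: is_derive_coord_cV.
Qed.

Lemma pdiff_additive f u v w (a : K) :
  pdiff f u (a *: v + w) = a * pdiff f u v + pdiff f u w.
Proof.
rewrite /pdiff mulr_sumr -big_split /=; apply: eq_bigr => i _.
by rewrite !mxE; ring.
Qed.

Lemma pdiff2C f u v w : pdiff2 f u v w = pdiff2 f u w v.
Proof.
rewrite /pdiff2 /pdiff.
under eq_bigr do rewrite mulr_sumr.
under [RHS]eq_bigr do rewrite mulr_sumr.
rewrite exchange_big /=; apply: eq_bigr => i _; apply: eq_bigr => j _.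
by rewrite mderiv_comm; ring.
Qed.

Lemma is_derive_pdiff f u v w :
  is_derive u w (fun q => pdiff f q v) (pdiff2 f u v w).
Proof.
apply: is_derive_bigsum => i.
exact: (is_deriveZ (v i 0) (is_derive_mpoly _ _ _)).
Qed.

Lemma is_derive_pdiff_field f u w (X : 'cV[K]_n -> 'cV[K]_n) dX :
  is_derive u w X dX ->
  is_derive u w (fun q => pdiff f q (X q)) (pdiff2 f u (X u) w + pdiff f u dX).
Proof.
move=> HX.
apply: (is_derive_val (is_derive_bigsum _ (fun i => is_derive_mul
  (is_derive_entry i 0 HX) (is_derive_mpoly _ _ _)))).
by rewrite big_split /=; congr (_ + _); apply: eq_bigr => i _; exact: mulrC.
Qed.

Lemma is_derive_pdiff2_field f u w v (X : 'cV[K]_n -> 'cV[K]_n) dX :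
  is_derive u w X dX ->
  is_derive u w (fun q => pdiff2 f q (X q) v)
    (pdiff3 f u (X u) v w + pdiff2 f u dX v).
Proof.
move=> HX.
apply: (is_derive_val (is_derive_bigsum _ (fun i => is_derive_mul
  (is_derive_entry i 0 HX) (is_derive_pdiff _ _ _ _)))).
by rewrite big_split /=; congr (_ + _); apply: eq_bigr => i _; exact: mulrC.
Qed.

Lemma mdeg_homog_euler f k u : f \is ishomog1 k mdeg ->
  pdiff f u u = k%:R * meval (u ^~ 0) f.
Proof.
move=> /dhomogP hf; rewrite /pdiff.
have E i : meval (u ^~ 0) (mderiv i f) =
    \sum_(m <- msupp f) mcoeff m f * meval (u ^~ 0) (mderiv i (mpolyX K m)).
  rewrite {1}(mpolyE f) [mderiv i (\sum_(m <- _) _)]raddf_sum.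
  rewrite [LHS]raddf_sum; apply: eq_bigr => m _.
  by rewrite /= mderivZ mevalZ.
under eq_bigr => i _ do rewrite E mulr_sumr.
rewrite mevalE mulr_sumr exchange_big /= big_seq [in RHS]big_seq.
apply: eq_bigr => m mf.
have <- : mdeg m = k by exact: hf.
rewrite -mevalX mdegE natr_sum mulr_suml; apply: eq_bigr => i _.
rewrite mderivX mevalZ.
have [m0|m0] := posnP (m i); first by rewrite m0; ring.
have -> : meval (u^~ 0) (mpolyX K m) = u i 0 * meval (u^~ 0) (mpolyX K (mnm_sub m (mnm1 i))).
  rewrite -[X in X * _](mevalXU (u ^~ 0) i) -mevalM -mpolyXD; congr (meval _ (mpolyX K _)).
  apply/mnmP => j; rewrite !mnmE.
  by case: eqP => [<-|_]; rewrite ?add0n ?subn0 // add1n subn1 prednK.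
by ring.
Qed.

Lemma homog_scale f k u (t : K) : f \is ishomog1 k mdeg ->
  meval ((t *: u) ^~ 0) f = t ^+ k * meval (u ^~ 0) f.
Proof.
move=> /dhomogP hf; rewrite !mevalE mulr_sumr.
rewrite big_seq [in RHS]big_seq; apply: eq_bigr => m mf.
rewrite mulrCA; congr (_ * _).
have <- : mdeg m = k by exact: hf.
rewrite mdegE -prodrXr -big_split /=; apply: eq_bigr => i _.
by rewrite mxE exprMn.
Qed.

Lemma mderiv_homog f k i : f \is ishomog1 k mdeg -> mderiv i f \is ishomog1 k.-1 mdeg.
Proof.
move=> /dhomogP hf; apply/dhomogP => m; rewrite mcoeff_msupp mcoeff_mderiv.
have [|] := boolP (mcoeff (mnm_add m (mnm1 i)) f == 0); first by move/eqP->; rewrite mul0rn eqxx.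
rewrite -mcoeff_msupp => /hf E _.
have <- : mdeg (mnm_add m (mnm1 i)) = k by exact: E.
by rewrite mdegD mdeg1 addn1.
Qed.
End Points.
End PolynomialCalculus.

(** * Invariants as polynomials in the basic invariants *)

Section Composition.
Variable K : numFieldType.

Implicit Types m n : nat.

Definition pjac m n (f : 'I_m -> mpoly n K) (u : 'cV[K]_n) : 'M[K]_(m, n) :=
  \matrix_(a, i) meval (u ^~ 0) (mderiv i (f a)).

Lemma pjac_mul m n (f : 'I_m -> mpoly n K) (u v : 'cV[K]_n) :
  pjac f u *m v = \col_a pdiff (f a) u v.
Proof.
apply/colP => a; rewrite !mxE; apply: eq_bigr => i _.
by rewrite mxE mulrC.
Qed.

Section Jets.
Variables (m n : nat) (x : 'I_m -> mpoly n K) (q : mpoly m K) (h : mpoly n K).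
Hypothesis hq : h = comp_mpoly [tuple x a | a < m] q.
Implicit Types u v w : 'cV[K]_n.
Let xu (u : 'cV[K]_n) := \col_a meval (u ^~ 0) (x a) : 'cV[K]_m.

Lemma meval_comp_tuple u : meval (u ^~ 0) h = meval (xu u ^~ 0) q.
Proof.
rewrite hq comp_mpoly_meval; apply: meval_eq => a.
by rewrite tnth_mktuple mxE.
Qed.

Lemma pdiff_comp u v :
  pdiff h u v = \sum_a pdiff (x a) u v * meval (xu u ^~ 0) (mderiv a q).
Proof.
have H1 := is_derive_mpoly h u v.
have H2 := is_derive_meval q (fun a => is_derive_mpoly (x a) u v).
have E : (fun p : 'cV[K]_n => meval (p ^~ 0) h) =
   fun p => meval (fun a => meval (p ^~ 0) (x a)) q.
  by apply/funext => p; rewrite meval_comp_tuple; apply: meval_eq => a; rewrite mxE.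
rewrite E in H1; rewrite (is_derive_unique H1 H2).
by apply: eq_bigr => a _; congr (_ * _); apply: meval_eq => b; rewrite mxE.
Qed.

Lemma pdiff2_comp u v w :
  pdiff2 h u v w =
    \sum_a pdiff2 (x a) u v w * meval (xu u ^~ 0) (mderiv a q)
  + \sum_a pdiff (x a) u v * pdiff (mderiv a q) (xu u) (\col_b pdiff (x b) u w).
Proof.
have H1 := is_derive_pdiff h u v w.
have H2 a := is_derive_meval (mderiv a q) (fun b => is_derive_mpoly (x b) u w).
have H3 := is_derive_bigsum (index_enum 'I_m)
  (fun a => is_derive_mul (is_derive_pdiff (x a) u v w) (H2 a)).
have E : (fun p : 'cV[K]_n => pdiff h p v) = fun p => \sum_a pdiff (x a) p v *
    meval (fun b => meval (p ^~ 0) (x b)) (mderiv a q).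
  apply/funext => p; rewrite pdiff_comp; apply: eq_bigr => a _.
  by congr (_ * _); apply: meval_eq => b; rewrite mxE.
rewrite E in H1; rewrite (is_derive_unique H1 H3) big_split /= addrC.
congr (_ + _); apply: eq_bigr => a _.
  by rewrite mulrC; congr (_ * _); apply: meval_eq => b; rewrite mxE.
congr (_ * _); apply: eq_bigr => b _; rewrite mxE; congr (_ * _).
by apply: meval_eq => c; rewrite mxE.
Qed.
End Jets.

Lemma pjac_comp m n (x : 'I_m -> mpoly n K) (h : 'I_m -> mpoly n K) q (u : 'cV[K]_n) :
  (forall a, h a = comp_mpoly [tuple x b | b < m] (q a)) ->
  pjac h u = pjac q (\col_a meval (u ^~ 0) (x a)) *m pjac x u.
Proof.
move=> hq; apply/matrixP => a i; rewrite mxE.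
have E (f : mpoly n K) : meval (u ^~ 0) (mderiv i f) = pdiff f u (delta_mx i 0).
  rewrite /pdiff (bigD1 i) //= big1 => [|j /negbTE ji].
    by rewrite mxE !eqxx mul1r addr0.
  by rewrite mxE ji mul0r.
rewrite E (pdiff_comp (hq a)) mxE; apply: eq_bigr => b _.
by rewrite !mxE -E mulrC.
Qed.

Section Weights.
Variables (m n : nat) (x : 'I_m -> mpoly n K) (d : 'I_m -> nat).
Hypothesis xd : forall a, x a \is ishomog1 (d a) mdeg.

Definition wdeg (l : multinom m) : nat := (\sum_b fun_of_multinom l b * d b)%N.

Lemma wdegD l1 l2 : wdeg (mnm_add l1 l2) = (wdeg l1 + wdeg l2)%N.
Proof.
rewrite /wdeg -big_split /=; apply: eq_bigr => b _.
by rewrite mnmDE mulnDl.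
Qed.

Lemma wdeg1 a : wdeg (mnm1 a) = d a.
Proof.
rewrite /wdeg (bigD1 a) //= mnm1E eqxx mul1n big1 ?addn0 // => b ba.
by rewrite mnm1E eq_sym (negbTE ba).
Qed.

Lemma wdeg_eq0 l : (forall b, 0 < d b)%N -> wdeg l = 0%N -> l = mnm0.
Proof.
move=> d_gt0 /eqP; rewrite sum_nat_eq0 => /forallP H.
apply/mnmP => b; rewrite mnm0E; have := H b.
by rewrite muln_eq0 (gtn_eqF (d_gt0 b)) orbF => /eqP.
Qed.

Lemma comp_monomial_homog l :
  comp_mpoly [tuple x a | a < m] (mpolyX K l) \is ishomog1 (wdeg l) mdeg.
Proof.
rewrite comp_mpolyX /wdeg.
elim: (index_enum _) => [|a r IH]; first by rewrite !big_nil; exact: dhomog1.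
rewrite !big_cons; apply: dhomogM => //.
by rewrite tnth_mktuple mulnC; apply: dhomogMn.
Qed.

(** The terms of q of weight other than k contribute other degrees to h, hence
    nothing in total. *)
Lemma weighted_representative k (h : mpoly n K) q :
  h \is ishomog1 k mdeg -> h = comp_mpoly [tuple x a | a < m] q ->
  exists2 q', h = comp_mpoly [tuple x a | a < m] q' &
    {in msupp q', forall l, wdeg l = k}.
Proof.
move=> hk hq.
pose q' := \sum_(l <- msupp q | wdeg l == k) (mcoeff l q *: mpolyX K l).
exists q'.
  rewrite -(pihomog_dE hk) hq comp_mpolyEX !raddf_sum /= big_mkcond /=.
  rewrite [RHS]big_mkcond; apply: eq_bigr => l _.
  have [lk|lk] := eqVneq (wdeg l) k.
    rewrite comp_mpolyZ [LHS]linearZ /= pihomog_dE //.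
    by rewrite -lk comp_monomial_homog.
  by rewrite [LHS]linearZ /= (pihomog_ne0 lk (comp_monomial_homog l)) scaler0.
move=> l; rewrite mcoeff_msupp /q' raddf_sum /=; apply: contra_neq_eq => lk.
rewrite big1 // => l' /eqP l'k; rewrite mcoeffZ mcoeffX.
case: eqP => [E|]; last by rewrite mulr0.
by move: lk; rewrite -E l'k eqxx.
Qed.

End Weights.

(** Derivation along c lowers the weight by the largest degree. *)
Lemma top_derivative_const n (d : 'I_n.+1 -> nat) (c : 'cV[K]_n.+1) k q :
  (forall b, 0 < d b)%N -> (forall a, c a 0 != 0 -> d a = d ord0) ->
  (k <= d ord0)%N -> {in msupp q, forall l, wdeg d l = k} ->
  exists2 kappa, \sum_a c a 0 *: mderiv a q = mpolyC n.+1 kappa &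
    (k < d ord0)%N -> kappa = 0.
Proof.
move=> d_gt0 cd kd qk.
have H a l : c a 0 != 0 -> mcoeff l (mderiv a q) != 0 -> l = mnm0 /\ k = d ord0.
  move=> /cd da; rewrite mcoeff_mderiv => nz.
  have : mcoeff (mnm_add l (mnm1 a)) q != 0.
    by apply: contraNneq nz => ->; rewrite mul0rn.
  rewrite -mcoeff_msupp => /qk; rewrite wdegD wdeg1 da => E.
  have l0 : wdeg d l = 0%N by lia.
  by split; [exact: wdeg_eq0 l0 | lia].
exists (mcoeff mnm0 (\sum_a c a 0 *: mderiv a q)).
  apply/mpolyP => l; rewrite mcoeffC; case: eqP => [<-|/eqP l0].
    by rewrite mulr1.
  rewrite mulr0 raddf_sum big1 // => a _; rewrite /= mcoeffZ.
  have [->|ca] := eqVneq (c a 0) 0; first by rewrite mul0r.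
  have [->|nz] := eqVneq (mcoeff l (mderiv a q)) 0; first by rewrite mulr0.
  by have [E _] := H _ _ ca nz; rewrite E eqxx in l0.
move=> klt; rewrite raddf_sum big1 // => a _; rewrite /= mcoeffZ.
have [->|ca] := eqVneq (c a 0) 0; first by rewrite mul0r.
have [->|nz] := eqVneq (mcoeff mnm0 (mderiv a q)) 0; first by rewrite mulr0.
by have [_ E] := H _ _ ca nz; rewrite E ltnn in klt.
Qed.

End Composition.

(** * The tangent frame of a natural almost Saito structure *)

Section InverseJacobian.
Variables (K : numFieldType) (n : nat) (x : 'I_n -> mpoly n K).
Implicit Types u v b : 'cV[K]_n.

(** The lift of a tangent vector of the orbit space; written with the adjugate,
    it is visibly a rational function of u. *)
Definition pull_back u b : 'cV[K]_n :=
  (\det (pjac x u))^-1 *: (\adj (pjac x u) *m b).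

Let JP : 'M[mpoly n K]_n := \matrix_(a, i) mderiv i (x a).

Lemma pjac_map u : pjac x u = map_mx (meval (u ^~ 0)) JP.
Proof. by apply/matrixP => a i; rewrite !mxE. Qed.

Lemma det_pjac : exists D : mpoly n K, forall u, \det (pjac x u) = meval (u ^~ 0) D.
Proof. by exists (\det JP) => u; rewrite pjac_map det_map_mx. Qed.

Lemma differentiable_det_pjac u : differentiable (fun p => \det (pjac x p)) u.
Proof.
have [D DE] := det_pjac.
have -> : (fun p => \det (pjac x p)) = (fun p => meval (p ^~ 0) D).
  by apply/funext => p.
exact: differentiable_mpoly.
Qed.

Lemma pjac_pull_back u b : pjac x u \in unitmx -> pjac x u *m pull_back u b = b.
Proof.
rewrite unitmxE unitfE => Ju; rewrite /pull_back -scalemxAr mulmxA mul_mx_adj.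
by rewrite mul_scalar_mx scalerA mulVf // scale1r.
Qed.

Lemma pull_back_pjac u v : pjac x u \in unitmx -> pull_back u (pjac x u *m v) = v.
Proof.
rewrite unitmxE unitfE => Ju; rewrite /pull_back mulmxA mul_adj_mx.
by rewrite mul_scalar_mx scalerA mulVf // scale1r.
Qed.

Lemma pull_back_linear u v w (a : K) :
  pull_back u (a *: v + w) = a *: pull_back u v + pull_back u w.
Proof. by rewrite /pull_back mulmxDr -scalemxAr scalerDr scalerA mulrC scalerA. Qed.

Lemma differentiable_pull_back u b : pjac x u \in unitmx ->
  differentiable (pull_back ^~ b) u.
Proof.
rewrite unitmxE unitfE => Ju; apply: differentiable_mx => i j.
have -> : (fun p => pull_back p b i j) = (fun p => (\det (pjac x p))^-1) *
    (fun p => meval (p ^~ 0) (\sum_k (\adj JP) i k * mpolyC n (b k j))).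
  apply/funext => p; rewrite !mxE /= mulrfctE raddf_sum /=; congr (_ * _).
  apply: eq_bigr => k _; rewrite mevalM mevalC; congr (_ * _).
  have -> : meval (p ^~ 0) ((\adj JP) i k) = map_mx (meval (p ^~ 0)) (\adj JP) i k.
    by rewrite [RHS]mxE.
  by rewrite map_mx_adj -pjac_map.
apply: differentiableM; last exact: differentiable_mpoly.
by apply: differentiableV => //; exact: differentiable_det_pjac.
Qed.

Lemma near_pjac_unit u : pjac x u \in unitmx ->
  \forall p \near u, pjac x p \in unitmx.
Proof.
rewrite unitmxE unitfE => Ju.
have /cvgr_neq0 := differentiable_continuous (differentiable_det_pjac u).
by move=> /(_ Ju); apply: filterS => p; rewrite unitmxE unitfE.
Qed.

(** Differentiate the equation pjac x u *m pull_back u b = b. *)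
Lemma is_derive_pull_back u b w : pjac x u \in unitmx ->
  is_derive u w (pull_back ^~ b)
    (- pull_back u (\col_a pdiff2 (x a) u (pull_back u b) w)).
Proof.
move=> Ju; have dY := is_derive_diff w (differentiable_pull_back b Ju).
apply: (is_derive_val dY); set Y' := 'd _ u w in dY *.
suff E : pjac x u *m Y' = - \col_a pdiff2 (x a) u (pull_back u b) w.
  by rewrite -[LHS](pull_back_pjac _ Ju) E /pull_back mulmxN scalerN.
apply/colP => a; rewrite pjac_mul !mxE.
have H1 := is_derive_pdiff_field (x a) dY.
have H2 : is_derive u w (fun p => pdiff (x a) p (pull_back p b)) 0.
  have H0 := @is_derive_cst K _ _ (b a 0) u w.
  apply: is_derive_near H0.
  apply: filterS (near_pjac_unit Ju) => p Jp.
  by rewrite -{1}(pjac_pull_back b Jp) pjac_mul mxE.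
have := is_derive_unique H1 H2 => /eqP; rewrite addrC addr_eq0 => /eqP.
by [].
Qed.

Lemma differentiable_orbit u :
  differentiable (fun p : 'cV[K]_n => \col_a meval (p ^~ 0) (x a) : 'cV[K]_n) u.
Proof.
apply: differentiable_mx => i j.
have -> : (fun q : 'cV[K]_n => (\col_a meval (q^~ 0) (x a) : 'cV[K]_n) i j) =
   (fun q => meval (q ^~ 0) (x i)) by apply/funext => q; rewrite mxE.
exact: differentiable_mpoly.
Qed.

Lemma is_derive_orbit u v :
  is_derive u v (fun p : 'cV[K]_n => \col_a meval (p ^~ 0) (x a) : 'cV[K]_n)
    (pjac x u *m v).
Proof.
have H := is_derive_diff v (differentiable_orbit u).
apply: (is_derive_val H); apply/colP => a; rewrite pjac_mul !mxE.
apply: (is_derive_unique (is_derive_entry a 0 H)).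
have -> : (fun q : 'cV[K]_n => (\col_a meval (q^~ 0) (x a) : 'cV[K]_n) a 0) =
   (fun q => meval (q ^~ 0) (x a)) by apply/funext => q; rewrite mxE.
exact: is_derive_mpoly.
Qed.

Lemma homog0_pjac_unit u (d : 'I_n -> nat) : (forall a, x a \is ishomog1 (d a) mdeg) ->
  pjac x u \in unitmx -> forall a, (0 < d a)%N.
Proof.
move=> xd Ju a; rewrite lt0n; apply/eqP => da0.
have m0 i : mderiv i (x a) = 0.
  apply/mpolyP => m; rewrite mcoeff0 mcoeff_mderiv.
  have [->|] := eqVneq (mcoeff (mnm_add m (mnm1 i)) (x a)) 0; first by rewrite mul0rn.
  have /dhomogP xa := xd a.
  rewrite -mcoeff_msupp => /xa; rewrite da0 => E.
  have : mdeg (mnm_add m (mnm1 i)) = 0%N by exact: E.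
  by rewrite mdegD mdeg1 addn1.
have : (pjac x u *m invmx (pjac x u)) a a = 0.
  by rewrite mxE big1 // => i _; rewrite mxE m0 meval0 mul0r.
by rewrite mulmxV // mxE eqxx => /eqP; rewrite oner_eq0.
Qed.

End InverseJacobian.

(** * The lifted structure *)

Section NaturalFrame.
Variables (R : realType) (n : nat).
Local Notation C := R[i].
Local Notation V := 'cV[C]_n.+1.
Variables (G : set 'M[C]_n.+1) (d : 'I_n.+1 -> nat) (x : 'I_n.+1 -> mpoly n.+1 C).
Variables (r : C) (Gam mul : V -> V -> V -> V) (e : V -> V).
Hypothesis basic : basic_invariants G d x.
Hypothesis natural : natural_almost_saito G d x r Gam mul e.

Let N := M0 G x.
Let asaito := nas_almost_saito natural.

Definition regular_locus : set V :=
  [set u | pjac x u \in unitmx /\ M0 G x (orbit_map x u)].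
Let W := regular_locus.

Lemma open_regular_locus : open W.
Proof.
rewrite openE => u [Ju Nu].
have H1 := near_pjac_unit Ju.
have H2 : \forall p \near u, N (orbit_map x p).
  have := differentiable_continuous (differentiable_orbit x u).
  by apply; apply: (open_nbhs_nbhs (conj (as_open asaito) Nu)).
by rewrite /interior; near=> p; split; near: p.
Unshelve. all: by end_near. Qed.

Lemma Gam_sym p v w : N p -> Gam p v w = Gam p w v.
Proof.
move=> Np.
have LN : local_domain N N by split; [exact: as_open asaito | ].
have := tff_torsion (as_conn asaito) (X := cst v) (Y := cst w) LN
  (fun q _ => differentiable_cst _ _) (fun q _ => differentiable_cst _ _) Np.
rewrite /lie /nabla /= !derive_cst !add0r oppr0 => /eqP.
by rewrite subr_eq0 => /eqP.
Qed.

Hypothesis d_gt0 : forall a, (0 < d a)%N.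

(** A vector field of degree -d_1 is constant: its components have degree
    d_a - d_1 <= 0. *)
Lemma unit_field_const : exists c : V,
  [/\ c != 0, forall p, N p -> e p = c & forall a, c a 0 != 0 -> d a = d ord0].
Proof.
have [P [[a0 Pa0] degP eP]] := nas_poly natural.
have Pm a m : mcoeff m (P a) != 0 -> m = mnm0 /\ d a = d ord0.
  rewrite -mcoeff_msupp => /degP E.
  have da := bi_sorted basic (leq0n a : (ord0 <= a)%N).
  have m0 : wdeg d m = 0%N by rewrite /wdeg; lia.
  split; first exact: wdeg_eq0 m0.
  by move: m0; rewrite /wdeg; lia.
have PC a : P a = mpolyC n.+1 (mcoeff mnm0 (P a)).
  apply/mpolyP => m; rewrite mcoeffC; case: eqP => [<-|/eqP m0].
    by rewrite mulr1.
  rewrite mulr0; apply: contra_neq_eq m0 => /Pm[] -> _; exact: erefl.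
exists (\col_a mcoeff mnm0 (P a)); split.
- apply: contraNneq Pa0 => /colP/(_ a0); rewrite !mxE => E.
  by rewrite PC E mpolyC0.
- move=> p Np; rewrite eP //; apply/colP => a; rewrite !mxE.
  by rewrite /mxpoly_eval {1}PC mevalC.
- by move=> a; rewrite mxE => /Pm[].
Qed.

Section Fixed.
Variable c : V.
Hypotheses (c_neq0 : c != 0) (ec : forall p, N p -> e p = c)
  (cd : forall a, c a 0 != 0 -> d a = d ord0).

Let openN : open N := as_open asaito.
Let LN : local_domain N N. Proof. by split. Qed.
Let holc b (U : set V) : holomorphic U (cst b : V -> V).
Proof. by move=> q _; exact: differentiable_cst. Qed.

Let near_N p : N p -> \forall q \near p, N q.
Proof. by move=> Np; apply: (open_nbhs_nbhs (conj openN Np)). Qed.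

Lemma derive_e p v : N p -> 'D_v e p = 0.
Proof.
move=> Np.
have H : is_derive p v e 0.
  apply: is_derive_near (is_derive_cst c p v).
  by apply: filterS (near_N Np) => q Nq; rewrite ec.
by have [_ ->] := H.
Qed.

Let nabla_e X p : N p -> nabla Gam X e p = Gam p c (X p).
Proof.
by move=> Np; rewrite /nabla derive_e // add0r ec //; apply: Gam_sym.
Qed.

Let nabla_cst b X p : nabla Gam X (cst b) p = Gam p (X p) b.
Proof. by rewrite /nabla derive_cst add0r. Qed.

(** Axiom (ASS4) for the constant fields c and b: the covariant derivative of e
    along any vector v is Gam c v, by symmetry of Gam. *)
Lemma is_derive_Gam p b : N p ->
  is_derive p c (fun q => Gam q c b) (- Gam p c (mul p c b)).
Proof.
move=> Np.
have hG := tensor12_holo (tff_tensor (as_conn asaito)) c b Np.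
apply: (is_derive_val (is_derive_diff c hG)).
have := ass4 asaito LN (X := cst c) (Y := cst b) (@holc _ N) (@holc _ N) Np.
rewrite (nabla_e (nabla Gam (cst c) (cst b)) Np).
rewrite (nabla_e (mulvf mul (cst c) (cst b)) Np) nabla_cst.
have E : nabla Gam (cst c) (nabla Gam (cst b) e) p
    = 'd (fun q => Gam q c b) p c + Gam p c (Gam p c b).
  rewrite {1}/nabla nabla_e //; congr (_ + _).
  have H : is_derive p c (nabla Gam (cst b) e) ('d (fun q => Gam q c b) p c).
    apply: is_derive_near (is_derive_diff c hG).
    by apply: filterS (near_N Np) => q Nq; rewrite nabla_e.
  by have [_ ->] := H.
by rewrite E addrK => /eqP; rewrite addr_eq0 => /eqP.
Qed.

(** Axiom (ASS2) for the constant fields c and b. *)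
Lemma is_derive_mulc p b : N p ->
  is_derive p c (fun q => mul q c b) (- mul p c (mul p c b)).
Proof.
move=> Np.
have hM := tensor12_holo (mul_tensor (as_mul asaito)) c b Np.
apply: (is_derive_val (is_derive_diff c hM)).
have := ass2 asaito LN (X := cst c) (Y := cst b) (@holc _ N) (@holc _ N) Np.
rewrite /lie /mulvf /= !derive_cst !derive_e // !subr0 ec //.
have m0l w : mul p 0 w = 0.
  have := tensor12_linl (mul_tensor (as_mul asaito)) w Np 1 0 0.
  by rewrite scaler0 addr0 scale1r => /eqP; rewrite eq_sym -subr_eq0 addrK => /eqP.
have m0r w : mul p w 0 = 0 by rewrite (mul_comm (as_mul asaito)).
rewrite m0l m0r !subr0 deriveE // => /eqP; rewrite addr_eq0 => /eqP.
by [].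
Qed.

Lemma mulc_unit p : N p -> mul p c (Edeg d p) = (d ord0)%:R *: c.
Proof.
move=> Np; have := mul_unit (as_mul asaito) c Np.
rewrite (mul_comm (as_mul asaito)) // => H.
have d0 : (d ord0)%:R != 0 :> C by rewrite pnatr_eq0 -lt0n.
have E : Edeg d p = (d ord0)%:R *: ((d ord0)%:R^-1 *: Edeg d p).
  by rewrite scalerA mulfV // scale1r.
have m0r : mul p c 0 = 0.
  have := tensor12_linr (mul_tensor (as_mul asaito)) c Np 1 0 0.
  by rewrite scaler0 addr0 scale1r => /eqP; rewrite eq_sym -subr_eq0 addrK => /eqP.
have := tensor12_linr (mul_tensor (as_mul asaito)) c Np (d ord0)%:R
  ((d ord0)%:R^-1 *: Edeg d p) 0.
by rewrite !addr0 -E m0r addr0 H.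
Qed.

(** The lifts to V of the field e, of the multiplication by e and of the covariant
    derivative of e. As the connection is trivial on V, frame_conn u v is also the
    ordinary derivative of frame_unit at u along v. *)
Definition frame_unit u : V := pull_back x u c.
Definition frame_mul u v : V :=
  pull_back x u (mul (orbit_map x u) c (pjac x u *m v)).
Definition frame_conn u v : V :=
  - pull_back x u (\col_a pdiff2 (x a) u (frame_unit u) v).
Local Notation X := frame_unit.
Local Notation A := frame_mul.
Local Notation Q := frame_conn.

Lemma pjac_frame_conn u v : W u ->
  pjac x u *m Q u v = - \col_a pdiff2 (x a) u (X u) v.
Proof. by move=> [Ju _]; rewrite mulmxN pjac_pull_back. Qed.

Lemma is_derive_frame_unit u : W u -> is_derive u (X u) X (Q u (X u)).
Proof. by move=> [Ju _]; exact: is_derive_pull_back. Qed.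

(** The lift of a constant field b has ordinary derivative given by
    is_derive_pull_back, and the induced connection maps it to Gam c b. *)
Lemma Gam_pulled_back u v : W u ->
  Gam (orbit_map x u) c (pjac x u *m v) = - \col_a pdiff2 (x a) u (X u) v.
Proof.
move=> Wu; have [Ju Nu] := Wu.
pose b := pjac x u *m v.
have Wunit p : W p -> pjac x p \in unitmx by case.
have hY b' : holomorphic W (pull_back x ^~ b').
  by move=> p /Wunit Jp; exact: differentiable_pull_back.
have Dorb p w : 'D_w (orbit_map x : V -> V) p = pjac x p *m w.
  by have [_ <-] := is_derive_orbit x p w.
have HD b' p : W p -> 'D_(pull_back x p b') (orbit_map x : V -> V) p = b'.
  by move=> Wp; rewrite Dorb; exact: (pjac_pull_back b' (Wunit _ Wp)).
have imW : (orbit_map x : V -> V) @` W `<=` N by move=> _ [p [_ Np] <-].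
have := nas_conn natural open_regular_locus (hY c) (hY b) LN (@holc c N) (@holc b N)
  imW (HD c) (HD b) Wu.
rewrite nabla_cst /= => <-; rewrite Dorb.
have [_ ->] := is_derive_pull_back b (X u) Ju.
rewrite mulmxN (pjac_pull_back _ Ju); congr (- _); apply/colP => a; rewrite mxE [RHS]mxE.
by rewrite pull_back_pjac // pdiff2C.
Qed.

Lemma frame_unit_neq0 u : W u -> X u != 0.
Proof.
move=> [Ju _]; apply: contraNneq c_neq0 => X0.
by rewrite -(pjac_pull_back c Ju) -/(X u) X0 mulmx0.
Qed.

Lemma frame_mul_linear u v w (a : C) : W u ->
  A u (a *: v + w) = a *: A u v + A u w.
Proof.
move=> [Ju Nu]; rewrite /A mulmxDr -scalemxAr.
by rewrite (tensor12_linr (mul_tensor (as_mul asaito))) // pull_back_linear.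
Qed.

Lemma frame_mul_euler u : W u -> A u u = (d ord0)%:R *: X u.
Proof.
move=> [Ju Nu]; rewrite /A.
have -> : pjac x u *m u = Edeg d (orbit_map x u).
  apply/colP => a; rewrite pjac_mul !mxE.
  exact: mdeg_homog_euler (bi_homog basic a).
by rewrite mulc_unit // /pull_back -scalemxAr !scalerA mulrC.
Qed.

End Fixed.
End NaturalFrame.

(** * Invariants along the lifted unit field *)

Lemma linear_expand (K : numFieldType) m n (T : 'cV[K]_m -> 'cV[K]_n) w i :
  linear T -> T w i 0 = \sum_b w b 0 * T (delta_mx b 0) i 0.
Proof.
move=> linT.
have T0 : T 0 = 0.
  have := linT 1 0 0; rewrite scaler0 addr0 scale1r => /eqP.
  by rewrite eq_sym -subr_eq0 addrK => /eqP.
have TS (r : seq 'I_m) (F : 'I_m -> 'cV[K]_m) (a : 'I_m -> K) :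
    T (\sum_(b <- r) a b *: F b) = \sum_(b <- r) a b *: T (F b).
  elim: r => [|b r IH]; first by rewrite !big_nil.
  by rewrite !big_cons linT IH.
have -> : w = \sum_b w b 0 *: delta_mx b 0.
  by rewrite {1}(matrix_sum_delta w); apply: eq_bigr => b _; rewrite big_ord1.
rewrite TS summxE; apply: eq_bigr => b _; rewrite mxE; congr (_ * _).
rewrite summxE (bigD1 b) //= big1 => [|b' /negbTE bb'].
  by rewrite addr0 !mxE !eqxx mulr1.
by rewrite !mxE eq_sym bb' mulr0.
Qed.

Section Admissible.
Variables (R : realType) (n : nat).
Local Notation C := R[i].
Local Notation V := 'cV[C]_n.+1.
Variables (G : set 'M[C]_n.+1) (d : 'I_n.+1 -> nat) (x : 'I_n.+1 -> mpoly n.+1 C).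
Variables (r : C) (Gam mul : V -> V -> V -> V) (e : V -> V).
Hypothesis basic : basic_invariants G d x.
Hypothesis natural : natural_almost_saito G d x r Gam mul e.
Let N := M0 G x.
Let W := regular_locus G x.
Hypothesis d_gt0 : forall a, (0 < d a)%N.
Variable c : V.
Hypotheses (c_neq0 : c != 0) (ec : forall p, N p -> e p = c)
  (cd : forall a, c a 0 != 0 -> d a = d ord0).

(** An invariant of degree at most the largest degree, written in the basic
    invariants, is at most affine in the direction of e. *)
Lemma admissible_representative h k :
  invariant_mpoly G h -> h \is ishomog1 k mdeg -> (k <= d ord0)%N ->
  exists q, h = comp_mpoly [tuple x a | a < n.+1] q /\
    exists2 kappa, \sum_a c a 0 *: mderiv a q = mpolyC n.+1 kappa &
      (k < d ord0)%N -> kappa = 0.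
Proof.
move=> /(bi_generate basic)[q0 hq0] hk kd.
have [q hq qk] := weighted_representative (bi_homog basic) hk hq0.
by exists q; split=> //; exact: top_derivative_const qk.
Qed.

Local Notation X := (frame_unit x c).
Local Notation A := (frame_mul x mul c).
Local Notation Q := (frame_conn x c).

Section Invariant.
Variables (h q : mpoly n.+1 C) (kappa : C).
Hypothesis hq : h = comp_mpoly [tuple x a | a < n.+1] q.
Hypothesis qc : \sum_a c a 0 *: mderiv a q = mpolyC n.+1 kappa.

Let l a (u : V) := meval ((orbit_map x u) ^~ 0) (mderiv a q).

Let pdiff_xX u a : W u -> pdiff (x a) u (X u) = c a 0.
Proof. by move=> [Ju _]; rewrite -{2}(pjac_pull_back c Ju) pjac_mul mxE. Qed.

Let pdiff_h u v : pdiff h u v = \sum_a pdiff (x a) u v * l a u.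
Proof. exact: (pdiff_comp hq). Qed.

Lemma pdiff_frame_unit u : W u -> pdiff h u (X u) = kappa.
Proof.
move=> Wu; rewrite pdiff_h -[kappa](mevalC ((orbit_map x u) ^~ 0)) -qc raddf_sum.
by apply: eq_bigr => a _; rewrite pdiff_xX //= mevalZ.
Qed.

Let hess_qc i (p : V) :
  \sum_a c a 0 * meval (p ^~ 0) (mderiv i (mderiv a q)) = 0.
Proof.
have E : mderiv i (\sum_a c a 0 *: mderiv a q) =
    \sum_a c a 0 *: mderiv i (mderiv a q).
  by rewrite raddf_sum; apply: eq_bigr => a _; rewrite /= mderivZ.
have : meval (p ^~ 0) (mderiv i (\sum_a c a 0 *: mderiv a q)) = 0.
  by rewrite qc mderivC meval0.
by rewrite E raddf_sum => {2}<-; apply: eq_bigr => a _; rewrite /= mevalZ.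
Qed.

Let pdiff2_h u v : W u -> pdiff2 h u (X u) v =
  \sum_a pdiff2 (x a) u (X u) v * l a u.
Proof.
move=> Wu; rewrite (pdiff2_comp hq) [X in _ + X](_ : _ = 0) ?addr0 //.
under eq_bigr => a _ do rewrite pdiff_xX // /pdiff mulr_sumr.
rewrite exchange_big big1 // => i _ /=.
transitivity ((\col_b pdiff (x b) u v) i 0 * \sum_a c a 0 *
    meval (orbit_map x u ^~ 0) (mderiv i (mderiv a q))).
  by rewrite mulr_sumr; apply: eq_bigr => a _; rewrite mulrCA.
by rewrite hess_qc mulr0.
Qed.

(** Derivative of pdiff_frame_unit in the direction v. *)
Lemma pdiff2_frame_conn u v : W u ->
  pdiff2 h u (X u) v + pdiff h u (Q u v) = 0.
Proof.
move=> Wu; rewrite pdiff2_h // pdiff_h -big_split big1 // => a _ /=.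
have := pjac_frame_conn c v Wu; rewrite pjac_mul => /colP/(_ a); rewrite !mxE => ->.
by rewrite mulNr subrr.
Qed.

Let linG p : N p -> linear (Gam p c).
Proof. by move=> Np; exact: tensor12_linr (tff_tensor (as_conn (nas_almost_saito natural))) _ _ Np. Qed.

Let linM p : N p -> linear (mul p c).
Proof. by move=> Np; exact: tensor12_linr (mul_tensor (as_mul (nas_almost_saito natural))) _ _ Np. Qed.

Let pdiff2_Gam u v : W u -> pdiff2 h u (X u) v =
  - \sum_a (Gam (orbit_map x u) c (pjac x u *m v)) a 0 * l a u.
Proof.
move=> Wu; rewrite pdiff2_h // (Gam_pulled_back natural c v Wu).
by rewrite -sumrN; apply: eq_bigr => a _; rewrite !mxE mulNr opprK.
Qed.

Let is_derive_l u a : W u -> is_derive u (X u) (l a) 0.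
Proof.
move=> Wu.
have := is_derive_meval (mderiv a q) (fun b => is_derive_mpoly (x b) u (X u)).
have -> : (fun p : V => meval ((fun b p => meval (p ^~ 0) (x b)) ^~ p) (mderiv a q))
   = l a.
  by apply/funext => p; apply: meval_eq => b; rewrite mxE.
move=> H; apply: (is_derive_val H); rewrite -[RHS](hess_qc a (orbit_map x u)).
apply: eq_bigr => b _; rewrite (pdiff_xX b Wu); apply: (congr1 ( *%R (c b 0))).
by rewrite mderiv_comm; apply: meval_eq => b'; rewrite mxE.
Qed.

Let pjac_X u : W u -> pjac x u *m X u = c.
Proof. by move=> [Ju _]; exact: pjac_pull_back. Qed.

Let along_orbit (T : V -> V) dT u : W u -> differentiable T (orbit_map x u) ->
  is_derive (orbit_map x u) c T dT ->
  is_derive u (X u) (fun p => T (orbit_map x p)) dT.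
Proof.
move=> Wu dfT HT.
have dO : differentiable (orbit_map x : V -> V) u := differentiable_orbit x u.
have HO : is_derive u (X u) (orbit_map x : V -> V) c.
  by rewrite -{2}(pjac_X Wu); exact: is_derive_orbit.
exact: is_derive_comp dO dfT HO HT.
Qed.

(** Up to sign, the second derivative is the image of pjac x u *m v under Gam c,
    paired with the gradient of q. Along the unit field Gam c obeys is_derive_Gam,
    the gradient of q is constant, and the derivative of pjac x gives the term in
    frame_conn. *)
Lemma is_derive_pdiff2_frame u v : W u ->
  is_derive u (X u) (fun p => pdiff2 h p (X p) v)
    (- pdiff2 h u (X u) (A u v) - pdiff2 h u (X u) (Q u v)).
Proof.
move=> Wu; have [Ju Nu] := Wu.
have hG b := tensor12_holo (tff_tensor (as_conn (nas_almost_saito natural))) c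
  (delta_mx b 0) Nu.
have HG b a := is_derive_entry a 0 (along_orbit Wu (hG b)
  (is_derive_Gam natural ec (delta_mx b 0) Nu)).
have H := is_derive_bigsum (index_enum 'I_n.+1) (fun a => is_derive_mul
  (is_derive_bigsum (index_enum 'I_n.+1) (fun b => is_derive_mul
    (is_derive_pdiff (x b) u v (X u)) (HG b a))) (is_derive_l a Wu)).
have HN := is_deriveN H.
have nearW : \forall p \near u, W p.
  by apply: open_nbhs_nbhs; split=> //; exact: open_regular_locus natural.
suff HE : is_derive u (X u) (fun p => pdiff2 h p (X p) v)
   (- \sum_a ((\sum_b pdiff (x b) u v * Gam (orbit_map x u) c (delta_mx b 0) a 0) * 0
   + l a u * \sum_b (pdiff (x b) u v *
       (- Gam (orbit_map x u) c (mul (orbit_map x u) c (delta_mx b 0))) a 0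
     + Gam (orbit_map x u) c (delta_mx b 0) a 0 * pdiff2 (x b) u v (X u)))).
  apply: (is_derive_val HE); rewrite !(pdiff2_Gam _ Wu) opprK -sumrN -[RHS]addrC.
  rewrite opprK -big_split /=; apply: eq_bigr => a _.
  rewrite mulr0 add0r pjac_pull_back // (pjac_frame_conn c v Wu).
  rewrite [X in _ = X * _ + _](linear_expand _ _ (linG Nu)).
  have linGM : linear (fun w => Gam (orbit_map x u) c (mul (orbit_map x u) c w)).
    by move=> t w1 w2 /=; rewrite (linM Nu) (linG Nu).
  rewrite [X in _ = _ + X * _](linear_expand _ _ linGM).
  rewrite -mulrDl -big_split [RHS]mulrC -mulrN -sumrN; congr (_ * _).
  apply: eq_bigr => b _ /=.
  by rewrite pjac_mul !mxE pdiff2C; ring.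
apply: is_derive_near HN; apply: filterS nearW => p Wp.
have [Jp Np] := Wp.
rewrite pdiff2_Gam // fctE; congr (- _); apply: eq_bigr => a _.
congr (_ * _); rewrite (linear_expand _ _ (linG Np)); apply: eq_bigr => b _.
by rewrite pjac_mul mxE.
Qed.

(** The same argument with is_derive_mulc. *)
Lemma is_derive_pdiff_frame_mul u : W u ->
  is_derive u (X u) (fun p => pdiff h p (A p (X p)))
    (- pdiff h u (A u (A u (X u)))).
Proof.
move=> Wu; have [Ju Nu] := Wu.
have hM := tensor12_holo (mul_tensor (as_mul (nas_almost_saito natural))) c c Nu.
have HM a := is_derive_entry a 0 (along_orbit Wu hM (is_derive_mulc natural ec c Nu)).
have H := is_derive_bigsum (index_enum 'I_n.+1) (fun a => is_derive_mul
  (HM a) (is_derive_l a Wu)).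
have nearW : \forall p \near u, W p.
  by apply: open_nbhs_nbhs; split=> //; exact: open_regular_locus natural.
have pdA p w : W p -> pdiff h p (A p w) =
   \sum_a mul (orbit_map x p) c (pjac x p *m w) a 0 * l a p.
  move=> [Jp Np]; rewrite pdiff_h; apply: eq_bigr => a _; congr (_ * _).
  by rewrite -[in RHS](pjac_pull_back (mul _ _ _) Jp) pjac_mul mxE.
have HE := is_derive_near _ H.
apply: (is_derive_val (HE _ _)).
  apply: filterS nearW => p Wp; rewrite pdA // pjac_X //.
rewrite pdA // -sumrN; apply: eq_bigr => a _.
by rewrite mulr0 add0r !mxE pjac_pull_back // pjac_X // mulrN mulrC.
Qed.

End Invariant.
End Admissible.

(** * Degrees, regular points and an obstruction *)

Section GroupLemmas.
Variables (R : realType) (n : nat).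
Local Notation C := R[i].
Local Notation V := 'cV[C]_n.+1.
Variables (G : set 'M[C]_n.+1) (d : 'I_n.+1 -> nat) (x : 'I_n.+1 -> mpoly n.+1 C).
Hypothesis basic : basic_invariants G d x.

(** Some basic invariant does not vanish at u, since h does; it is homogeneous
    and invariant under g, so m divides its degree. *)
Lemma degree_bound (g : 'M[C]_n.+1) (u : V) (mu : C) m h :
  G g -> g *m u = mu *: u -> m.-primitive_root mu ->
  invariant_mpoly G h -> mxpoly_eval h u != mxpoly_eval h 0 ->
  (m <= d ord0)%N.
Proof.
move=> Gg gu mu_prim /(bi_generate basic)[q hq] hu.
have [/existsP[a xa]|/existsPn xeq] :=
  boolP [exists a, mxpoly_eval (x a) u != mxpoly_eval (x a) 0]; last first.
  move: hu; rewrite /mxpoly_eval !(meval_comp_tuple hq).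
  have -> : (\col_a meval (u^~ 0) (x a) : V) = \col_a meval ((0 : V)^~ 0) (x a).
    by apply/colP => a; rewrite !mxE; apply/eqP; have := xeq a; rewrite negbK.
  by rewrite eqxx.
have xh := bi_homog basic a.
have x0 := homog_scale u 0 xh; rewrite scale0r in x0.
have da : (0 < d a)%N.
  rewrite lt0n; apply/eqP => da; move: xa.
  by rewrite /mxpoly_eval x0 da expr0 mul1r eqxx.
have xu : meval (u ^~ 0) (x a) != 0.
  by move: xa; rewrite /mxpoly_eval x0 expr0n gtn_eqF // mul0r.
have := bi_invariant basic a u Gg; rewrite gu /mxpoly_eval (homog_scale _ _ xh).
move=> /(canRL (mulfK xu)); rewrite divff // => mu1.
have : (m %| d a)%N by rewrite (prim_order_dvd mu_prim) mu1.
by move=> /(dvdn_leq da) /leq_trans; apply; apply: (bi_sorted basic); exact: leq0n.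
Qed.

Lemma pjac_equivariant m (f : 'I_m -> mpoly n.+1 C) g u :
  (forall a, invariant_mpoly G (f a)) -> G g ->
  pjac f (g *m u) *m g = pjac f u.
Proof.
move=> finv Gg.
have E (v : V) : pjac f (g *m u) *m g *m v = pjac f u *m v.
  rewrite -mulmxA !pjac_mul; apply/colP => a; rewrite !mxE.
  have Hlin i : is_derive u v (fun p : V => (g *m p) i 0) ((g *m v) i 0).
    rewrite mxE.
    have -> : (fun p : V => (g *m p) i 0) = fun p => \sum_j g i j * p j 0.
      by apply/funext => p; rewrite mxE.
    by apply: is_derive_bigsum => j; exact: is_deriveZ (is_derive_coord_cV u v j).
  have H1 := is_derive_meval (f a) Hlin.
  have H2 := is_derive_mpoly (f a) u v.
  have EF : (fun p : V => meval ((fun i (p : V) => (g *m p) i 0) ^~ p) (f a))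
     = fun p => meval (p ^~ 0) (f a).
    by apply/funext => p; exact: (finv a g p Gg).
  rewrite EF in H1; rewrite (is_derive_unique H2 H1).
  by rewrite /pdiff; apply: eq_bigr => i _; rewrite mxE.
apply/matrixP => a i; have := E (delta_mx i 0).
by rewrite -!colE => /colP/(_ a); rewrite !mxE.
Qed.

(** The square of a Jacobian determinant of invariants is an invariant that
    vanishes on the hyperplanes, hence separates them from u. *)
Lemma regular_point (f : 'I_n.+1 -> mpoly n.+1 C) u :
  (forall g, G g -> (\det g) ^+ 2 = 1) ->
  (forall a, invariant_mpoly G (f a)) -> pjac f u \in unitmx ->
  regular_locus G x u.
Proof.
move=> detG finv fu.
have /choice[q fq] a : exists q, f a = comp_mpoly [tuple x b | b < n.+1] q.
  exact: (bi_generate basic (finv a)).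
split; first by move: fu; rewrite (pjac_comp _ fq) unitmx_mul => /andP[].
have [D DE] := det_pjac f.
have Dinv : invariant_mpoly G (D * D).
  move=> g v Gg; rewrite /mxpoly_eval !mevalM -!DE.
  rewrite -(pjac_equivariant v finv Gg) det_mulmx mulrACA -[_ * \det g]expr2.
  by rewrite detG // mulr1.
have [q' Dq] := bi_generate basic Dinv.
move=> [w [g [Gg rg gw]] wu].
have : meval (w ^~ 0) (D * D) = meval (u ^~ 0) (D * D).
  rewrite !(meval_comp_tuple Dq); congr (meval _ _).
  by move: wu; rewrite /orbit_map => ->.
rewrite !mevalM -!DE -!expr2 => /eqP.
have fw0 : \det (pjac f w) = 0.
  apply/eqP; rewrite -[_ == _]negbK -unitfE -unitmxE; apply/negP => fw.
  have := pjac_equivariant w finv Gg; rewrite gw => /(canRL (mulKmx fw)).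
  rewrite mulVmx // => g1; move: rg; rewrite /reflection g1 subrr mxrank0.
  by [].
rewrite fw0 expr0n /= eq_sym expf_eq0 /=.
by move: fu; rewrite unitmxE unitfE => /negbTE ->.
Qed.

Section Obstruction.
Variables (r : C) (Gam mul : V -> V -> V -> V) (e : V -> V).
Hypothesis natural : natural_almost_saito G d x r Gam mul e.

(** If the row D^2 h (X, -) vanishes at a point, so does its derivative along
    the lifted unit field X. *)
Lemma jet_obstruction u : regular_locus G x u ->
  exists X X1 : V, X != 0 /\ forall h k, invariant_mpoly G h ->
    h \is ishomog1 k mdeg -> (k < d ord0)%N ->
    [/\ pdiff h u X = 0, pdiff2 h u X X + pdiff h u X1 = 0 &
        (forall v, pdiff2 h u X v = 0) ->
        forall v, pdiff3 h u X v X + pdiff2 h u X1 v = 0].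
Proof.
move=> Wu; have [Ju _] := Wu.
have d_gt0 := homog0_pjac_unit (bi_homog basic) Ju.
have [c [c0 ec cd]] := unit_field_const basic natural d_gt0.
pose X := frame_unit x c; pose X1 := frame_conn x c u (X u).
exists (X u), X1; split; first exact: frame_unit_neq0 Wu.
move=> h k hinv hk kd.
have [q [hq [kappa qc kappa0]]] :=
  admissible_representative basic d_gt0 cd hinv hk (ltnW kd).
split.
- by rewrite (pdiff_frame_unit hq qc Wu) kappa0.
- exact: (pdiff2_frame_conn hq qc (X u) Wu).
- move=> H v.
  have H1 := is_derive_pdiff2_frame natural ec hq qc v Wu.
  have H2 := is_derive_pdiff2_field h v (is_derive_frame_unit c Wu).
  by rewrite (is_derive_unique H2 H1) !H oppr0 addr0.
Qed.

End Obstruction.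
End GroupLemmas.

Section Conjugation.
Variables (R : realType) (n : nat).
Local Notation C := R[i].
Local Notation V := 'cV[C]_n.

Lemma mxgroup_gen_ind (s : seq 'M[C]_n) (Pr : 'M[C]_n -> Prop) :
  is_mxgroup Pr -> (forall g, g \in s -> Pr g) ->
  forall g, mxgroup_gen s g -> Pr g.
Proof. by move=> gP sP g; apply; split. Qed.

Lemma mxgroup_gen_group (s : seq 'M[C]_n) :
  (forall g, g \in s -> g \in unitmx) -> is_mxgroup (mxgroup_gen s).
Proof.
move=> su; split.
- move=> g; apply: (mxgroup_gen_ind _ su); split=> //=.
  + by rewrite unitmx1.
  + by move=> a b; rewrite unitmx_mul => -> ->.
  + by move=> a; rewrite unitmx_inv.
- by move=> P [gP _]; exact: mxgroup1 gP.
- by move=> a b Ha Hb P HP; apply: (mxgroupM HP.1); [exact: Ha | exact: Hb].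
- by move=> a Ha P HP; apply: (mxgroupV HP.1); exact: Ha.
Qed.

Lemma mxgroup_gen_mem (s : seq 'M[C]_n) g : g \in s -> mxgroup_gen s g.
Proof. by move=> gs P [_]; apply. Qed.

Variables (s : seq 'M[C]_n) (P : 'M[C]_n).
Hypotheses (Pu : P \in unitmx) (su : forall g, g \in s -> g \in unitmx).
Let G : set 'M[C]_n := [set P *m h *m invmx P | h in mxgroup_gen s].

Lemma conj_invariant (phi : V -> C) (f : mpoly n C) :
  (forall g u, g \in s -> phi (g *m u) = phi u) ->
  (forall u, mxpoly_eval f u = phi (invmx P *m u)) -> invariant_mpoly G f.
Proof.
move=> phis fphi _ u [h Hh <-]; rewrite !fphi -!mulmxA mulKmx //.
move: (invmx P *m u) => {u}.
suff [] : h \in unitmx /\ forall u, phi (h *m u) = phi u by [].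
move: h Hh; apply: mxgroup_gen_ind => [|g gs]; last first.
  by split=> [|u]; [exact: su | exact: phis].
split=> [g []//||g1 g2 [U1 H1] [U2 H2]|g [U H]].
- by split=> [|u]; rewrite ?unitmx1 ?mul1mx.
- by split=> [|u]; rewrite ?unitmx_mul ?U1 // -mulmxA H1 H2.
- by split=> [|u]; rewrite ?unitmx_inv // -H mulKVmx.
Qed.

Lemma conj_det : (forall g, g \in s -> (\det g) ^+ 2 = 1) ->
  forall g, G g -> (\det g) ^+ 2 = 1.
Proof.
move=> sdet _ [h Hh <-]; rewrite !det_mulmx det_inv mulrAC divff ?mul1r; last first.
  by move: Pu; rewrite unitmxE unitfE.
suff [] : h \in unitmx /\ (\det h) ^+ 2 = 1 by [].
move: h Hh; apply: mxgroup_gen_ind => [|g gs]; last first.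
  by split; [exact: su | exact: sdet].
split=> [g []//||g1 g2 [U1 H1] [U2 H2]|g [U H]].
- by rewrite unitmx1 det1 expr1n.
- by rewrite unitmx_mul U1 U2 det_mulmx exprMn H1 H2 mulr1.
- by rewrite unitmx_inv U det_inv exprVn H invr1.
Qed.

Lemma conj_mem h : mxgroup_gen s h -> G (P *m h *m invmx P).
Proof. by move=> Hh; exists h. Qed.

End Conjugation.

(** * Jets along a line, and the obstruction in rank two *)

Section LineJets.
Variable K : numFieldType.

Lemma poly_ext (p q : {poly K}) : (forall t, p.[t] = q.[t]) -> p = q.
Proof.
move=> pq; apply/eqP; rewrite -subr_eq0; apply/eqP.
apply: (@roots_geq_poly_eq0 _ _ [seq i%:R | i <- iota 0 (size (p - q))]).
- by apply/allP => _ /mapP[i _ ->]; rewrite /root hornerD hornerN pq subrr.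
- rewrite map_inj_uniq ?iota_uniq // => i j /eqP; rewrite eqr_nat => /eqP.
  by [].
- by rewrite size_map size_iota.
Qed.

Section Line.
Variables (n : nat) (u v : 'cV[K]_n).

Definition line_poly (f : mpoly n K) : {poly K} :=
  mmap (@polyC K) (fun i => (u i 0)%:P + (v i 0)%:P * 'X) f.

Lemma line_polyD f g : line_poly (f + g) = line_poly f + line_poly g.
Proof. exact: mmapD. Qed.

Lemma line_polyM f g : line_poly (f * g) = line_poly f * line_poly g.
Proof. by rewrite /line_poly rmorphM. Qed.

Lemma line_polyC c : line_poly (mpolyC n c) = c%:P.
Proof. exact: mmapC. Qed.

Lemma line_polyX i : line_poly (mpolyX K (mnm1 i)) = (u i 0)%:P + (v i 0)%:P * 'X.
Proof. by rewrite /line_poly mmapX mmap1U. Qed.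

Lemma horner_line_poly f t :
  (line_poly f).[t] = meval ((u + t *: v) ^~ 0) f.
Proof.
elim/mpoly_ring_ind: f => [c|i|f g Hf Hg|f g Hf Hg].
- by rewrite line_polyC hornerC mevalC.
- by rewrite line_polyX mevalXU !hornerE !mxE mulrC.
- by rewrite line_polyD hornerD Hf Hg mevalD.
- by rewrite line_polyM hornerM Hf Hg mevalM.
Qed.

Lemma deriv_line_poly f :
  (line_poly f)^`() = \sum_i (v i 0)%:P * line_poly (mderiv i f).
Proof.
elim/mpoly_ring_ind: f => [c|i|f g Hf Hg|f g Hf Hg].
- rewrite line_polyC derivC big1 // => i _; rewrite mderivC.
  by rewrite -mpolyC0 line_polyC mulr0.
- rewrite line_polyX (bigD1 i) //= big1 => [|j /negbTE ji]; last first.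
    by rewrite mderivX mnm1E eq_sym ji scale0r -mpolyC0 line_polyC mulr0.
  rewrite mderivX mnm1E eqxx scale1r addr0.
  have -> : mnm_sub (mnm1 i) (mnm1 i) = mnm0.
    by apply/mnmP => j; rewrite !mnmE subnn.
  by rewrite mpolyX0 -mpolyC1 line_polyC derivD derivM !derivC derivX mul0r !add0r.
- rewrite line_polyD derivD Hf Hg -big_split; apply: eq_bigr => i _ /=.
  by rewrite mderivD line_polyD mulrDr.
- rewrite line_polyM derivM Hf Hg mulr_suml mulr_sumr -big_split.
  apply: eq_bigr => i _ /=; rewrite mderivM line_polyD !line_polyM; ring.
Qed.

Variables (f : mpoly n K) (p : {poly K}).
Hypothesis fp : forall t, meval ((u + t *: v) ^~ 0) f = p.[t].

Let line_polyE : line_poly f = p.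
Proof. by apply: poly_ext => t; rewrite horner_line_poly fp. Qed.

Let horner0 g : (line_poly g).[0] = meval (u ^~ 0) g.
Proof. by rewrite horner_line_poly scale0r addr0. Qed.

Let horner1 g : (line_poly g)^`().[0] = pdiff g u v.
Proof.
rewrite deriv_line_poly horner_sum; apply: eq_bigr => i _.
by rewrite hornerM hornerC horner0.
Qed.

Let horner2 g : (line_poly g)^`()^`().[0] = pdiff2 g u v v.
Proof.
rewrite deriv_line_poly raddf_sum horner_sum; apply: eq_bigr => i _ /=.
by rewrite derivM derivC mul0r add0r hornerM hornerC horner1.
Qed.

Lemma line_jet0 : meval (u ^~ 0) f = p.[0].
Proof. by rewrite -horner0 line_polyE. Qed.

Lemma line_jet1 : pdiff f u v = p^`().[0].
Proof. by rewrite -horner1 line_polyE. Qed.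

Lemma line_jet2 : pdiff2 f u v v = p^`()^`().[0].
Proof. by rewrite -horner2 line_polyE. Qed.

Lemma line_jet3 : pdiff3 f u v v v = p^`()^`()^`().[0].
Proof.
rewrite -line_polyE deriv_line_poly !raddf_sum horner_sum; apply: eq_bigr => i _ /=.
by rewrite !(derivM, derivC, mul0r, add0r) hornerM hornerC horner2.
Qed.
End Line.

Section Scaling.
Variables (n : nat) (f : mpoly n K).
Implicit Types u v w y : 'cV[K]_n.

Lemma pdiffZ u v (a : K) : pdiff f u (a *: v) = a * pdiff f u v.
Proof. by rewrite /pdiff mulr_sumr; apply: eq_bigr => i _; rewrite mxE mulrA. Qed.

Lemma pdiffD u v w : pdiff f u (v + w) = pdiff f u v + pdiff f u w.
Proof. by have := pdiff_additive f u v w 1; rewrite scale1r mul1r. Qed.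

Lemma pdiff2Zl u v w (a : K) : pdiff2 f u (a *: v) w = a * pdiff2 f u v w.
Proof. by rewrite /pdiff2 mulr_sumr; apply: eq_bigr => i _; rewrite mxE mulrA. Qed.

Lemma pdiff2Dl u v w y : pdiff2 f u (v + w) y = pdiff2 f u v y + pdiff2 f u w y.
Proof.
by rewrite /pdiff2 -big_split; apply: eq_bigr => i _; rewrite mxE mulrDl.
Qed.

Lemma pdiff2Zr u v w (a : K) : pdiff2 f u v (a *: w) = a * pdiff2 f u v w.
Proof. by rewrite pdiff2C pdiff2Zl pdiff2C. Qed.

Lemma pdiff2Dr u v w y : pdiff2 f u v (w + y) = pdiff2 f u v w + pdiff2 f u v y.
Proof. by rewrite pdiff2C pdiff2Dl !(pdiff2C f u v). Qed.
End Scaling.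

Lemma pdiff3Zl n (f : mpoly n K) u v w y (a : K) :
  pdiff3 f u (a *: v) w y = a * pdiff3 f u v w y.
Proof. by rewrite /pdiff3 mulr_sumr; apply: eq_bigr => i _; rewrite mxE mulrA. Qed.

Lemma pdiff3Zr n (f : mpoly n K) u v w y (a : K) :
  pdiff3 f u v w (a *: y) = a * pdiff3 f u v w y.
Proof.
rewrite /pdiff3 mulr_sumr; apply: eq_bigr => i _.
by rewrite pdiff2Zr mulrCA.
Qed.

Lemma pdiff2_euler n (f : mpoly n K) k u v : f \is ishomog1 k mdeg ->
  pdiff2 f u v u = k.-1%:R * pdiff f u v.
Proof.
move=> fk; rewrite /pdiff2 /pdiff mulr_sumr; apply: eq_bigr => i _.
by rewrite mulrCA; congr (_ * _); exact: mdeg_homog_euler (mderiv_homog i fk).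
Qed.
End LineJets.

Lemma det_mx2 (K : comNzRingType) (A : 'M[K]_2) :
  \det A = A 0 0 * A 1 1 - A 0 1 * A 1 0.
Proof.
rewrite (expand_det_row _ 0) !big_ord_recl big_ord0 /cofactor !det_mx11 !mxE /=.
rewrite /= !expr0 !mul1r addr0 -signr_odd /= expr1 mulN1r mulrN.
by congr (_ * A _ _ - A _ _ * A _ _); apply/val_inj.
Qed.

Section RankTwo.
Variable R : realType.
Local Notation C := R[i].
Local Notation V := 'cV[C]_2.

(** In the plane of u and w the lifted unit field at u is a multiple of w: it
    annihilates the invariant f, and f(u) is nonzero. *)
Lemma rank2_obstruction (G : set 'M[C]_2) d x r Gam mul e
    (f h : mpoly 2 C) kf kh (u w : V) (p q : {poly C}) :
  basic_invariants G d x -> natural_almost_saito G d x r Gam mul e ->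
  (forall g, G g -> (\det g) ^+ 2 = 1) ->
  invariant_mpoly G f -> f \is ishomog1 kf mdeg -> (0 < kf < d ord0)%N ->
  invariant_mpoly G h -> h \is ishomog1 kh mdeg ->
  (forall t, mxpoly_eval f (u + t *: w) = p.[t]) ->
  (forall t, mxpoly_eval h (u + t *: w) = q.[t]) ->
  p.[0] != 0 -> p^`().[0] = 0 -> p^`()^`().[0] = 0 -> q^`().[0] != 0 ->
  p^`()^`()^`().[0] = 0.
Proof.
move=> basic natural detG finv fk /andP[kf0 kfd] hinv hk fp hq p0 p1 p2 q1.
have f0 := line_jet0 fp; have f1 := line_jet1 fp.
have f2 := line_jet2 fp; have f3 := line_jet3 fp.
have h1 := line_jet1 hq; rewrite p1 in f1; rewrite p2 in f2.
have kfp : kf%:R * p.[0] != 0 by rewrite mulf_neq0 // pnatr_eq0 -lt0n.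
have fu : pdiff f u u = kf%:R * p.[0] by rewrite (mdeg_homog_euler u fk) f0.
pose F (a : 'I_2) := if a == 0 then f else h.
pose M : 'M[C]_2 := \matrix_(i, j) (if j == 0 then u i 0 else w i 0).
have JM : \det (pjac F u *m M) != 0.
  rewrite det_mx2 !mxE.
  have col0 a : \sum_j pjac F u a j * M j 0 = pdiff (F a) u u.
    by apply: eq_bigr => j _; rewrite !mxE mulrC.
  have col1 a : \sum_j pjac F u a j * M j 1 = pdiff (F a) u w.
    by apply: eq_bigr => j _; rewrite !mxE mulrC.
  rewrite !col0 !col1 /F /= fu f1 mul0r subr0 h1.
  by rewrite mulf_neq0.
have := JM; rewrite det_mulmx mulf_eq0 negb_or => /andP[Ju Mu].
have Wu : regular_locus G x u.
  have Finv a : invariant_mpoly G (F a) by rewrite /F; case: ifP.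
  have FJ : pjac F u \in unitmx by rewrite unitmxE unitfE.
  refine (regular_point basic detG Finv FJ).
have span v : exists a b, v = a *: u + b *: w.
  have Mun : M \in unitmx by rewrite unitmxE unitfE.
  exists ((invmx M *m v) 0 0), ((invmx M *m v) 1 0).
  rewrite -[LHS](mulKVmx Mun); apply/colP => i.
  rewrite mxE !big_ord_recl big_ord0 addr0 [in RHS]mxE; congr (_ + _).
    by rewrite [M _ _]mxE [in RHS]mxE /= mulrC.
  rewrite [M _ _]mxE [in RHS]mxE /= mulrC; congr (_ * _).
  by congr ((invmx M *m v) _ _); exact/val_inj.
have [X [X1 [X0 /(_ f kf finv fk kfd)[fX fX1 fX2]]]] :=
  jet_obstruction basic natural Wu.
have on_w v : pdiff f u v = 0 -> exists b, v = b *: w.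
  have [a [b ->]] := span v; rewrite pdiffD !pdiffZ f1 mulr0 addr0 fu => /eqP.
  by rewrite mulf_eq0 (negbTE kfp) orbF => /eqP ->; exists b; rewrite scale0r add0r.
have [b Xb] := on_w _ fX.
have b0 : b != 0 by apply: contraNneq X0 => b0; rewrite Xb b0 scale0r.
have fww v : pdiff2 f u w v = 0.
  have [a [b' ->]] := span v.
  by rewrite pdiff2Dr !pdiff2Zr f2 (pdiff2_euler u w fk) f1 !mulr0 addr0.
have H v : pdiff2 f u X v = 0 by rewrite Xb pdiff2Zl fww mulr0.
have [b1 X1b] : exists b1, X1 = b1 *: w.
  by apply: on_w; rewrite -fX1 H add0r.
have := fX2 H w; rewrite Xb X1b pdiff2Zl fww mulr0 addr0 pdiff3Zl pdiff3Zr f3.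
by move=> /eqP; rewrite !mulf_eq0 !(negbTE b0) /= => /eqP.
Qed.

End RankTwo.

(** * Reflections of the plane acting on null vectors *)

Lemma sum_ord2 (M : nmodType) (F : 'I_2 -> M) : \sum_i F i = F 0 + F 1.
Proof.
by rewrite !big_ord_recl big_ord0 addr0; congr (_ + F _); apply/val_inj.
Qed.

Lemma ord2_cases (i : 'I_2) : i = 0 \/ i = 1.
Proof. by case: i => [[|[|]]] // ?; [left | right]; apply/val_inj. Qed.

Section Spinors.
Variable R : realType.
Local Notation C := R[i].
Local Notation V := 'cV[C]_2.
Local Notation I := ('i%C : C).

Let I2 : I ^+ 2 = -1 := sqr_i R.

(** The null vector of C^3 attached to a vector of C^2: a two-to-one map onto
    the cone a^2 + b^2 + c^2 = 0, under which a Pauli reflection acts as the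
    orthogonal reflection in its vector. *)
Definition null1 (u : V) : C := u 0 0 ^+ 2 - u 1 0 ^+ 2.
Definition null2 (u : V) : C := I * (u 0 0 ^+ 2 + u 1 0 ^+ 2).
Definition null3 (u : V) : C := - 2 * (u 0 0 * u 1 0).

Lemma pauli_mul a b c (u : V) :
  (pauli a b c *m u) 0 0 = c%:C * u 0 0 + (a%:C - I * b%:C) * u 1 0 /\
  (pauli a b c *m u) 1 0 = (a%:C + I * b%:C) * u 0 0 - c%:C * u 1 0.
Proof.
have E1 : a -i* b = a%:C - I * b%:C by rewrite [LHS]complexE /= rmorphN mulrN.
have E2 : a +i* b = a%:C + I * b%:C by rewrite [LHS]complexE.
by rewrite !mxE !sum_ord2 !mxE /= E1 E2 rmorphN mulNr.
Qed.

Lemma pauli_null a b c (u : V) : a ^+ 2 + b ^+ 2 + c ^+ 2 = 1 ->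
  let l := a%:C * null1 u + b%:C * null2 u + c%:C * null3 u in
  [/\ null1 (pauli a b c *m u) = null1 u - 2 * a%:C * l,
      null2 (pauli a b c *m u) = null2 u - 2 * b%:C * l &
      null3 (pauli a b c *m u) = null3 u - 2 * c%:C * l].
Proof.
move=> /(congr1 (real_complex R)); rewrite !rmorphD !rmorphXn rmorph1 /= => n1.
have n2 : c%:C ^+ 2 = 1 - a%:C ^+ 2 - b%:C ^+ 2 by rewrite -n1; ring.
have [E0 E1] := pauli_mul a b c u.
rewrite /null1 /null2 /null3 E0 E1.
by split; ring: I2 n2.
Qed.

Lemma pauli_det a b c : a ^+ 2 + b ^+ 2 + c ^+ 2 = 1 -> \det (pauli a b c) = -1 :> C.
Proof.
move=> /(congr1 (real_complex R)); rewrite !rmorphD !rmorphXn rmorph1 /= => n1.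
have n2 : c%:C ^+ 2 = 1 - a%:C ^+ 2 - b%:C ^+ 2 by rewrite -n1; ring.
rewrite det_mx2 !mxE /=.
have -> : a -i* b = a%:C - I * b%:C by rewrite [LHS]complexE /= rmorphN mulrN.
have -> : a +i* b = a%:C + I * b%:C by rewrite [LHS]complexE.
by rewrite rmorphN /=; ring: I2 n2.
Qed.

Lemma null_eq0 u : null1 u = 0 -> null2 u = 0 -> u = 0.
Proof.
rewrite /null1 /null2 => H1 H2.
have H3 : u 0 0 ^+ 2 + u 1 0 ^+ 2 = 0.
  have -> : u 0 0 ^+ 2 + u 1 0 ^+ 2 = - I * (I * (u 0 0 ^+ 2 + u 1 0 ^+ 2)).
    by ring: I2.
  by rewrite H2 mulr0.
have two : (2 : C) != 0 by rewrite pnatr_eq0.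
have H4 : u 0 0 = 0.
  apply/eqP; rewrite -sqrf_eq0.
  have -> : u 0 0 ^+ 2 = (u 0 0 ^+ 2 - u 1 0 ^+ 2 + (u 0 0 ^+ 2 + u 1 0 ^+ 2)) / 2.
    by field.
  by rewrite H1 H3 addr0 mul0r.
have H5 : u 1 0 = 0.
  apply/eqP; rewrite -sqrf_eq0.
  by move: H3; rewrite H4 expr0n add0r => ->.
by apply/colP => i; rewrite mxE; case: (ord2_cases i) => ->.
Qed.

(** In the basis of u and w the rotation of order three is diagonal. *)
Lemma threefold_line (w3 : C) : w3 ^+ 2 = - w3 - 1 ->
  exists u w : V, forall t,
  [/\ null1 (u + t *: w) = 1 + t - t ^+ 2 / 2,
      null2 (u + t *: w) = w3 + t - w3 ^+ 2 * t ^+ 2 / 2 &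
      null3 (u + t *: w) = w3 ^+ 2 + t - w3 * t ^+ 2 / 2].
Proof.
move=> w32.
have two : (2 : C) != 0 by rewrite pnatr_eq0.
have w3n0 : w3 != 0.
  by apply: contra_eq_neq w32 => ->; rewrite expr0n oppr0 sub0r eq_sym oppr_eq0 oner_eq0.
pose a : C := sqrtC ((1 - I * w3) / 2).
have a2 : a ^+ 2 = (1 - I * w3) / 2 by rewrite sqrtCK.
have a0 : a != 0.
  rewrite -sqrf_eq0 a2 mulf_neq0 ?invr_neq0 // subr_eq0 eq_sym.
  apply: contraNneq w3n0 => E.
  have E1 : w3 = - I * (I * w3) by ring: I2.
  rewrite E mulr1 in E1; apply/eqP; rewrite E1.
  have -> : - I = (- I) ^+ 2 - (- (- I) - 1) by ring: I2.
  by rewrite -E1 w32 subrr.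
pose b : C := - w3 ^+ 2 / (2 * a).
have ab : a * b = - w3 ^+ 2 / 2 by rewrite /b; field.
have b2 : b ^+ 2 = (- 1 - I * w3) / 2.
  apply: (mulfI (expf_neq0 2 a0)); rewrite -exprMn ab a2.
  by field: I2 w32.
(* The first vector lies over (1, w3, w3^2) and the second over - 1/2 times its
   conjugate, scaled so that the mixed term is (1, 1, 1). *)
exists (\col_i (if i == 0 then a else b)).
exists (\col_i (if i == 0 then - (1 - I) * w3 * b / 2 else (1 + I) * w3 * a / 2)).
move=> t; rewrite /null1 /null2 /null3 !mxE /=; split.
- transitivity (a ^+ 2 - b ^+ 2 - t * w3 * (1 - I + (1 + I)) * (a * b)
    + t ^+ 2 * ((1 - I) ^+ 2 * w3 ^+ 2 / 4 * b ^+ 2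
              - (1 + I) ^+ 2 * w3 ^+ 2 / 4 * a ^+ 2)); first by field.
  by rewrite a2 b2 ab; field: I2 w32.
- transitivity (I * (a ^+ 2 + b ^+ 2 + t * w3 * (- (1 - I) + (1 + I)) * (a * b)
    + t ^+ 2 * ((1 - I) ^+ 2 * w3 ^+ 2 / 4 * b ^+ 2
              + (1 + I) ^+ 2 * w3 ^+ 2 / 4 * a ^+ 2))); first by field.
  by rewrite a2 b2 ab; field: I2 w32.
- transitivity (- 2 * (a * b + t * w3 / 2 * ((1 + I) * a ^+ 2 - (1 - I) * b ^+ 2)
    - t ^+ 2 * ((1 - I) * (1 + I) * w3 ^+ 2 / 4 * (a * b)))); first by field.
  by rewrite a2 b2 ab; field: I2 w32.
Qed.
End Spinors.

(** * Eigenvalues, power sums and axis forms *)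

Section PowerSums.
Variable K : numFieldType.

(** Otherwise a polynomial without constant term that vanishes at the other
    elements of s, but not at a, would have sum zero over s. *)
Lemma power_sums_eq0 (s : seq K) :
  (forall k, \sum_(a <- s) a ^+ k.+1 = 0) -> forall a, a \in s -> a = 0.
Proof.
move=> s0 a sa; apply/eqP; apply/negPn/negP => a0.
pose p : {poly K} := 'X * \prod_(b <- rem a (undup s)) ('X - b%:P).
have ps : \sum_(c <- s) p.[c] = 0.
  under eq_bigr => c _ do rewrite horner_coef.
  rewrite exchange_big big1 //= => -[[|k] klt] _ /=.
    by rewrite big1 // => c _; rewrite coefXM eqxx mul0r.
  by rewrite -mulr_sumr s0 mulr0.
have pc c : c \in s -> c != a -> p.[c] = 0.
  move=> sc ca; apply/eqP; rewrite hornerM mulf_eq0; apply/orP; right.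
  rewrite -[_ == 0]/(root _ c) root_prod_XsubC mem_rem_uniq ?undup_uniq //.
  by rewrite !inE ca mem_undup.
have pa : p.[a] != 0.
  rewrite hornerM hornerX mulf_neq0 //.
  rewrite -[_ == 0]/(root _ a) root_prod_XsubC mem_rem_uniq ?undup_uniq //.
  by rewrite !inE eqxx.
move: ps; rewrite (bigID (pred1 a)) /= [X in _ + X]big_seq_cond.
rewrite [X in _ + X]big1 => [|c /andP[sc ca]]; last exact: pc.
rewrite addr0 (eq_bigr (fun=> p.[a])) => [|c /eqP -> //].
rewrite big_const_seq iter_addr_0 => /eqP; rewrite mulrn_eq0 (negbTE pa) orbF.
by rewrite -leqn0 leqNgt -has_count has_pred1 sa.
Qed.

Lemma primitive_rootP (z : K) n : (0 < n)%N -> z ^+ n = 1 ->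
  (forall p, p \in primes n -> z ^+ (n %/ p) != 1) -> n.-primitive_root z.
Proof.
move=> n0 zn zp; have [m mz mn] := prim_order_exists n0 zn.
suff <- : m = n by [].
apply/eqP/negPn/negP => mneq.
have m0 : (0 < m)%N := prim_order_gt0 mz.
have q1 : (1 < n %/ m)%N.
  rewrite ltn_neqAle divn_gt0 // (dvdn_leq n0 mn) andbT eq_sym.
  by apply: contraNneq mneq => q1; rewrite -(divnK mn) q1 mul1n.
have pq := pdiv_dvd (n %/ m); have pp := pdiv_prime q1.
have pn : (pdiv (n %/ m) %| n)%N by rewrite (dvdn_trans pq) // dvdn_div.
have := zp (pdiv (n %/ m)); rewrite mem_primes pp n0 pn => /(_ isT).
rewrite -(prim_order_dvd mz) => /negP; apply.
by rewrite dvdn_divRL // mulnC -dvdn_divRL.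
Qed.

Definition quadratic (x : K * K * K) : {poly K} :=
  x.1.1%:P + x.1.2%:P * 'X + x.2%:P * 'X ^+ 2.

Lemma quadratic_jets a b c k : let p := quadratic (a, b, c) ^+ k.+3 in
  [/\ p.[0] = a ^+ k.+3,
      p^`().[0] = k.+3%:R * a ^+ k.+2 * b,
      p^`()^`().[0] = k.+3%:R * (k.+2%:R * a ^+ k.+1 * b ^+ 2 + 2 * a ^+ k.+2 * c) &
      p^`()^`()^`().[0] = k.+3%:R * k.+2%:R *
        (k.+1%:R * a ^+ k * b ^+ 3 + 6 * a ^+ k.+1 * (b * c))].
Proof.
set q := quadratic (a, b, c).
have q0 : q.[0] = a by rewrite /q /quadratic /= !hornerE /=; ring.
have q1 : q^`() = b%:P + (2 * c)%:P * 'X.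
  have two : (2 : K)%:P = 2 by rewrite rmorph_nat.
  rewrite /q /quadratic /= !(derivD, derivM, derivC, derivX, derivXn) polyCM two.
  ring.
have q2 : q^`()^`() = (2 * c)%:P.
  by rewrite q1 derivD derivM !derivC derivX mul0r !add0r mulr1.
have q10 : q^`().[0] = b by rewrite q1 !hornerE; ring.
clearbody q; move=> p.
have p1 : p^`() = q^`() * q ^+ k.+2 *+ k.+3 by rewrite deriv_exp.
have p2 : p^`()^`() = ((2 * c)%:P * q ^+ k.+2 + q^`() ^+ 2 * q ^+ k.+1 *+ k.+2) *+ k.+3.
  by rewrite p1 derivMn derivM deriv_exp q2 /=; congr (_ *+ _); ring.
have p3 : p^`()^`()^`() = ((2 * c)%:P * q^`() * q ^+ k.+1 *+ (3 * k.+2)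
    + q^`() ^+ 3 * q ^+ k *+ k.+1 *+ k.+2) *+ k.+3.
  rewrite p2 derivMn derivD derivMn (derivM (2 * c)%:P) (derivM (q^`() ^+ 2)).
  rewrite derivC !deriv_exp q2 /=.
  by congr (_ *+ _); ring.
split.
- by rewrite horner_exp q0.
- by rewrite p1 hornerMn hornerM horner_exp q0 q10 -mulr_natl; ring.
- by rewrite p2 !(hornerMn, hornerD, hornerM, horner_exp) q0 q10 hornerC !exprS; move: (a ^+ k) => ak; ring.
- by rewrite p3 !(hornerMn, hornerD, hornerM, horner_exp) q0 q10 hornerC !exprS; move: (a ^+ k) => ak; ring.
Qed.

End PowerSums.

Lemma eigenvector2 (K : fieldType) (g : 'M[K]_2) mu :
  mu ^+ 2 - \tr g * mu + \det g = 0 ->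
  exists2 u : 'cV[K]_2, u != 0 & g *m u = mu *: u.
Proof.
move=> gmu.
have /eqP/det0P[v v0 vg] : \det (g - mu%:M)^T = 0.
  rewrite det_tr det_mx2 !mxE -gmu /mxtrace sum_ord2 det_mx2 /=.
  by ring.
exists v^T; first by apply: contraNneq v0 => /(congr1 trmx); rewrite trmxK trmx0 => ->.
apply/eqP; rewrite -subr_eq0 -mul_scalar_mx -mulmxBl -[_ *m _]trmxK trmx_mul trmxK.
by rewrite vg trmx0.
Qed.

Section AxisForms.
Variable R : realType.
Local Notation C := R[i].
Local Notation V := 'cV[C]_2.
Local Notation I := ('i%C : C).
Let I2 : I ^+ 2 = -1 := sqr_i R.

Let CD (a b : R) : (a + b)%:C = a%:C + b%:C :> C. Proof. exact: rmorphD. Qed.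
Let CN (a : R) : (- a)%:C = - a%:C :> C. Proof. exact: rmorphN. Qed.
Let CM (a b : R) : (a * b)%:C = a%:C * b%:C :> C. Proof. exact: rmorphM. Qed.
Let C2 : (2 : R)%:C = 2 :> C. Proof. exact: rmorph_nat. Qed.
Let CE := (CD, CN, CM, C2).
Let pauli00 (a b c : R) : pauli a b c 0 0 = c%:C. Proof. by rewrite mxE. Qed.
Let pauli01 (a b c : R) : pauli a b c 0 1 = a%:C - I * b%:C.
Proof. by rewrite mxE /= [LHS]complexE /= CN mulrN. Qed.
Let pauli10 (a b c : R) : pauli a b c 1 0 = a%:C + I * b%:C.
Proof. by rewrite mxE /= [LHS]complexE. Qed.
Let pauli11 (a b c : R) : pauli a b c 1 1 = - c%:C.
Proof. by rewrite mxE /= CN. Qed.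
Let pauliE := (pauli00, pauli01, pauli10, pauli11).

(** The linear forms on C^3, seen as quadratic forms on C^2; sums of their powers
    over the axes of a polyhedron are invariants of its binary group. *)
Definition axis_form (n : C * C * C) (u : V) : C :=
  n.1.1 * null1 u + n.1.2 * null2 u + n.2 * null3 u.
Definition axis_sum (N : seq (C * C * C)) k u := \sum_(n <- N) axis_form n u ^+ k.

Lemma axis_form_pauli n a b c u : a ^+ 2 + b ^+ 2 + c ^+ 2 = 1 ->
  axis_form n (pauli a b c *m u) = axis_form n u
   - 2 * (n.1.1 * a%:C + n.1.2 * b%:C + n.2 * c%:C) *
     (a%:C * null1 u + b%:C * null2 u + c%:C * null3 u).
Proof. by move=> /(@pauli_null R a b c u)[E1 E2 E3]; rewrite /axis_form E1 E2 E3; ring. Qed.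

Lemma pauli_trace3 a1 b1 c1 a2 b2 c2 a3 b3 c3 :
  \tr (pauli a1 b1 c1 *m pauli a2 b2 c2 *m pauli a3 b3 c3) =
  2 * I * (a1 * (b2 * c3 - c2 * b3) + b1 * (c2 * a3 - a2 * c3)
           + c1 * (a2 * b3 - b2 * a3))%:C :> C.
Proof.
rewrite /mxtrace sum_ord2 ![(_ *m _) _ _]mxE !sum_ord2 ![(_ *m _) _ _]mxE !sum_ord2.
by rewrite !pauliE !CE; ring: I2.
Qed.

Lemma pauli_conj a b c a' b' c' : a ^+ 2 + b ^+ 2 + c ^+ 2 = 1 ->
  let l := 2 * (a * a' + b * b' + c * c') in
  pauli a b c *m pauli a' b' c' *m pauli a b c =
  pauli (l * a - a') (l * b - b') (l * c - c') :> 'M[C]_2.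
Proof.
move=> n1 l.
have n2 : c%:C ^+ 2 = 1 - a%:C ^+ 2 - b%:C ^+ 2 :> C.
  by rewrite -!rmorphXn -[1]/(1%:C) -!rmorphB -n1; congr (_%:C); ring.
have mulE (A B : 'M[C]_2) i j : (A *m B) i j = A i 0 * B 0 j + A i 1 * B 1 j.
  by rewrite mxE sum_ord2.
have ext (A B : 'M[C]_2) : A 0 0 = B 0 0 -> A 0 1 = B 0 1 -> A 1 0 = B 1 0 ->
    A 1 1 = B 1 1 -> A = B.
  move=> E00 E01 E10 E11; apply/matrixP => i j.
  by case: (ord2_cases i) => ->; case: (ord2_cases j) => ->.
by apply: ext; rewrite !mulE !pauliE /l !CE; ring: I2 n2.
Qed.

Section Polynomials.
Variable P : 'M[C]_2.

Definition coord_poly (j : 'I_2) : mpoly 2 C :=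
  \sum_i mpolyC 2 (invmx P j i) * mpolyX C (mnm1 i).
Definition axis_poly (n : C * C * C) : mpoly 2 C :=
  let x := coord_poly 0 in let y := coord_poly 1 in
    mpolyC 2 n.1.1 * (x * x - y * y) + mpolyC 2 (n.1.2 * I) * (x * x + y * y)
  - mpolyC 2 (2 * n.2) * (x * y).
Definition axis_sum_poly N k := \sum_(n <- N) axis_poly n ^+ k.

Lemma eval_coord_poly j u : mxpoly_eval (coord_poly j) u = (invmx P *m u) j 0.
Proof.
rewrite /mxpoly_eval raddf_sum mxE; apply: eq_bigr => i _.
by rewrite /= mevalM mevalC mevalXU.
Qed.

Lemma eval_axis_poly n u :
  mxpoly_eval (axis_poly n) u = axis_form n (invmx P *m u).
Proof.
have Ex := eval_coord_poly 0 u; have Ey := eval_coord_poly 1 u.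
rewrite /mxpoly_eval in Ex Ey *.
rewrite /axis_poly mevalB mevalD !mevalM !mevalC mevalB mevalD !mevalM Ex Ey.
by rewrite /axis_form /null1 /null2 /null3; ring.
Qed.

Lemma eval_axis_sum_poly N k u :
  mxpoly_eval (axis_sum_poly N k) u = axis_sum N k (invmx P *m u).
Proof.
rewrite /mxpoly_eval raddf_sum; apply: eq_bigr => n _ /=.
by rewrite rmorphXn /= -eval_axis_poly.
Qed.

Lemma axis_sum_poly_homog N k : axis_sum_poly N k \is ishomog1 (2 * k)%N mdeg.
Proof.
have hc j : coord_poly j \is ishomog1 1 mdeg.
  rewrite /coord_poly; apply: (big_ind (fun f => f \is ishomog1 1 mdeg)).
  - exact: dhomog0.
  - by move=> f g; exact: dhomogD.
  - by move=> i _; rewrite mul_mpolyC dhomogZ // dhomogX; apply/eqP; exact: mdeg1.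
have hcc i j : coord_poly i * coord_poly j \is ishomog1 2 mdeg by exact: (dhomogM (hc i) (hc j)).
have hB (f g : mpoly 2 C) : f \is ishomog1 2 mdeg -> g \is ishomog1 2 mdeg ->
    f - g \is ishomog1 2 mdeg.
  by move=> hf hg; rewrite -scaleN1r; apply: dhomogD => //; exact: dhomogZ.
have hq n : axis_poly n \is ishomog1 2 mdeg.
  rewrite /axis_poly !mul_mpolyC; apply: (hB); last by apply: dhomogZ; exact: hcc.
  by apply: dhomogD; apply: dhomogZ; [apply: (hB) | apply: dhomogD]; exact: hcc.
rewrite /axis_sum_poly; apply: (big_ind (fun f => f \is ishomog1 (2 * k)%N mdeg)).
- exact: dhomog0.
- by move=> f g; exact: dhomogD.
- by move=> n _; exact: dhomogMn.
Qed.

End Polynomials.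

(** The value of an axis form along the line of threefold_line. *)
Definition axis_line (w3 : C) (n : C * C * C) : C * C * C :=
  (n.1.1 + n.1.2 * w3 + n.2 * w3 ^+ 2, n.1.1 + n.1.2 + n.2,
   - (n.1.1 + n.1.2 * w3 ^+ 2 + n.2 * w3) / 2).

Lemma axis_sum_line w3 u w N k :
  (forall t, [/\ null1 (u + t *: w) = 1 + t - t ^+ 2 / 2,
      null2 (u + t *: w) = w3 + t - w3 ^+ 2 * t ^+ 2 / 2 &
      null3 (u + t *: w) = w3 ^+ 2 + t - w3 * t ^+ 2 / 2]) ->
  forall t, axis_sum N k (u + t *: w) =
    (\sum_(n <- N) quadratic (axis_line w3 n) ^+ k).[t].
Proof.
move=> H t; rewrite horner_sum; apply: eq_bigr => n _; rewrite horner_exp.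
have [E1 E2 E3] := H t; congr (_ ^+ _).
rewrite /axis_form E1 E2 E3 /quadratic /axis_line /= !hornerE /=.
by field.
Qed.

End AxisForms.

(** * Groups generated by Pauli reflections *)

Section BinaryGroups.
Variable R : realType.
Local Notation C := R[i].
Local Notation V := 'cV[C]_2.
Local Notation I := ('i%C : C).
Let I2 : I ^+ 2 = -1 := sqr_i R.

Definition unit_vector (v : R * R * R) := v.1.1 ^+ 2 + v.1.2 ^+ 2 + v.2 ^+ 2 = 1.
Definition pauli_vector (v : R * R * R) : 'M[C]_2 := pauli v.1.1 v.1.2 v.2.

Lemma pauli_vector_unit v : unit_vector v -> pauli_vector v \in unitmx.
Proof. by move=> v1; rewrite unitmxE pauli_det // unitrN unitr1. Qed.

Lemma pauli_vector_det v : unit_vector v -> (\det (pauli_vector v)) ^+ 2 = 1.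
Proof. by move=> v1; rewrite pauli_det // sqrrN expr1n. Qed.

Lemma cube_root : exists w3 : C, w3 ^+ 2 = - w3 - 1.
Proof.
have two : (2 : C) != 0 by rewrite pnatr_eq0.
exists ((-1 + sqrtC (-3)) / 2).
have s3 : sqrtC (-3 : C) ^+ 2 = -3 by rewrite sqrtCK.
by field: s3.
Qed.

Lemma axis_sum_jets (w3 : C) (N : seq (C * C * C)) k :
  let p := \sum_(n <- N) quadratic (axis_line w3 n) ^+ k.+3 in
  let a n := (axis_line w3 n).1.1 in let b n := (axis_line w3 n).1.2 in
  let c n := (axis_line w3 n).2 in
  [/\ p.[0] = \sum_(n <- N) a n ^+ k.+3,
      p^`().[0] = \sum_(n <- N) k.+3%:R * a n ^+ k.+2 * b n,
      p^`()^`().[0] = \sum_(n <- N)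
        k.+3%:R * (k.+2%:R * a n ^+ k.+1 * b n ^+ 2 + 2 * a n ^+ k.+2 * c n) &
      p^`()^`()^`().[0] = \sum_(n <- N) k.+3%:R * k.+2%:R *
        (k.+1%:R * a n ^+ k * b n ^+ 3 + 6 * a n ^+ k.+1 * (b n * c n))].
Proof.
move=> p a b c.
have J n := quadratic_jets (a n) (b n) (c n) k.
split; rewrite /p ?raddf_sum /= ?raddf_sum /= ?raddf_sum /= horner_sum;
  by apply: eq_bigr => n _; case: (J n).
Qed.

Lemma axis_sum_separates (N : seq (C * C * C)) (m : nat) (u : V) :
  (forall u, (forall n, n \in N -> axis_form n u = 0) -> u = 0) ->
  u != 0 -> exists k, axis_sum N (m.+1 * k.+1) u != 0.
Proof.
move=> Nsep u0; apply: contrapT => /forallNP H.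
have s0 k : \sum_(a <- [seq axis_form n u ^+ m.+1 | n <- N]) a ^+ k.+1 = 0.
  have /negP := H k; rewrite negbK /axis_sum => /eqP Hk.
  by rewrite big_map -[RHS]Hk; apply: eq_bigr => n _; rewrite exprM.
move/eqP: u0; apply; apply: Nsep => n Nn.
have := power_sums_eq0 s0 (map_f (fun n => axis_form n u ^+ m.+1) Nn).
by move=> /eqP; rewrite expf_eq0 => /andP[_ /eqP].
Qed.

(** The hypothesis compares m-th powers, so that the axes need only be permuted up
    to sign when m = 2. *)
Lemma axis_sum_permuted N (s : seq nat) m k (g : 'M[C]_2) u :
  let n j := nth (0, 0, 0) N j in
  perm_eq s (iota 0 (size N)) ->
  (forall j, (j < size N)%N ->
    axis_form (n j) (g *m u) ^+ m = axis_form (n (nth 0%N s j)) u ^+ m) ->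
  axis_sum N (m * k) (g *m u) = axis_sum N (m * k) u.
Proof.
move=> n sN H; rewrite /axis_sum [RHS](big_nth (0, 0, 0)) [LHS](big_nth (0, 0, 0)).
have sizes : size s = size N by rewrite (perm_size sN) size_iota.
have iotaE : index_iota 0 (size N) = iota 0 (size N) by rewrite /index_iota subn0.
rewrite [in RHS]iotaE -[RHS](perm_big _ sN) [RHS](big_nth 0%N) sizes.
by apply: eq_big_nat => j /andP[_ jN]; rewrite !exprM H.
Qed.

Section Conjugates.
Variables (vs : seq (R * R * R)) (P : 'M[C]_2).
Hypotheses (Pu : P \in unitmx) (vs1 : forall v, v \in vs -> unit_vector v).
Let s := [seq pauli_vector v | v <- vs].
Let G : set 'M[C]_2 := [set P *m h *m invmx P | h in mxgroup_gen s].

Lemma pauli_gens_unit g : g \in s -> g \in unitmx.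
Proof. by case/mapP => v /vs1 v1 ->; exact: pauli_vector_unit. Qed.

Lemma pauli_group_det g : G g -> (\det g) ^+ 2 = 1.
Proof.
apply: (conj_det Pu pauli_gens_unit) => _ /mapP[v /vs1 v1 ->].
exact: pauli_vector_det.
Qed.

Lemma axis_sum_invariant N k :
  (forall v u, v \in vs -> axis_sum N k (pauli_vector v *m u) = axis_sum N k u) ->
  invariant_mpoly G (axis_sum_poly P N k).
Proof.
move=> Ninv; apply: (conj_invariant Pu pauli_gens_unit (phi := axis_sum N k)).
  by move=> _ u /mapP[v vvs ->]; exact: Ninv.
exact: eval_axis_sum_poly.
Qed.

(** An eigenvalue of an element of the group, being a primitive root of unity,
    bounds the largest degree from below. *)
Lemma pauli_degree_bound d x N m (g : 'M[C]_2) mu l :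
  basic_invariants G d x ->
  (forall k v u, v \in vs ->
     axis_sum N (m.+1 * k) (pauli_vector v *m u) = axis_sum N (m.+1 * k) u) ->
  (forall u, (forall n, n \in N -> axis_form n u = 0) -> u = 0) ->
  mxgroup_gen s g -> mu ^+ 2 - \tr g * mu + \det g = 0 ->
  l.-primitive_root mu -> (l <= d ord0)%N.
Proof.
move=> basic Ninv Nsep sg gmu mul.
have [u u0 gu] := eigenvector2 gmu.
have [k Nk] := axis_sum_separates m Nsep u0.
apply: (@degree_bound _ _ _ _ _ basic (P *m g *m invmx P) (P *m u) mu l
  (axis_sum_poly P N (m.+1 * k.+1))) => //.
- exact: conj_mem.
- by rewrite -mulmxA mulKmx // -mulmxA gu scalemxAr.
- by apply: axis_sum_invariant => v v' vvs; exact: Ninv.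
- rewrite !eval_axis_sum_poly mulKmx // mulmx0.
  rewrite [X in _ != X](_ : _ = 0) //.
  rewrite /axis_sum big1 // => n _.
  have -> : axis_form n (0 : V) = 0.
    by rewrite /axis_form /null1 /null2 /null3 !mxE; ring.
  by rewrite expr0n.
Qed.

(** The line of threefold_line joins two eigenvectors of a rotation of order
    three, and the invariants have few terms in these coordinates. *)
Lemma pauli_obstruction d x r Gam mul e N k l w3 :
  w3 ^+ 2 = - w3 - 1 ->
  basic_invariants G d x -> natural_almost_saito G d x r Gam mul e ->
  (forall v u, v \in vs -> axis_sum N k.+3 (pauli_vector v *m u) = axis_sum N k.+3 u) ->
  (forall v u, v \in vs -> axis_sum N l.+3 (pauli_vector v *m u) = axis_sum N l.+3 u) ->
  (2 * k.+3 < d ord0)%N ->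
  let p := \sum_(n <- N) quadratic (axis_line w3 n) ^+ k.+3 in
  let q := \sum_(n <- N) quadratic (axis_line w3 n) ^+ l.+3 in
  p.[0] != 0 -> p^`().[0] = 0 -> p^`()^`().[0] = 0 -> q^`().[0] != 0 ->
  p^`()^`()^`().[0] = 0.
Proof.
move=> w32 basic natural kinv linv kd p q p0 p1 p2 q1.
have [u [w uw]] := threefold_line w32.
have E j t : mxpoly_eval (axis_sum_poly P N j) (P *m u + t *: (P *m w)) =
    (\sum_(n <- N) quadratic (axis_line w3 n) ^+ j).[t].
  rewrite eval_axis_sum_poly -(axis_sum_line _ _ uw); congr axis_sum.
  by rewrite scalemxAr -mulmxDr mulKmx.
refine (rank2_obstruction basic natural pauli_group_det (axis_sum_invariant kinv)
  (axis_sum_poly_homog P N k.+3) _ (axis_sum_invariant linv)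
  (axis_sum_poly_homog P N l.+3) (E _) (E _) p0 p1 p2 q1).
by rewrite kd andbT.
Qed.

End Conjugates.
End BinaryGroups.

(** * The group G12 *)

Section G12.
Variable R : realType.
Local Notation C := R[i].
Local Notation V := 'cV[C]_2.
Local Notation I := ('i%C : C).
Let I2 : I ^+ 2 = -1 := sqr_i R.

Lemma natr_neq0 k : (k.+1%:R : C) != 0.
Proof. by rewrite pnatr_eq0. Qed.

Lemma oppr1_neq1 : (-1 : C) != 1.
Proof. by rewrite -subr_eq0 -opprD oppr_eq0 (natr_neq0 1). Qed.

Lemma quadratic_root (t D : C) : exists mu, mu ^+ 2 - t * mu + D = 0.
Proof.
have s2 : sqrtC (t ^+ 2 - 4 * D) ^+ 2 = t ^+ 2 - 4 * D by rewrite sqrtCK.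
have two := natr_neq0 1.
by exists ((t + sqrtC (t ^+ 2 - 4 * D)) / 2); field: s2.
Qed.

Section HalfRoot.
Variable t : R.
Hypothesis tt : t ^+ 2 = 2.
Let h := t / 2.
Let tC : t%:C ^+ 2 = 2 :> C.
Proof. by rewrite -rmorphXn tt rmorph_nat. Qed.
Let hC : h%:C = t%:C / 2 :> C.
Proof. by rewrite /h rmorphM fmorphV rmorph_nat. Qed.

Definition tetrahedron : seq (C * C * C) :=
  [:: (1, 1, 1); (1, -1, -1); (-1, 1, -1); (-1, -1, 1)].

Let vs12 : seq (R * R * R) := [:: (h, 0, h); (- h, 0, h); (h, - h, 0)].

Let vs12_unit v : v \in vs12 -> unit_vector v.
Proof.
have two : (2 : R) != 0 by rewrite pnatr_eq0.
by rewrite !inE => /or3P[] /eqP ->; rewrite /unit_vector /h /=; field: tt.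
Qed.

Let real0 : (0 : R)%:C = 0 :> C. Proof. by []. Qed.
Let realN (a : R) : (- a)%:C = - a%:C :> C. Proof. exact: rmorphN. Qed.

Lemma tetrahedron_sum_invariant k v u : v \in vs12 ->
  axis_sum tetrahedron k (pauli_vector v *m u) = axis_sum tetrahedron k u.
Proof.
have two := natr_neq0 1.
move=> vvs; have E n := axis_form_pauli n u (vs12_unit vvs).
rewrite -[k]mul1n; move: vvs E; rewrite !inE => /or3P[] /eqP ->;
  rewrite /pauli_vector; cbn [fst snd]; rewrite ?realN ?real0 ?hC => E;
  [apply: (axis_sum_permuted (s := [:: 2; 1; 0; 3]%N)) |
   apply: (axis_sum_permuted (s := [:: 0; 3; 2; 1]%N)) |
   apply: (axis_sum_permuted (s := [:: 0; 2; 1; 3]%N))] => //;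
  move=> [|[|[|[|//]]]] _; cbn [nth tetrahedron]; congr (_ ^+ 1);
  by rewrite E /axis_form; cbn [fst snd]; field: tC.
Qed.

Lemma tetrahedron_separates (u : V) :
  (forall n, n \in tetrahedron -> axis_form n u = 0) -> u = 0.
Proof.
move=> H; have two := natr_neq0 1.
have E1 := H (1, 1, 1); have E2 := H (1, -1, -1); have E3 := H (-1, 1, -1).
rewrite !inE !eqxx ?orbT /= in E1 E2 E3.
move: (E1 isT) (E2 isT) (E3 isT); rewrite /axis_form /= => {}E1 {}E2 {}E3.
apply: null_eq0.
  transitivity (((1 * null1 u + 1 * null2 u + 1 * null3 u) +
    (1 * null1 u + -1 * null2 u + -1 * null3 u)) / 2); first by field.
  by rewrite E1 E2 addr0 mul0r.
transitivity (((1 * null1 u + 1 * null2 u + 1 * null3 u) +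
  (-1 * null1 u + 1 * null2 u + -1 * null3 u)) / 2); first by field.
by rewrite E1 E3 addr0 mul0r.
Qed.

(** The product of the generators has an eigenvalue of order 8, so the invariant
    of degree 6 lies below the largest degree; on the line of threefold_line its
    first two derivatives vanish, but not the third. *)
Lemma G12_obstruction (P : 'M[C]_2) : P \in unitmx ->
  ~ admits_natural_almost_saito
      [set P *m g *m invmx P | g in mxgroup_gen [seq pauli_vector v | v <- vs12]].
Proof.
move=> Pu [d [x [r [Gam [mul [e [basic natural]]]]]]].
have two := natr_neq0 1.
have [w3 w32] := cube_root R.
pose g1 : 'M[C]_2 := pauli h 0 h; pose g2 : 'M[C]_2 := pauli (- h) 0 h.
pose g3 : 'M[C]_2 := pauli h (- h) 0.
have [mu Hmu] := quadratic_root (\tr (g1 *m g2 *m g3)) (\det (g1 *m g2 *m g3)).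
have d1 : \det g1 = -1.
  by apply: pauli_det; apply: (@vs12_unit (h, 0, h)); rewrite !inE eqxx ?orbT.
have d2 : \det g2 = -1.
  by apply: pauli_det; apply: (@vs12_unit (- h, 0, h)); rewrite !inE eqxx ?orbT.
have d3 : \det g3 = -1.
  by apply: pauli_det; apply: (@vs12_unit (h, - h, 0)); rewrite !inE eqxx ?orbT.
have Gs := mxgroup_gen_group (pauli_gens_unit vs12_unit).
have d8 : (8 <= d ord0)%N.
  apply: (pauli_degree_bound (m := 0) (g := g1 *m g2 *m g3) (mu := mu) Pu
    vs12_unit basic _ tetrahedron_separates) => //.
  - by move=> k v u vvs; exact: tetrahedron_sum_invariant.
  - by apply: (mxgroupM Gs); [apply: (mxgroupM Gs)|];
      apply: mxgroup_gen_mem; rewrite !inE eqxx ?orbT.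
  - have mu2 : mu ^+ 2 = 2 * I * h%:C * mu + 1.
      move: Hmu; rewrite pauli_trace3 !det_mulmx d1 d2 d3.
      rewrite [X in X%:C](_ : _ = h); last first.
        have two' : (2 : R) != 0 by rewrite pnatr_eq0.
        by rewrite /h; field: tt.
      move=> Hm; transitivity (2 * I * h%:C * mu + 1 +
        (mu ^+ 2 - 2 * I * h%:C * mu + -1 * -1 * -1)); first by ring.
      by rewrite Hm addr0.
    have mu2' : mu ^+ 2 = I * t%:C * mu + 1 by rewrite mu2 hC; field.
    have mu4 : mu ^+ 4 = -1 by ring: mu2' I2 tC.
    apply: primitive_rootP => //.
      by rewrite -[8%N]/((4 * 2)%N) exprM mu4 sqrrN expr1n.
    move=> p; rewrite -[primes 8]/[:: 2%N] inE => /eqP ->.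
    by rewrite -[(8 %/ 2)%N]/4%N mu4 oppr1_neq1.
have [p0 p1 p2 p3] := axis_sum_jets w3 tetrahedron 0.
have [_ q1 _ _] := axis_sum_jets w3 tetrahedron 1.
have := @pauli_obstruction _ vs12 P Pu vs12_unit d x r Gam mul e tetrahedron 0 1
  w3 w32 basic natural (@tetrahedron_sum_invariant _) (@tetrahedron_sum_invariant _) _.
cbv zeta; rewrite p0 p1 p2 p3 q1 /tetrahedron !big_cons !big_nil /axis_line /=.
move=> /(_ (leq_trans (isT : (6 < 8)%N) d8)).
rewrite [X in X != 0](_ : _ = 24); last by field: w32.
move=> /(_ (natr_neq0 23)).
rewrite [X in X = 0 -> _](_ : _ = 0); last by field: w32.
move=> /(_ erefl).
rewrite [X in X = 0 -> _](_ : _ = 0); last by field: w32.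
move=> /(_ erefl).
rewrite [X in X != 0](_ : _ = - 96); last by field: w32.
rewrite oppr_eq0 => /(_ (natr_neq0 95)).
rewrite [X in X = 0](_ : _ = 360); last by field: w32.
by move/eqP; rewrite (negbTE (natr_neq0 359)).
Qed.

End HalfRoot.

Lemma inv_sqrt2 : (Num.sqrt 2)^-1 = Num.sqrt 2 / 2 :> R.
Proof.
have s2 : Num.sqrt 2 != 0 :> R by rewrite gt_eqF // sqrtr_gt0.
by apply: (mulfI s2); rewrite divff // mulrA -expr2 sqr_sqrtr // divff // pnatr_eq0.
Qed.

Lemma G12_no_natural_almost_saito (G : set 'M[C]_2) :
  is_G12 G -> ~ admits_natural_almost_saito G.
Proof.
move=> [P Pu ->]; rewrite inv_sqrt2.
by apply: G12_obstruction => //; rewrite sqr_sqrtr.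
Qed.

End G12.

(** * The group G22 *)

Section G22.
Variable R : realType.
Local Notation C := R[i].
Local Notation V := 'cV[C]_2.
Local Notation I := ('i%C : C).
Let I2 : I ^+ 2 = -1 := sqr_i R.

Section GoldenRatio.
Variables (tau : R) (T : C).
Hypotheses (tautau : tau ^+ 2 = tau + 1) (Ttau : T = tau%:C).
Let TT : T ^+ 2 = T + 1.
Proof. by rewrite Ttau -rmorphXn tautau rmorphD rmorph1. Qed.

(** The six axes through the vertices of an icosahedron. *)
Definition icosahedron : seq (C * C * C) :=
  [:: (0, 1, T); (0, -1, T); (T, 0, 1); (T, 0, -1); (1, T, 0); (-1, T, 0)].

Let vs22 : seq (R * R * R) :=
  [:: (0, 0, 1); (1, 0, 0); (tau / 2, 1 / 2, (tau - 1) / 2)].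

Let vs22_unit v : v \in vs22 -> unit_vector v.
Proof.
have two : (2 : R) != 0 by rewrite pnatr_eq0.
by rewrite !inE => /or3P[] /eqP ->; rewrite /unit_vector /=; field: tautau.
Qed.

Let real1 : (1 : R)%:C = 1 :> C. Proof. by []. Qed.
Let realT : (tau / 2)%:C = T / 2 :> C.
Proof. by rewrite rmorphM fmorphV rmorph_nat Ttau. Qed.
Let realH : (1 / 2 : R)%:C = 1 / 2 :> C.
Proof. by rewrite rmorphM fmorphV rmorph_nat rmorph1. Qed.
Let realT1 : ((tau - 1) / 2)%:C = (T - 1) / 2 :> C.
Proof. by rewrite rmorphM fmorphV rmorph_nat rmorphB rmorph1 Ttau. Qed.

Lemma icosahedron_sum_invariant k v u : v \in vs22 ->
  axis_sum icosahedron (2 * k) (pauli_vector v *m u) = axis_sum icosahedron (2 * k) u.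
Proof.
have two := natr_neq0 R 1.
move=> vvs; have E n := axis_form_pauli n u (vs22_unit vvs).
move: vvs E; rewrite !inE => /or3P[] /eqP ->;
  rewrite /pauli_vector; cbn [fst snd]; rewrite ?real0 ?real1 ?realT ?realH ?realT1 => E;
  [apply: (axis_sum_permuted (s := [:: 1; 0; 3; 2; 4; 5]%N)) |
   apply: (axis_sum_permuted (s := [:: 0; 1; 3; 2; 5; 4]%N)) |
   apply: (axis_sum_permuted (s := [:: 3; 1; 4; 0; 2; 5]%N))] => //;
  move=> [|[|[|[|[|[|//]]]]]] _; cbn [nth icosahedron];
  by rewrite E /axis_form; cbn [fst snd]; field: TT.
Qed.

Lemma icosahedron_separates (u : V) :
  (forall n, n \in icosahedron -> axis_form n u = 0) -> u = 0.
Proof.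
move=> H; have two := natr_neq0 R 1.
have E1 := H (0, 1, T); have E2 := H (0, -1, T).
have E3 := H (T, 0, 1); have E4 := H (T, 0, -1).
rewrite !inE !eqxx ?orbT in E1 E2 E3 E4.
move: (E1 isT) (E2 isT) (E3 isT) (E4 isT); rewrite /axis_form; cbn [fst snd].
move=> {}E1 {}E2 {}E3 {}E4.
apply: null_eq0; last first.
  transitivity (((0 * null1 u + 1 * null2 u + T * null3 u) -
    (0 * null1 u + -1 * null2 u + T * null3 u)) / 2); first by field.
  by rewrite E1 E2 subr0 mul0r.
transitivity ((T - 1) * ((T * null1 u + 0 * null2 u + 1 * null3 u) +
    (T * null1 u + 0 * null2 u + -1 * null3 u)) / 2); first by field: TT.
by rewrite E3 E4 addr0 mulr0 mul0r.
Qed.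

(** As for G12, with an eigenvalue of order 20 and the invariant of degree 12. *)
Lemma G22_obstruction (P : 'M[C]_2) : P \in unitmx ->
  ~ admits_natural_almost_saito
      [set P *m g *m invmx P | g in mxgroup_gen [seq pauli_vector v | v <- vs22]].
Proof.
move=> Pu [d [x [r [Gam [mul [e [basic natural]]]]]]].
have two := natr_neq0 R 1.
have two' : (2 : R) != 0 by rewrite pnatr_eq0.
have [w3 w32] := cube_root R.
pose g1 : 'M[C]_2 := pauli 0 0 1; pose g2 : 'M[C]_2 := pauli 1 0 0.
pose g3 : 'M[C]_2 := pauli (tau / 2) (1 / 2) ((tau - 1) / 2).
pose g := g1 *m g2 *m (g3 *m g2 *m g3).
have [mu Hmu] := quadratic_root (\tr g) (\det g).
have d1 : \det g1 = -1.
  by apply: pauli_det; apply: (@vs22_unit (0, 0, 1)); rewrite !inE eqxx ?orbT.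
have d2 : \det g2 = -1.
  by apply: pauli_det; apply: (@vs22_unit (1, 0, 0)); rewrite !inE eqxx ?orbT.
have n3 : unit_vector (tau / 2, 1 / 2, (tau - 1) / 2).
  by apply: vs22_unit; rewrite !inE eqxx ?orbT.
have d3 : \det g3 = -1 by exact: pauli_det.
have Gs := mxgroup_gen_group (pauli_gens_unit vs22_unit).
have d20 : (20 <= d ord0)%N.
  apply: (pauli_degree_bound (m := 1) (g := g) (mu := mu) Pu
    vs22_unit basic _ icosahedron_separates) => //.
  - by move=> k v u vvs; exact: icosahedron_sum_invariant.
  - by do ![apply: (mxgroupM Gs)]; apply: mxgroup_gen_mem; rewrite !inE eqxx ?orbT.
  - have mu2 : mu ^+ 2 = I * T * mu + 1.
      move: Hmu; rewrite /g !det_mulmx d1 d2 d3 (pauli_conj _ _ _ n3) pauli_trace3.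
      rewrite [X in X%:C](_ : _ = tau / 2); last by cbn [fst snd]; field.
      rewrite realT => Hm; transitivity (I * T * mu + 1 +
        (mu ^+ 2 - 2 * I * (T / 2) * mu + -1 * -1 * (-1 * -1 * -1))); first by field.
      by rewrite Hm addr0.
    have mu10 : mu ^+ 10 = -1 by ring: mu2 I2 TT.
    apply: primitive_rootP => //.
      by rewrite -[20%N]/((10 * 2)%N) exprM mu10 sqrrN expr1n.
    move=> p; rewrite -[primes 20]/[:: 2%N; 5%N] !inE => /orP[] /eqP ->.
      by rewrite -[(20 %/ 2)%N]/10%N mu10 (oppr1_neq1 R).
    rewrite -[(20 %/ 5)%N]/4%N; apply/eqP => mu4.
    have mum : mu ^+ 2 = -1.
      by rewrite -mu10 -[10%N]/((4 * 2 + 2)%N) exprD exprM mu4 expr1n mul1r.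
    have T4 : (I * T * mu) ^+ 2 = 4.
      have -> : I * T * mu = mu ^+ 2 - 1 by rewrite mu2 addrK.
      by rewrite mum; ring.
    have T3 : T = 3.
      have -> : T = (I * T * mu) ^+ 2 - 1 by ring: mum I2 TT.
      by rewrite T4; ring.
    have : (5 : C) = 0.
      have -> : (5 : C) = T ^+ 2 - (T + 1) by rewrite T3; ring.
      by rewrite TT subrr.
    by move/eqP; rewrite (negbTE (natr_neq0 R 4)).
have [p0 p1 p2 p3] := axis_sum_jets w3 icosahedron 3.
have [_ q1 _ _] := axis_sum_jets w3 icosahedron 7.
have := @pauli_obstruction _ vs22 P Pu vs22_unit d x r Gam mul e icosahedron 3 7
  w3 w32 basic natural (@icosahedron_sum_invariant 3) (@icosahedron_sum_invariant 5)
  (leq_trans (isT : (12 < 20)%N) d20).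
cbv zeta; rewrite p0 p1 p2 p3 q1 /icosahedron !big_cons !big_nil /axis_line.
cbn [fst snd].
(* These numbers are nonzero because their products with a conjugate are integers:
   T has the conjugate 1 - T, and w3 has the conjugate - 1 - w3. *)
have E0 : T ^+ 2 + 3 * w3 != 0.
  apply/eqP => E; have : (8 : C) = (T ^+ 2 + 3 * w3) * (T ^+ 2 - 3 - 3 * w3).
    by ring: w32 TT.
  by rewrite E mul0r => /eqP; rewrite (negbTE (natr_neq0 R 7)).
have T0 : T != 0.
  apply/eqP => E; have : (1 : C) = T * (T - 1) by ring: TT.
  by rewrite E mul0r => /eqP; rewrite oner_eq0.
rewrite [X in X != 0](_ : _ = 3 * (8 * T + 6) * (T ^+ 2 + 3 * w3) ^+ 2); last by field: w32 TT.
have -> : 3 * (8 * T + 6) * (T ^+ 2 + 3 * w3) ^+ 2 != 0.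
  rewrite !mulf_neq0 ?expf_neq0 ?(natr_neq0 R) //.
  apply/eqP => E; have : (20 : C) = (8 * T + 6) * (14 - 8 * T) by ring: TT.
  by rewrite E mul0r => /eqP; rewrite (negbTE (natr_neq0 R 19)).
move=> /(_ isT).
rewrite [X in X = 0 -> _](_ : _ = 0); last by field: w32 TT.
move=> /(_ erefl).
rewrite [X in X = 0 -> _](_ : _ = 0); last by field: w32 TT.
move=> /(_ erefl).
rewrite [X in X != 0](_ : _ = 30 * T ^+ 2 * (8 * T + 4) * (T ^+ 2 + 3 * w3) ^+ 3);
  last by field: w32 TT.
have -> : 30 * T ^+ 2 * (8 * T + 4) * (T ^+ 2 + 3 * w3) ^+ 3 != 0.
  rewrite !mulf_neq0 ?expf_neq0 ?(natr_neq0 R) //.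
  apply/eqP => E; have : (-16 : C) = (8 * T + 4) * (12 - 8 * T) by ring: TT.
  by rewrite E mul0r => /eqP; rewrite oppr_eq0 (negbTE (natr_neq0 R 15)).
move=> /(_ isT).
rewrite [X in X = 0](_ : _ = - (1980 * T ^+ 3 * (T ^+ 2 + 3 * w3))); last by field: w32 TT.
by apply/eqP; rewrite oppr_eq0 !mulf_neq0 ?expf_neq0 ?(natr_neq0 R).
Qed.

End GoldenRatio.

Lemma G22_no_natural_almost_saito (G : set 'M[C]_2) :
  is_G22 G -> ~ admits_natural_almost_saito G.
Proof.
set tau : R := (1 + Num.sqrt 5) / 2.
have two' : (2 : R) != 0 by rewrite pnatr_eq0.
have s5 : Num.sqrt 5 ^+ 2 = 5 :> R by rewrite sqr_sqrtr.
have tautau : tau ^+ 2 = tau + 1 by rewrite /tau; field: s5.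
have tau0 : tau != 0.
  apply/eqP => E; move: tautau; rewrite E expr0n add0r => /eqP.
  by rewrite eq_sym oner_eq0.
have tauV : tau^-1 = tau - 1.
  by apply: (mulfI tau0); rewrite divff // mulrBr mulr1 -expr2 tautau addrAC subrr add0r.
move=> [P Pu ->]; rewrite -/tau tauV.
exact: (G22_obstruction tautau erefl Pu).
Qed.

End G22.

(** * Rigidity in rank two *)

Section HessianAlongUnit.
Variables (R : realType) (n : nat).
Local Notation C := R[i].
Local Notation V := 'cV[C]_n.+1.
Variables (G : set 'M[C]_n.+1) (d : 'I_n.+1 -> nat) (x : 'I_n.+1 -> mpoly n.+1 C).
Variables (r : C) (Gam mul : V -> V -> V -> V) (e : V -> V).
Hypothesis natural : natural_almost_saito G d x r Gam mul e.
Variable c : V.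
Hypothesis ec : forall p, M0 G x p -> e p = c.
Local Notation X := (frame_unit x c).
Local Notation A := (frame_mul x mul c).
Local Notation Q := (frame_conn x c).

Lemma pdiff2_delta (h : mpoly n.+1 C) u v i :
  pdiff2 h u v (delta_mx i 0) = pdiff (mderiv i h) u v.
Proof.
rewrite pdiff2C /pdiff2 (bigD1 i) //= big1 => [|j /negbTE ji].
  by rewrite !mxE !eqxx mul1r addr0.
by rewrite mxE ji mul0r.
Qed.

(** The terms of is_derive_pdiff2_frame in the connection cancel against the
    derivative of the second argument. *)
Lemma is_derive_hessian (h q : mpoly n.+1 C) kappa u :
  h = comp_mpoly [tuple x a | a < n.+1] q ->
  \sum_a c a 0 *: mderiv a q = mpolyC n.+1 kappa -> regular_locus G x u ->
  is_derive u (X u) (fun p => pdiff2 h p (X p) (X p)) (- pdiff2 h u (X u) (A u (X u))).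
Proof.
move=> hq qc Wu.
have H1 := is_derive_pdiff2_frame natural ec hq qc (X u) Wu.
have HX i := is_derive_entry i 0 (is_derive_frame_unit c Wu).
have H2 := is_derive_bigsum (index_enum 'I_n.+1) (fun i => is_derive_mul
  (is_derive_pdiff2_frame natural ec hq qc (delta_mx i 0) Wu)
  (is_derive_add (HX i) (is_derive_cst (- X u i 0) u (X u)))).
have H := is_derive_add H1 H2.
refine (is_derive_val (is_derive_near (g := fun p => pdiff2 h p (X p) (X p)) _ H) _).
  near=> p => /=.
  transitivity (pdiff2 h p (X p) (X u + (X p - X u))); last first.
    by rewrite addrC subrK.
  rewrite pdiff2Dr; congr (_ + _).
  rewrite [RHS]pdiff2C [RHS]/pdiff2; apply: eq_bigr => i _.
  rewrite pdiff2_delta mulrC; congr (_ * _).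
  by rewrite [RHS]mxE [X in _ = _ + X]mxE.
rewrite -[RHS]addr0 -addrA; congr (_ + _).
apply/eqP; rewrite addrC subr_eq0; apply/eqP.
rewrite [RHS]pdiff2C [RHS]/pdiff2; apply: eq_bigr => i _.
by rewrite subrr mul0r !addr0 pdiff2_delta mulrC.
Unshelve. all: by end_near. Qed.

End HessianAlongUnit.

Section Rigidity.
Variable R : realType.
Local Notation C := R[i].
Local Notation V := 'cV[C]_2.
Variables (G : set 'M[C]_2) (d : 'I_2 -> nat) (x : 'I_2 -> mpoly 2 C).
Variables (r : C) (Gam mul : V -> V -> V -> V) (e : V -> V).
Hypotheses (basic : basic_invariants G d x)
  (natural : natural_almost_saito G d x r Gam mul e)
  (detG : forall g, G g -> (\det g) ^+ 2 = 1).
Variables (f h : mpoly 2 C) (kf kh : nat).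
Hypotheses (finv : invariant_mpoly G f) (fk : f \is ishomog1 kf mdeg)
  (hinv : invariant_mpoly G h) (hk : h \is ishomog1 kh mdeg)
  (kf0 : (0 < kf)%N) (kfd : (kf < d ord0)%N) (khd : (kh <= d ord0)%N).
Let fv := mxpoly_eval f.
Let hv := mxpoly_eval h.
Variables (al be al' ga de : C) (u0 : V).
Let F (p : V) := al * (hv p * hv p) + be * (fv p * (fv p * fv p)).
Let U : set V := [set u | [/\ fv u != 0, hv u != 0 & F u != 0]].
Hypotheses (Uu0 : U u0) (de0 : de != 0) (ga0 : ga != 0).
Hypothesis Ujac : forall u, U u ->
  pjac (fun a : 'I_2 => if a == 0 then f else h) u \in unitmx.
Hypothesis hessians : forall u v k, U u -> pdiff f u v = 0 -> pdiff h u v = k ->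
  F u * pdiff2 f u v v = de * k ^+ 2 * fv u /\
  hv u * F u * pdiff2 h u v v =
    k ^+ 2 * (al' * (hv u * hv u) + ga * (fv u * (fv u * fv u))).

Let Uneq0 u : U u -> [/\ fv u != 0, hv u != 0 & F u != 0]. Proof. by []. Qed.

Let openU : open U.
Proof.
pose Fp : mpoly 2 C := mpolyC 2 al * (h * h) + mpolyC 2 be * (f * (f * f)).
have FE u : mxpoly_eval Fp u = F u.
  by rewrite /mxpoly_eval mevalD !mevalM !mevalC.
have near_neq0 (g : mpoly 2 C) (u : V) : mxpoly_eval g u != 0 ->
    \forall p \near u, mxpoly_eval g p != 0.
  have := differentiable_continuous (differentiable_mpoly g u).
  by move=> /cvgr_neq0; apply.
have UE : U = [set u | mxpoly_eval (f * (h * Fp)) u != 0].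
  have gE u : mxpoly_eval (f * (h * Fp)) u = fv u * (hv u * F u).
    by rewrite -FE /mxpoly_eval !mevalM.
  apply/seteqP; split=> u; rewrite /= gE !mulf_eq0 !negb_or.
    by case=> -> -> ->.
  by case/and3P.
by rewrite UE openE => u; exact: near_neq0.
Qed.

(** Let X be the lifted unit field, scaled so that X f = 0 and X h = 1, and
    let mu X + nu u be the product of X with itself. Derivation along X gives
    X(D^2 f(X, X)) = - mu D^2 f(X, X) and X(nu) = - mu nu, so that the identity
    for D^2 f(X, X) makes F nu constant along X. The equation for D^2 h(X, X) then
    makes F D^2 h(X, X) = al' h + ga f^3 / h an affine function of h along X,
    against ga != 0. *)
Lemma rank2_rigidity : False.
Proof.
have Wu u : U u -> regular_locus G x u.
  move=> Uu; pose FF (a : 'I_2) := if a == 0 then f else h.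
  have Finv a : invariant_mpoly G (FF a) by rewrite /FF; case: ifP.
  exact: (regular_point basic detG Finv (Ujac Uu)).
have d_gt0 := homog0_pjac_unit (bi_homog basic) (Wu _ Uu0).1.
have [c [c0 ec cd]] := unit_field_const basic natural d_gt0.
have [qf [fq [kap' qfc /(_ kfd) kap0']]] :=
  admissible_representative basic d_gt0 cd finv fk (ltnW kfd).
rewrite {}kap0' in qfc.
have [qh [hq [kap qhc _]]] := admissible_representative basic d_gt0 cd hinv hk khd.
pose X := frame_unit x c; pose A := frame_mul x mul c.
have fX u : U u -> pdiff f u (X u) = 0.
  by move=> /Wu W; exact: (pdiff_frame_unit fq qfc W).
have hX u : U u -> pdiff h u (X u) = kap.
  by move=> /Wu W; exact: (pdiff_frame_unit hq qhc W).
have inj u v : U u -> pdiff f u v = 0 -> pdiff h u v = 0 -> v = 0.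
  move=> Uu fv0 hv0; rewrite -(mulKmx (Ujac Uu) v) pjac_mul.
  rewrite [X in _ *m X](_ : _ = 0) ?mulmx0 //; apply/colP => a.
  by rewrite mxE [RHS]mxE; case: (a == 0); [exact: fv0 | exact: hv0].
have kap0 : kap != 0.
  apply/eqP => E; have := frame_unit_neq0 c0 (Wu _ Uu0).
  by rewrite -/(X u0) (inj _ _ Uu0 (fX _ Uu0)) ?eqxx // hX.
have Hf u : U u -> is_derive u (X u) (fun p => pdiff2 f p (X p) (X p))
    (- pdiff2 f u (X u) (A u (X u))).
  by move=> /Wu W; exact: (is_derive_hessian natural ec fq qfc W).
have Hh u : U u -> is_derive u (X u) (fun p => pdiff2 h p (X p) (X p))
    (- pdiff2 h u (X u) (A u (X u))).
  by move=> /Wu W; exact: (is_derive_hessian natural ec hq qhc W).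
have Dn u : U u -> is_derive u (X u) (fun p => pdiff f p (A p (X p)))
    (- pdiff f u (A u (A u (X u)))).
  by move=> /Wu W; exact: (is_derive_pdiff_frame_mul natural ec fq qfc W).
have Alin u v w a : U u -> A u (a *: v + w) = a *: A u v + A u w.
  by move=> /Wu W; exact: (frame_mul_linear natural c v w a W).
have Aeuler u : U u -> A u u = (d ord0)%:R *: X u.
  by move=> /Wu W; exact: (frame_mul_euler basic natural d_gt0).
clearbody X A.
have fE u : pdiff f u u = kf%:R * fv u := mdeg_homog_euler u fk.
have hE u : pdiff h u u = kh%:R * hv u := mdeg_homog_euler u hk.
have kfr0 : (kf%:R : C) != 0 by rewrite pnatr_eq0 -lt0n.
have dec u v : U u -> exists m n, v = m *: X u + n *: u.
  move=> Uu; have [f0 _ _] := Uneq0 Uu.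
  pose n := pdiff f u v / (kf%:R * fv u).
  exists ((pdiff h u v - n * pdiff h u u) / kap), n.
  move: (X u) (fX u Uu) (hX u Uu) => w fw hw.
  have E (g : mpoly 2 C) a b : pdiff g u (a *: w + b *: u - v) =
      a * pdiff g u w + b * pdiff g u u - pdiff g u v.
    by rewrite -[- v]scaleN1r !pdiffD !pdiffZ mulN1r.
  have k0 : kf%:R * fv u != 0 by rewrite mulf_neq0.
  apply/eqP; rewrite eq_sym -subr_eq0; apply/eqP; apply: (inj u _ Uu); rewrite E.
    by rewrite fw fE mulr0 add0r divfK // subrr.
  by rewrite hw divfK // subrK subrr.
have Df u : U u -> is_derive u (X u) fv 0.
  by move=> Uu; apply: (is_derive_val (is_derive_mpoly f u (X u))); exact: fX.
have Dh u : U u -> is_derive u (X u) hv kap.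
  by move=> Uu; apply: (is_derive_val (is_derive_mpoly h u (X u))); exact: hX.
pose ff p := fv p * (fv p * fv p); pose hh p := hv p * hv p.
have Dff u : U u -> is_derive u (X u) ff 0.
  move=> Uu; apply: (is_derive_val (is_derive_mul (Df _ Uu)
    (is_derive_mul (Df _ Uu) (Df _ Uu)))); ring.
have Dhh u : U u -> is_derive u (X u) hh (2 * hv u * kap).
  by move=> Uu; apply: (is_derive_val (is_derive_mul (Dh _ Uu) (Dh _ Uu))); ring.
have Dlin a b u : U u ->
    is_derive u (X u) (fun p => a * hh p + b * ff p) (2 * a * hv u * kap).
  move=> Uu; apply: (is_derive_val (is_derive_add
    (is_derive_mul (is_derive_cst a u (X u)) (Dhh _ Uu))
    (is_derive_mul (is_derive_cst b u (X u)) (Dff _ Uu)))).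
  by rewrite /cst; ring.
have DF u : U u -> is_derive u (X u) F (2 * al * hv u * kap) by exact: Dlin.
have same (T1 T2 : V -> C) (d1 d2 : C) u : U u -> (forall p, U p -> T1 p = T2 p) ->
    is_derive u (X u) T1 d1 -> is_derive u (X u) T2 d2 -> d1 = d2.
  move=> Uu T12 D1 D2; apply: is_derive_unique D2; apply: is_derive_near D1.
  apply: (@filterS _ (nbhs u) _ U) => //.
  exact: (open_nbhs_nbhs (conj openU Uu)).
pose sf p := pdiff2 f p (X p) (X p); pose sh p := pdiff2 h p (X p) (X p).
pose n p := pdiff f p (A p (X p)).
have sfE u : U u -> F u * sf u = de * kap ^+ 2 * fv u.
  by move=> Uu; have [] := hessians Uu (fX _ Uu) (hX _ Uu).
have shE u : U u -> hv u * F u * sh u = kap ^+ 2 * (al' * hh u + ga * ff u).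
  by move=> Uu; have [] := hessians Uu (fX _ Uu) (hX _ Uu).
have key u : U u -> exists mu nu, [/\ A u (X u) = mu *: X u + nu *: u,
    n u = nu * (kf%:R * fv u) & F u * mu = 2 * al * hv u * kap].
  move=> Uu; have [mu [nu AX]] := dec u (A u (X u)) Uu.
  exists mu, nu; split=> //.
    by rewrite /n AX pdiffD !pdiffZ fX // fE mulr0 add0r.
  have Dsf := Hf _ Uu; rewrite AX pdiff2Dr !pdiff2Zr (pdiff2_euler u (X u) fk) fX // in Dsf.
  have sf0 : sf u != 0.
    apply/eqP => E; have := sfE _ Uu; rewrite E mulr0 => /esym/eqP.
    have [f0 _ _] := Uneq0 Uu.
    by apply/negP; rewrite !mulf_neq0 // expf_neq0.
  have := same _ _ _ _ _ Uu sfE (is_derive_mul (DF _ Uu) Dsf)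
    (is_derive_mul (is_derive_cst (de * kap ^+ 2) u (X u)) (Df _ Uu)).
  rewrite /cst -/(sf u) => /eqP; rewrite -subr_eq0 => /eqP E.
  apply: (mulIf sf0); apply/eqP; rewrite -subr_eq0; apply/eqP.
  by rewrite -[RHS]oppr0 -E; ring.
pose m : C := kh.-1%:R.
have nE u : U u ->
    n u * m * (hh u * F u) = kf%:R * kap ^+ 2 * fv u * (ga * ff u + - al' * hh u).
  move=> Uu; have [mu [nu [AX nu_n muE]]] := key _ Uu.
  have Dsh := Hh _ Uu; rewrite AX pdiff2Dr !pdiff2Zr (pdiff2_euler u (X u) hk) hX // in Dsh.
  have := same _ _ _ _ _ Uu shE
    (is_derive_mul (is_derive_mul (Dh _ Uu) (DF _ Uu)) Dsh)
    (is_derive_mul (is_derive_cst (kap ^+ 2) u (X u)) (Dlin al' ga _ Uu)).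
  rewrite /cst -/(sh u) -/m => /eqP; rewrite -subr_eq0 => /eqP E.
  have {}muE : F u * mu - 2 * al * hv u * kap = 0 by rewrite muE subrr.
  have shE0 : hv u * F u * sh u - kap ^+ 2 * (al' * hh u + ga * ff u) = 0.
    by rewrite shE // subrr.
  move: E; set L := (L in L = 0 -> _) => E.
  apply: (mulIf kap0); apply/eqP; rewrite -subr_eq0; apply/eqP.
  transitivity (- (kf%:R * fv u * hv u) * L
    - kf%:R * fv u * hh u * sh u * (F u * mu - 2 * al * hv u * kap)
    + kf%:R * fv u * kap * (hv u * F u * sh u - kap ^+ 2 * (al' * hh u + ga * ff u))).
    by rewrite /L nu_n /hh; ring.
  by rewrite E muE shE0 !mulr0 subr0 addr0.
have [mu [nu [AX nu_n muE]]] := key _ Uu0.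
have AAX : pdiff f u0 (A u0 (A u0 (X u0))) = mu * n u0.
  have A0 : A u0 0 = 0.
    have := Alin u0 0 0 1 Uu0.
    by rewrite scaler0 addr0 scale1r => /eqP; rewrite eq_sym -subr_eq0 addrK => /eqP.
  have Anu := Alin u0 u0 0 nu Uu0; rewrite !addr0 A0 addr0 in Anu.
  by rewrite AX Alin // Anu Aeuler // pdiffD !pdiffZ fX // !mulr0 addr0.
have Dn0 := Dn _ Uu0; rewrite AAX in Dn0.
have [f0 h0 F0] := Uneq0 Uu0.
have := same _ _ _ _ _ Uu0 nE
  (is_derive_mul (is_derive_mul Dn0 (is_derive_cst m u0 (X u0)))
    (is_derive_mul (Dhh _ Uu0) (DF _ Uu0)))
  (is_derive_mul (is_derive_mul (is_derive_cst (kf%:R * kap ^+ 2) u0 (X u0)) (Df _ Uu0))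
    (is_derive_add (is_derive_mul (is_derive_cst ga u0 (X u0)) (Dff _ Uu0))
      (is_derive_mul (is_derive_cst (- al') u0 (X u0)) (Dhh _ Uu0)))).
rewrite /cst -?/(n u0) => /eqP; rewrite -subr_eq0 => /eqP E.
have {}muE : F u0 * mu - 2 * al * hv u0 * kap = 0 by rewrite muE subrr.
have nE0 : n u0 * m * (hh u0 * F u0) -
    kf%:R * kap ^+ 2 * fv u0 * (ga * ff u0 + - al' * hh u0) = 0.
  by rewrite nE // subrr.
have : 2 * kap * (kf%:R * kap ^+ 2 * fv u0 * (ga * ff u0)) = 0.
  move: E; set L := (L in L = 0 -> _) => E.
  transitivity (hv u0 * (L + m * n u0 * hh u0 * (F u0 * mu - 2 * al * hv u0 * kap))
    - 2 * kap * (n u0 * m * (hh u0 * F u0) -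
        kf%:R * kap ^+ 2 * fv u0 * (ga * ff u0 + - al' * hh u0))).
    by rewrite /L /hh; ring.
  by rewrite E muE nE0 !mulr0 addr0 mulr0 subr0.
have two : (2 : C) != 0 by rewrite pnatr_eq0.
by move/eqP; apply/negP; rewrite !mulf_neq0 // expf_neq0.
Qed.
End Rigidity.

(** * The group G13 *)

Section OctahedralAlgebra.
Variables (K : fieldType) (a b : K).
Let f := 2 * a ^+ 8 + 28 * a ^+ 4 * b ^+ 4 + 2 * b ^+ 8.
Let h := - 12 * a ^+ 10 * b ^+ 2 + 24 * a ^+ 6 * b ^+ 6 - 12 * a ^+ 2 * b ^+ 10.
Let fa := 16 * a ^+ 7 + 112 * a ^+ 3 * b ^+ 4.
Let fb := 112 * a ^+ 4 * b ^+ 3 + 16 * b ^+ 7.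
Let ha := - 120 * a ^+ 9 * b ^+ 2 + 144 * a ^+ 5 * b ^+ 6 - 24 * a * b ^+ 10.
Let hb := - 24 * a ^+ 10 * b + 144 * a ^+ 6 * b ^+ 5 - 120 * a ^+ 2 * b ^+ 9.
Let F := 9216 * (h * h) + - 1536 * (f * (f * f)).

(** The Jacobian determinant of f and h changes sign under the reflections, so its
    square is a polynomial in f and h. *)
Lemma octahedral_syzygy : (fa * hb - fb * ha) ^+ 2 = h * F.
Proof. by rewrite /F /f /h /fa /fb /ha /hb; ring. Qed.

(** The vector (s, t) is the rotated gradient of f, times k over the Jacobian
    determinant J. So J^2 times either Hessian is an invariant, of degree 20 or 24:
    a multiple of f h, or a combination of h^2 and f^3. *)
Lemma octahedral_identities s t k : h != 0 ->
  fa * s + fb * t = 0 -> ha * s + hb * t = k ->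
  F * ((112 * a ^+ 6 + 336 * a ^+ 2 * b ^+ 4) * s ^+ 2
        + 2 * (448 * a ^+ 3 * b ^+ 3) * (s * t)
        + (336 * a ^+ 4 * b ^+ 2 + 112 * b ^+ 6) * t ^+ 2) = - 3584 * k ^+ 2 * f /\
  h * F * ((- 1080 * a ^+ 8 * b ^+ 2 + 720 * a ^+ 4 * b ^+ 6 - 24 * b ^+ 10) * s ^+ 2
        + 2 * (- 240 * a ^+ 9 * b + 864 * a ^+ 5 * b ^+ 5 - 240 * a * b ^+ 9) * (s * t)
        + (- 24 * a ^+ 10 + 720 * a ^+ 6 * b ^+ 4 - 1080 * a ^+ 2 * b ^+ 8) * t ^+ 2) =
   k ^+ 2 * (8448 * (h * h) + - 768 * (f * (f * f))).
Proof.
move=> h0 fs hs; have J2 := octahedral_syzygy.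
set J := fa * hb - fb * ha in J2.
have Js : J * s = - (k * fb).
  transitivity (hb * (fa * s + fb * t) - fb * (ha * s + hb * t)).
    by rewrite /J; move: (fa) (fb) (ha) (hb) => *; ring.
  by rewrite fs hs mulr0 sub0r mulrC.
have Jt : J * t = k * fa.
  transitivity (fa * (ha * s + hb * t) - ha * (fa * s + fb * t)).
    by rewrite /J; move: (fa) (fb) (ha) (hb) => *; ring.
  by rewrite fs hs mulr0 subr0 mulrC.
have Jq (q1 q2 q3 : K) : J ^+ 2 * (q1 * s ^+ 2 + 2 * q2 * (s * t) + q3 * t ^+ 2) =
    k ^+ 2 * (q1 * fb ^+ 2 - 2 * q2 * (fa * fb) + q3 * fa ^+ 2).
  transitivity (q1 * (J * s) ^+ 2 + 2 * q2 * ((J * s) * (J * t)) + q3 * (J * t) ^+ 2).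
    by move: J {J2 Js Jt} => J; ring.
  by rewrite Js Jt; move: (fa) (fb) => *; ring.
split.
- by apply: (mulfI h0); rewrite (mulrA h F) -J2 Jq /f /h /fa /fb; ring.
- by rewrite -J2 Jq /f /h /fa /fb; ring.
Qed.

End OctahedralAlgebra.

Section G13.
Variable R : realType.
Local Notation C := R[i].
Local Notation V := 'cV[C]_2.
Local Notation I := ('i%C : C).
Let I2 : I ^+ 2 = -1 := sqr_i R.

Definition octahedron : seq (C * C * C) := [:: (1, 0, 0); (0, 1, 0); (0, 0, 1)].

Lemma octahedron_separates (u : V) :
  (forall n, n \in octahedron -> axis_form n u = 0) -> u = 0.
Proof.
move=> H; have E1 := H (1, 0, 0); have E2 := H (0, 1, 0).
rewrite !inE !eqxx ?orbT in E1 E2.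
move: (E1 isT) (E2 isT); rewrite /axis_form; cbn [fst snd].
rewrite !mul0r !mul1r !addr0 add0r => {}E1 {}E2.
exact: null_eq0.
Qed.

(** The values of the octahedral axis forms along the line w + t y. *)
Definition octahedron_line (w y : V) : seq (C * C * C) :=
  [:: (null1 w, 2 * (w 0 0 * y 0 0 - w 1 0 * y 1 0), null1 y);
      (null2 w, 2 * I * (w 0 0 * y 0 0 + w 1 0 * y 1 0), null2 y);
      (null3 w, - 2 * (w 0 0 * y 1 0 + w 1 0 * y 0 0), null3 y)].

Lemma octahedron_jets (P : 'M[C]_2) k w y : P \in unitmx ->
  let f := axis_sum_poly P octahedron k.+3 in
  [/\ mxpoly_eval f (P *m w) = \sum_(q <- octahedron_line w y) q.1.1 ^+ k.+3,
      pdiff f (P *m w) (P *m y) =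
        \sum_(q <- octahedron_line w y) k.+3%:R * q.1.1 ^+ k.+2 * q.1.2 &
      pdiff2 f (P *m w) (P *m y) (P *m y) = \sum_(q <- octahedron_line w y)
        k.+3%:R * (k.+2%:R * q.1.1 ^+ k.+1 * q.1.2 ^+ 2 + 2 * q.1.1 ^+ k.+2 * q.2)].
Proof.
move=> Pu f.
pose p := \sum_(q <- octahedron_line w y) quadratic q ^+ k.+3.
have fp t : mxpoly_eval f (P *m w + t *: (P *m y)) = p.[t].
  rewrite eval_axis_sum_poly scalemxAr -mulmxDr mulKmx // /p horner_sum.
  rewrite /axis_sum /octahedron /octahedron_line !big_cons !big_nil !horner_exp.
  congr (_ ^+ _ + (_ ^+ _ + (_ ^+ _ + _)));
    rewrite /axis_form /quadratic /null1 /null2 /null3 !mxE; cbn [fst snd];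
    by rewrite !hornerE /=; ring.
have J (q : C * C * C) := quadratic_jets q.1.1 q.1.2 q.2 k.
split.
- apply: (etrans (line_jet0 fp)); rewrite /p horner_sum; apply: eq_bigr => -[[a b] c] _.
  by have [] := J (a, b, c).
- rewrite (line_jet1 fp) /p raddf_sum horner_sum; apply: eq_bigr => -[[a b] c] _.
  by have [] := J (a, b, c).
- rewrite (line_jet2 fp) /p raddf_sum /= raddf_sum horner_sum.
  apply: eq_bigr => -[[a b] c] _.
  by have [] := J (a, b, c).
Qed.

Section Octahedral.
Variable P : 'M[C]_2.
Hypothesis Pu : P \in unitmx.
Let f := axis_sum_poly P octahedron 4.
Let h := axis_sum_poly P octahedron 6.

Lemma octahedral8 (w y : V) (a := w 0 0) (b := w 1 0) (s := y 0 0) (t := y 1 0) :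
  [/\ mxpoly_eval f (P *m w) = 2 * a ^+ 8 + 28 * a ^+ 4 * b ^+ 4 + 2 * b ^+ 8,
      pdiff f (P *m w) (P *m y) = (16 * a ^+ 7 + 112 * a ^+ 3 * b ^+ 4) * s
        + (112 * a ^+ 4 * b ^+ 3 + 16 * b ^+ 7) * t &
      pdiff2 f (P *m w) (P *m y) (P *m y) =
        (112 * a ^+ 6 + 336 * a ^+ 2 * b ^+ 4) * s ^+ 2
        + 2 * (448 * a ^+ 3 * b ^+ 3) * (s * t)
        + (336 * a ^+ 4 * b ^+ 2 + 112 * b ^+ 6) * t ^+ 2].
Proof.
have [E0 E1 E2] := octahedron_jets 1 w y Pu.
rewrite /f E0 E1 E2 /octahedron_line !big_cons !big_nil; cbn [fst snd].
rewrite /null1 /null2 /null3 -/a -/b -/s -/t; clearbody a b s t.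
by split; ring: I2.
Qed.

Lemma octahedral12 (w y : V) (a := w 0 0) (b := w 1 0) (s := y 0 0) (t := y 1 0) :
  [/\ mxpoly_eval h (P *m w) =
        - 12 * a ^+ 10 * b ^+ 2 + 24 * a ^+ 6 * b ^+ 6 - 12 * a ^+ 2 * b ^+ 10,
      pdiff h (P *m w) (P *m y) =
        (- 120 * a ^+ 9 * b ^+ 2 + 144 * a ^+ 5 * b ^+ 6 - 24 * a * b ^+ 10) * s
        + (- 24 * a ^+ 10 * b + 144 * a ^+ 6 * b ^+ 5 - 120 * a ^+ 2 * b ^+ 9) * t &
      pdiff2 h (P *m w) (P *m y) (P *m y) =
        (- 1080 * a ^+ 8 * b ^+ 2 + 720 * a ^+ 4 * b ^+ 6 - 24 * b ^+ 10) * s ^+ 2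
        + 2 * (- 240 * a ^+ 9 * b + 864 * a ^+ 5 * b ^+ 5 - 240 * a * b ^+ 9) * (s * t)
        + (- 24 * a ^+ 10 + 720 * a ^+ 6 * b ^+ 4 - 1080 * a ^+ 2 * b ^+ 8) * t ^+ 2].
Proof.
have [E0 E1 E2] := octahedron_jets 3 w y Pu.
rewrite /h E0 E1 E2 /octahedron_line !big_cons !big_nil; cbn [fst snd].
rewrite /null1 /null2 /null3 -/a -/b -/s -/t; clearbody a b s t.
by split; ring: I2.
Qed.


Local Notation fv u := (mxpoly_eval f u).
Local Notation hv u := (mxpoly_eval h u).
Local Notation F u := (9216 * (hv u * hv u) + - 1536 * (fv u * (fv u * fv u))).
Let U : set V := [set u | [/\ fv u != 0, hv u != 0 & F u != 0]].

Lemma octahedral_hessians w y k : U (P *m w) ->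
  pdiff f (P *m w) (P *m y) = 0 -> pdiff h (P *m w) (P *m y) = k ->
  F (P *m w) * pdiff2 f (P *m w) (P *m y) (P *m y) = - 3584 * k ^+ 2 * fv (P *m w) /\
  hv (P *m w) * F (P *m w) * pdiff2 h (P *m w) (P *m y) (P *m y) =
   k ^+ 2 * (8448 * (hv (P *m w) * hv (P *m w))
     + - 768 * (fv (P *m w) * (fv (P *m w) * fv (P *m w)))).
Proof.
case=> _ + _; have [-> -> ->] := octahedral8 w y; have [-> -> ->] := octahedral12 w y.
exact: octahedral_identities.
Qed.

Lemma octahedral_pjac w : U (P *m w) ->
  pjac (fun i : 'I_2 => if i == 0 then f else h) (P *m w) \in unitmx.
Proof.
move=> [_ h0 F0]; have hF := mulf_neq0 h0 F0.
have [f0 _ _] := octahedral8 w 0; have [h0' _ _] := octahedral12 w 0.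
rewrite f0 h0' -octahedral_syzygy sqrf_eq0 {h0 F0 f0 h0'} in hF.
set M := pjac _ _; suff : M *m P \in unitmx by rewrite unitmx_mul => /andP[].
have col i j : (M *m P) i j = pdiff (if i == 0 then f else h) (P *m w) (P *m delta_mx j 0).
  have -> : (M *m P) i j = (M *m (P *m delta_mx j 0 : V)) i 0.
    by rewrite mulmxA -colE [RHS]mxE.
  by rewrite pjac_mul mxE.
rewrite unitmxE unitfE det_mx2 !col /=.
have d j : (delta_mx j 0 : V) 0 0 = (j == 0)%:R /\ (delta_mx j 0 : V) 1 0 = (j == 1)%:R.
  by rewrite !mxE !andbT ![_ == j]eq_sym.
have [d00 d01] := d 0; have [d10 d11] := d 1.
have [_ -> _] := octahedral8 w (delta_mx 0 0); have [_ -> _] := octahedral8 w (delta_mx 1 0).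
have [_ -> _] := octahedral12 w (delta_mx 0 0).
have [_ -> _] := octahedral12 w (delta_mx 1 0).
by rewrite d00 d01 d10 d11 /= !mulr0 !mulr1 !addr0 !add0r.
Qed.

End Octahedral.

Variable t : R.
Hypothesis tt : t ^+ 2 = 2.
Let h := t / 2.
Let tC : t%:C ^+ 2 = 2 :> C.
Proof. by rewrite -rmorphXn tt rmorph_nat. Qed.
Let hC : h%:C = t%:C / 2 :> C.
Proof. by rewrite /h rmorphM fmorphV rmorph_nat. Qed.
Let real0 : (0 : R)%:C = 0 :> C. Proof. by []. Qed.
Let real1 : (1 : R)%:C = 1 :> C. Proof. by []. Qed.
Let realN (a : R) : (- a)%:C = - a%:C :> C. Proof. exact: rmorphN. Qed.

Let vs13 : seq (R * R * R) := [:: (0, 0, 1); (- h, 0, h); (h, - h, 0)].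

Let vs13_unit v : v \in vs13 -> unit_vector v.
Proof.
have two : (2 : R) != 0 by rewrite pnatr_eq0.
by rewrite !inE => /or3P[] /eqP ->; rewrite /unit_vector /h /=; field: tt.
Qed.

Lemma octahedron_sum_invariant k v u : v \in vs13 ->
  axis_sum octahedron (2 * k) (pauli_vector v *m u) = axis_sum octahedron (2 * k) u.
Proof.
have two := natr_neq0 R 1.
move=> vvs; have E n := axis_form_pauli n u (vs13_unit vvs).
move: vvs E; rewrite !inE => /or3P[] /eqP ->;
  rewrite /pauli_vector; cbn [fst snd]; rewrite ?realN ?real0 ?real1 ?hC => E;
  [apply: (axis_sum_permuted (s := [:: 0; 1; 2]%N)) |
   apply: (axis_sum_permuted (s := [:: 2; 1; 0]%N)) |
   apply: (axis_sum_permuted (s := [:: 1; 0; 2]%N))] => //;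
  move=> [|[|[|//]]] _; cbn [nth octahedron];
  by rewrite E /axis_form; cbn [fst snd]; field: tC.
Qed.

(** An eigenvalue of order 12 shows that the invariants of degrees 8 and 12 do
    not exceed the largest degree, as required by rank2_rigidity. *)
Lemma G13_obstruction (P : 'M[C]_2) : P \in unitmx ->
  ~ admits_natural_almost_saito
      [set P *m g *m invmx P | g in mxgroup_gen [seq pauli_vector v | v <- vs13]].
Proof.
move=> Pu [d [x [r [Gam [mul [e [basic natural]]]]]]].
have two := natr_neq0 R 1.
pose g1 : 'M[C]_2 := pauli 0 0 1; pose g2 : 'M[C]_2 := pauli (- h) 0 h.
pose g3 : 'M[C]_2 := pauli h (- h) 0.
have [mu Hmu] := quadratic_root (\tr (g1 *m g2 *m g3)) (\det (g1 *m g2 *m g3)).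
have d1 : \det g1 = -1.
  by apply: pauli_det; apply: (@vs13_unit (0, 0, 1)); rewrite !inE eqxx ?orbT.
have d2 : \det g2 = -1.
  by apply: pauli_det; apply: (@vs13_unit (- h, 0, h)); rewrite !inE eqxx ?orbT.
have d3 : \det g3 = -1.
  by apply: pauli_det; apply: (@vs13_unit (h, - h, 0)); rewrite !inE eqxx ?orbT.
have Gs := mxgroup_gen_group (pauli_gens_unit vs13_unit).
have d12 : (12 <= d ord0)%N.
  apply: (pauli_degree_bound (m := 1) (g := g1 *m g2 *m g3) (mu := mu) Pu
    vs13_unit basic _ octahedron_separates) => //.
  - by move=> k v u vvs; exact: octahedron_sum_invariant.
  - by apply: (mxgroupM Gs); [apply: (mxgroupM Gs)|];
      apply: mxgroup_gen_mem; rewrite !inE eqxx ?orbT.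
  - have mu2 : mu ^+ 2 = I * mu + 1.
      move: Hmu; rewrite pauli_trace3 !det_mulmx d1 d2 d3.
      rewrite [X in X%:C](_ : _ = 1 / 2); last first.
        have two' : (2 : R) != 0 by rewrite pnatr_eq0.
        by rewrite /h; field: tt.
      have -> : (1 / 2 : R)%:C = 1 / 2 :> C.
        by rewrite rmorphM fmorphV rmorph_nat rmorph1.
      move=> Hm; transitivity (I * mu + 1 +
        (mu ^+ 2 - 2 * I * (1 / 2) * mu + -1 * -1 * -1)); first by field.
      by rewrite Hm addr0.
    have mu6 : mu ^+ 6 = -1 by ring: mu2 I2.
    apply: primitive_rootP => //.
      by rewrite -[12%N]/((6 * 2)%N) exprM mu6 sqrrN expr1n.
    move=> p; rewrite -[primes 12]/[:: 2%N; 3%N] !inE => /orP[] /eqP ->.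
      by rewrite -[(12 %/ 2)%N]/6%N mu6 oppr1_neq1.
    rewrite -[(12 %/ 3)%N]/4%N; apply/eqP => mu4.
    have : (3 : C) = 0.
      transitivity (mu ^+ 4 * mu ^+ 4 + mu ^+ 4 + 1).
        by rewrite mu4; ring.
      by ring: mu2 I2.
    by move/eqP; rewrite (negbTE (natr_neq0 R 2)).
have inv k : invariant_mpoly [set P *m g *m invmx P | g in mxgroup_gen
    [seq pauli_vector v | v <- vs13]] (axis_sum_poly P octahedron (2 * k)).
  apply: (axis_sum_invariant Pu vs13_unit) => v u vvs.
  exact: octahedron_sum_invariant.
pose w0 : V := \col_i (if i == 0 then 1 else 2).
refine (@rank2_rigidity R _ d x r Gam mul e basic natural (pauli_group_det Pu vs13_unit)
  (axis_sum_poly P octahedron 4) (axis_sum_poly P octahedron 6) 8 12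
  (inv 2) (axis_sum_poly_homog P octahedron 4) (inv 3) (axis_sum_poly_homog P octahedron 6)
  isT (leq_trans (isT : (8 < 12)%N) d12) d12 9216 (- 1536) 8448 (- 768) (- 3584)
  (P *m w0) _ _ _ _ _).
- have [f0 _ _] := octahedral8 Pu w0 0; have [h0 _ _] := octahedral12 Pu w0 0.
  have fE : mxpoly_eval (axis_sum_poly P octahedron 4) (P *m w0) = 962.
    by rewrite f0 !mxE /=; ring.
  have hE : mxpoly_eval (axis_sum_poly P octahedron 6) (P *m w0) = - (12 * 900).
    by rewrite h0 !mxE /=; ring.
  rewrite /mkset fE hE; split; first exact: natr_neq0.
    by rewrite oppr_eq0 mulf_neq0 ?natr_neq0.
  rewrite [X in X != 0](_ : _ = - (3 * 4096 * (4879 * 4879))); last by ring.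
  by rewrite oppr_eq0 !mulf_neq0 ?natr_neq0.
- by rewrite oppr_eq0 natr_neq0.
- by rewrite oppr_eq0 natr_neq0.
- by move=> u; rewrite -(mulKVmx Pu u); exact: octahedral_pjac.
- by move=> u v k; rewrite -(mulKVmx Pu u) -(mulKVmx Pu v); exact: octahedral_hessians.
Qed.

End G13.

Lemma G13_no_natural_almost_saito (R : realType) (G : set 'M[R[i]]_2) :
  is_G13 G -> ~ admits_natural_almost_saito G.
Proof.
move=> [P Pu ->]; rewrite inv_sqrt2.
by apply: G13_obstruction => //; rewrite sqr_sqrtr.
Qed.

(** * Computation in rings of cyclotomic integers *)

Section Cyclotomic.
Variables (K : numFieldType) (z : K) (cs : seq Z).

(** The list p stands for the polynomial with coefficients p, evaluated at z;
    multiplication by z reduces with z ^ d = cs(z), where d is the size of cs. *)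
Definition zval (a : Z) : K := (int_of_Z a)%:~R.
Definition zp_val (p : seq Z) : K := foldr (fun a x => zval a + z * x) 0 p.

Fixpoint zp_add (p q : seq Z) : seq Z :=
  match p, q with
  | [::], _ => q
  | _, [::] => p
  | a :: p', b :: q' => Z.add a b :: zp_add p' q'
  end.
Definition zp_scale a (p : seq Z) := map (Z.mul a) p.
Definition zp_mulX (p : seq Z) :=
  if size p == size cs
  then zp_add (Z0 :: take (size cs).-1 p) (zp_scale (nth Z0 p (size cs).-1) cs)
  else Z0 :: p.
Definition zp_mul (p q : seq Z) :=
  foldr (fun a acc => zp_add (zp_scale a q) (zp_mulX acc)) [::] p.
Fixpoint zp_exp_rec fuel (p : seq Z) n : seq Z :=
  if fuel is fuel'.+1 then
    if n is 0 then [:: Z.pos xH] else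
    let q := zp_exp_rec fuel' (zp_mul p p) n./2 in
    if odd n then zp_mul p q else q
  else [:: Z.pos xH].
Definition zp_exp p n := zp_exp_rec n p n.
Definition zp_sum (ps : seq (seq Z)) := foldr zp_add [::] ps.
Definition zp_dot n (r v : seq (seq Z)) :=
  zp_sum (mkseq (fun j => zp_mul (nth [::] r j) (nth [::] v j)) n).
Definition zp_zero (p : seq Z) := all (Z.eqb Z0) p.

(** Whether the product of the two values is a nonzero integer. *)
Definition zp_invertible (p q : seq Z) :=
  let c := zp_mul p q in ~~ Z.eqb (head Z0 c) Z0 && zp_zero (behead c).

Hypothesis zcs : z ^+ size cs = zp_val cs.
Hypothesis cs_gt0 : (0 < size cs)%N.

Lemma zvalD a b : zval (Z.add a b) = zval a + zval b.
Proof. by rewrite /zval -intrD -raddfD. Qed.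

Lemma zvalM a b : zval (Z.mul a b) = zval a * zval b.
Proof. by rewrite /zval -intrM -rmorphM. Qed.

Lemma zp_valD p q : zp_val (zp_add p q) = zp_val p + zp_val q.
Proof.
elim: p q => [|a p IH] [|b q] //=; rewrite ?add0r ?addr0 //.
by rewrite IH zvalD; ring.
Qed.

Lemma zp_val_scale a p : zp_val (zp_scale a p) = zval a * zp_val p.
Proof. by elim: p => [|b p IH] /=; rewrite ?mulr0 // IH zvalM; ring. Qed.

Lemma zp_val_cat p q : zp_val (p ++ q) = zp_val p + z ^+ size p * zp_val q.
Proof.
elim: p => [|a p IH] /=; first by rewrite add0r mul1r.
by rewrite IH exprS; ring.
Qed.

Lemma zp_val_mulX p : zp_val (zp_mulX p) = z * zp_val p.
Proof.
have z0 : zval Z0 = 0 by [].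
rewrite /zp_mulX; case: eqP => [ps|_]; last by rewrite /= z0 add0r.
have ps0 : (0 < size p)%N by rewrite ps.
have pE : p = take (size p).-1 p ++ [:: nth Z0 p (size p).-1].
  rewrite -{1}[p](cat_take_drop (size p).-1); congr cat.
  by rewrite (drop_nth Z0) ?prednK // drop_size.
rewrite zp_valD zp_val_scale -zcs -ps [in RHS]pE zp_val_cat size_takel ?leq_pred //.
by rewrite -[in z ^+ size p](prednK ps0) exprS /= z0; ring.
Qed.

Lemma zp_valM p q : zp_val (zp_mul p q) = zp_val p * zp_val q.
Proof.
elim: p => [|a p IH] /=; first by rewrite mul0r.
by rewrite zp_valD zp_val_scale zp_val_mulX IH; ring.
Qed.

Lemma zp_val_exp p n : zp_val (zp_exp p n) = zp_val p ^+ n.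
Proof.
have one : zp_val [:: Z.pos xH] = 1 by rewrite /zp_val /= mulr0 addr0.
rewrite /zp_exp; have := leqnn n; move: {2 3}n => fuel.
elim: fuel p n => [|fuel IH] p [|n] nf; rewrite ?expr0 //.
have E : zp_val (zp_exp_rec fuel (zp_mul p p) n.+1./2) = (zp_val p ^+ 2) ^+ n.+1./2.
  by rewrite IH ?zp_valM // -divn2; lia.
rewrite -[in RHS](odd_double_half n.+1) exprD -mul2n exprM -E.
by rewrite [LHS]/=; case: ifP => /= ->; rewrite ?zp_valM ?expr1 ?expr0 ?mul1r.
Qed.

Lemma zp_val_sum ps : zp_val (zp_sum ps) = \sum_(p <- ps) zp_val p.
Proof. by elim: ps => [|p ps IH]; rewrite ?big_nil // big_cons -IH -zp_valD. Qed.

Lemma zp_val_dot n r v : zp_val (zp_dot n r v) =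
  \sum_(j < n) zp_val (nth [::] r j) * zp_val (nth [::] v j).
Proof.
have iotaE : iota 0 n = index_iota 0 n by rewrite /index_iota subn0.
rewrite /zp_dot zp_val_sum big_map iotaE big_mkord.
by apply: eq_bigr => j _; rewrite zp_valM.
Qed.

Lemma zp_val_zero p : zp_zero p -> zp_val p = 0.
Proof.
elim: p => [//|a p IH] /andP[/Z.eqb_spec <- /IH /= ->].
by rewrite mulr0 addr0.
Qed.

Lemma zp_val_neq0 p q : zp_invertible p q -> zp_val p != 0.
Proof.
rewrite /zp_invertible /= => /andP[/negP n0 t0]; apply/eqP => p0.
have : zp_val (zp_mul p q) = 0 by rewrite zp_valM p0 mul0r.
case: (zp_mul p q) n0 t0 => [|n c] /= n0 c0; first by case: (n0 _).
rewrite (zp_val_zero c0) mulr0 addr0 /zval => /eqP; rewrite intr_eq0 => /eqP nz.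
by apply: n0; apply/Z.eqb_spec; apply: (can_inj int_of_ZK); rewrite nz.
Qed.

End Cyclotomic.

(** * Sums of powers of linear forms *)

Section LinearForms.
Variables (K : numFieldType) (n : nat).
Local Notation V := 'cV[K]_n.
Local Notation form := 'rV[K]_n.
Implicit Types (r : form) (s : seq (K * form)) (u v w y : V).

Definition lform r u : K := (r *m u) 0 0.
Definition lform_poly r : mpoly n K := \sum_i mpolyC n (r 0 i) * mpolyX K (mnm1 i).
(** The coefficients make the family stable under derivation. *)
Definition power_sum s k : mpoly n K :=
  \sum_(c <- s) mpolyC n c.1 * lform_poly c.2 ^+ k.

Lemma lformE r u : lform r u = \sum_i r 0 i * u i 0.
Proof. by rewrite /lform mxE. Qed.

Lemma eval_lform_poly r u : meval (u ^~ 0) (lform_poly r) = lform r u.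
Proof.
rewrite raddf_sum lformE; apply: eq_bigr => i _.
by rewrite /= mevalM mevalC mevalXU.
Qed.

Lemma eval_power_sum s k u :
  meval (u ^~ 0) (power_sum s k) = \sum_(c <- s) c.1 * lform c.2 u ^+ k.
Proof.
rewrite raddf_sum; apply: eq_bigr => c _ /=.
by rewrite mevalM mevalC rmorphXn /= -eval_lform_poly.
Qed.

Lemma power_sum_homog s k : power_sum s k \is ishomog1 k mdeg.
Proof.
have hl r : lform_poly r \is ishomog1 1 mdeg.
  rewrite /lform_poly; apply: (big_ind (fun f => f \is ishomog1 1 mdeg)).
  - exact: dhomog0.
  - by move=> f g; exact: dhomogD.
  - by move=> i _; rewrite mul_mpolyC dhomogZ // dhomogX; apply/eqP; exact: mdeg1.
rewrite /power_sum; apply: (big_ind (fun f => f \is ishomog1 k mdeg)).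
- exact: dhomog0.
- by move=> f g; exact: dhomogD.
- by move=> c _; rewrite mul_mpolyC dhomogZ // -[k in ishomog1 k]mul1n dhomogMn.
Qed.

Let mderiv_lform r i : mderiv i (lform_poly r) = mpolyC n (r 0 i).
Proof.
rewrite /lform_poly raddf_sum (bigD1 i) //= big1 => [|j /negbTE ji].
  rewrite mderivM mderivC mul0r add0r mderivX mnm1E eqxx scale1r addr0.
  have -> : mnm_sub (mnm1 i) (mnm1 i) = mnm0 :> multinom n.
    by apply/mnmP => j; rewrite !mnmE subnn.
  by rewrite mpolyX0 mulr1.
by rewrite mderivM mderivC mul0r add0r mderivX mnm1E ji scale0r mulr0.
Qed.

Let weight (t : K * form -> K) s := [seq (c.1 * t c, c.2) | c <- s].

Let mderiv_power_sum s k i :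
  mderiv i (power_sum s k.+1) = power_sum (weight (fun c => k.+1%:R * c.2 0 i) s) k.
Proof.
rewrite /power_sum /weight big_map raddf_sum; apply: eq_bigr => c _ /=.
have E m : mderiv i (lform_poly c.2 ^+ m.+1) =
    mpolyC n (m.+1%:R * c.2 0 i) * lform_poly c.2 ^+ m.
  elim: m => [|m IH].
    by rewrite expr1 expr0 mulr1 mul1r mderiv_lform.
  rewrite exprS mderivM IH mderiv_lform [in RHS]exprS [in RHS]mpolyCM.
  rewrite -[m.+2]addn1 natrD mpolyCD mpolyC1 mpolyCM exprS.
  by move: (lform_poly _ ^+ m) => L; ring.
by rewrite mderivM mderivC mul0r add0r E mulrA -mpolyCM.
Qed.

Let sum_weight (F : K * form -> K) s v k :
  \sum_i v i 0 * \sum_(c <- s) c.1 * (k * c.2 0 i) * F c =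
  \sum_(c <- s) k * c.1 * lform c.2 v * F c.
Proof.
under eq_bigr => i _ do rewrite mulr_sumr.
rewrite exchange_big /=; apply: eq_bigr => c _.
by rewrite lformE mulr_sumr mulr_suml; apply: eq_bigr => i _; ring.
Qed.

Lemma pdiff_power_sum s k u v : pdiff (power_sum s k.+1) u v =
  k.+1%:R * \sum_(c <- s) c.1 * (lform c.2 u ^+ k * lform c.2 v).
Proof.
rewrite /pdiff; under eq_bigr => i _.
  rewrite mderiv_power_sum eval_power_sum /weight big_map /=; over.
rewrite (sum_weight (fun c => lform c.2 u ^+ k)) mulr_sumr.
by apply: eq_bigr => c _; ring.
Qed.

Lemma pdiff2_power_sum s k u v w : pdiff2 (power_sum s k.+2) u v w =
  k.+2%:R * k.+1%:R *
    \sum_(c <- s) c.1 * (lform c.2 u ^+ k * lform c.2 v * lform c.2 w).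
Proof.
rewrite /pdiff2; under eq_bigr => i _.
  rewrite mderiv_power_sum pdiff_power_sum /weight big_map /= mulrCA; over.
rewrite -mulr_sumr (sum_weight (fun c => lform c.2 u ^+ k * lform c.2 w)) !mulr_sumr.
by apply: eq_bigr => c _; ring.
Qed.

Lemma pdiff3_power_sum s k u v w y : pdiff3 (power_sum s k.+3) u v w y =
  k.+3%:R * k.+2%:R * k.+1%:R * \sum_(c <- s)
    c.1 * (lform c.2 u ^+ k * lform c.2 v * lform c.2 w * lform c.2 y).
Proof.
rewrite /pdiff3; under eq_bigr => i _.
  rewrite mderiv_power_sum pdiff2_power_sum /weight big_map /= mulrCA; over.
rewrite -mulr_sumr (sum_weight (fun c => lform c.2 u ^+ k * lform c.2 w * lform c.2 y)).
by rewrite !mulr_sumr; apply: eq_bigr => c _; ring.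
Qed.

End LinearForms.

(** * The root system of G31 *)

Section RootReflections.
Variables (R : realType) (n : nat) (a : 'cV[R[i]]_n).
Let a_adj : 'rV[R[i]]_n := (map_mx conjc a)^T.
Hypothesis a_norm : (a_adj *m a) 0 0 != 0.

Lemma root_reflection_mul (w : 'cV[R[i]]_n) :
  root_reflection a *m w = w - (2 / (a_adj *m a) 0 0 * lform a_adj w) *: a.
Proof.
rewrite /root_reflection -/a_adj mulmxBl mul1mx -scalemxAl -mulmxA.
by rewrite [a_adj *m w]mx11_scalar mul_mx_scalar scalerA.
Qed.

Lemma root_reflectionK : root_reflection a *m root_reflection a = 1%:M.
Proof.
rewrite /root_reflection -/a_adj; move: a_norm; set N := (_ *m _) 0 0 => N0.
rewrite mulmxBl mul1mx -scalemxAl mulmxBr mulmx1 -scalemxAr -mulmxA.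
have -> : a_adj *m (a *m a_adj) = N *: a_adj.
  by rewrite mulmxA [a_adj *m a]mx11_scalar mul_scalar_mx.
rewrite -scalemxAr scalerA divfK //.
have -> : a *m a_adj - 2 *: (a *m a_adj) = - (a *m a_adj).
  by rewrite scaler_nat mulr2n opprD addrA subrr sub0r.
by rewrite scalerN opprK subrK.
Qed.

Lemma root_reflection_unit : root_reflection a \in unitmx.
Proof. by case: (mulmx1_unit root_reflectionK). Qed.

Lemma root_reflection_det : \det (root_reflection a) ^+ 2 = 1.
Proof. by rewrite expr2 -det_mulmx root_reflectionK det1. Qed.

End RootReflections.

(** A Gaussian integer is the pair of its real and imaginary parts. *)
Definition gaussian : Type := (Z * Z)%type.
Definition gadd (x y : gaussian) : gaussian := (Z.add x.1 y.1, Z.add x.2 y.2).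
Definition gmul (x y : gaussian) : gaussian :=
  (Z.sub (Z.mul x.1 y.1) (Z.mul x.2 y.2), Z.add (Z.mul x.1 y.2) (Z.mul x.2 y.1)).
Definition gscale (c : Z) (x : gaussian) : gaussian := (Z.mul c x.1, Z.mul c x.2).
Definition gconj (x : gaussian) : gaussian := (x.1, Z.opp x.2).
Definition g0 : gaussian := (Z0, Z0).
Definition g1 : gaussian := (Zpos xH, Z0).
Definition gI : gaussian := (Z0, Zpos xH).
Definition gdot n (r v : seq gaussian) :=
  foldr gadd g0 (mkseq (fun j => gmul (nth g0 r j) (nth g0 v j)) n).
Definition gauss_norm n (a : seq gaussian) := (gdot n a [seq gconj x | x <- a]).1.

(** The form w |-> N r(s w), for s the reflection with root a of norm N. *)
Definition greflect n (a r : seq gaussian) : seq gaussian :=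
  mkseq (fun j => gadd (gscale (gauss_norm n a) (nth g0 r j))
    (gscale (Zneg (xO xH)) (gmul (gdot n r a) (gconj (nth g0 a j))))) n.

(** Multiplication by a power of i that makes the first nonzero entry lie in a
    fixed quadrant. *)
Definition grotate (r : seq gaussian) : seq gaussian :=
  let rs := traject (map (gmul gI)) r 4 in
  let upright s := let x := nth g0 s (find (fun x => x != g0) s) in
    Z.ltb Z0 x.1 && Z.leb Z0 x.2 in
  nth r rs (find upright rs).

Section GaussianValues.
Variables (R : realType) (n : nat).
Local Notation C := R[i].
Local Notation V := 'cV[C]_n.
Local Notation I := ('i%C : C).
Let I2 : I ^+ 2 = -1 := sqr_i R.

Definition gval (x : gaussian) : C := zval C x.1 + I * zval C x.2.
Definition gform (r : seq gaussian) : 'rV[C]_n := \row_j gval (nth g0 r j).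
Definition gvec (a : seq gaussian) : V := \col_j gval (nth g0 a j).

Lemma zvalN a : zval C (Z.opp a) = - zval C a.
Proof. by rewrite /zval -mulrNz; congr (_%:~R); rewrite -raddfN. Qed.

Lemma gval0 : gval g0 = 0.
Proof. by rewrite /gval /= mulr0 addr0. Qed.

Lemma gvalD x y : gval (gadd x y) = gval x + gval y.
Proof. by rewrite /gval /= !zvalD; ring. Qed.

Lemma gvalM x y : gval (gmul x y) = gval x * gval y.
Proof.
by rewrite /gval /= -Z.add_opp_r !zvalD zvalN !zvalM; ring: I2.
Qed.

Lemma gval_scale c x : gval (gscale c x) = zval C c * gval x.
Proof. by rewrite /gval /= !zvalM; ring. Qed.

Lemma gval_conj x : gval (gconj x) = conjc (gval x).
Proof.
have zcR a : zval C a = (zval R a)%:C by rewrite /zval rmorph_int.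
rewrite /gval /= zvalN !zcR; move: (zval R _) (zval R _) => a b.
by apply/eqP; rewrite eq_complex /=; apply/andP; split; apply/eqP; ring.
Qed.

Lemma gval_dot r v : gval (gdot n r v) =
  \sum_(j < n) gval (nth g0 r j) * gval (nth g0 v j).
Proof.
have iotaE : iota 0 n = index_iota 0 n by rewrite /index_iota subn0.
rewrite -(big_mkord xpredT (fun j => gval (nth g0 r j) * gval (nth g0 v j))) -iotaE.
rewrite /gdot /mkseq; elim: (iota 0 n) => [|j s IH]; first by rewrite big_nil gval0.
by rewrite big_cons -IH /= gvalD gvalM.
Qed.

Lemma lform_gvec r v : lform (gform r) (gvec v) = gval (gdot n r v).
Proof. by rewrite lformE gval_dot; apply: eq_bigr => j _; rewrite !mxE. Qed.

Lemma nth_map_g0 f (a : seq gaussian) j : f g0 = g0 -> nth g0 (map f a) j = f (nth g0 a j).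
Proof.
move=> f0; have [ja|ja] := ltnP j (size a); first exact: nth_map.
by rewrite !nth_default ?size_map.
Qed.

Lemma gvec_adj a : (map_mx conjc (gvec a))^T = gform (map gconj a).
Proof.
apply/rowP => j; rewrite !mxE nth_map_g0 ?gval_conj //.
Qed.

Section Reflect.
Variable a : seq gaussian.
Hypothesis a_norm : (gdot n a (map gconj a)).2 = Z0.
Hypothesis a_neq0 : gauss_norm n a <> Z0.

Lemma gauss_normE : ((map_mx conjc (gvec a))^T *m gvec a) 0 0 = zval C (gauss_norm n a).
Proof.
rewrite gvec_adj -/(lform _ _) lform_gvec.
have -> : gval (gdot n (map gconj a) a) = gval (gdot n a (map gconj a)).
  by rewrite !gval_dot; apply: eq_bigr => j _; rewrite mulrC.
by rewrite /gval a_norm /gauss_norm mulr0 addr0.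
Qed.

Lemma zval_neq0 b : b <> Z0 -> zval C b != 0.
Proof.
move=> b0; rewrite /zval intr_eq0; apply/eqP => b0'; apply: b0.
by apply: (can_inj int_of_ZK); rewrite b0'.
Qed.

Lemma lform_greflect r w : lform (gform (greflect n a r)) w =
  zval C (gauss_norm n a) * lform (gform r) (root_reflection (gvec a) *m w).
Proof.
have N0 := zval_neq0 a_neq0.
rewrite root_reflection_mul gauss_normE gvec_adj.
have lB c u v : lform (gform r) (u - c *: v) = lform (gform r) u - c * lform (gform r) v.
  by rewrite /lform mulmxBr -scalemxAr !mxE.
rewrite lB lform_gvec mulrBr.
have -> : zval C (gauss_norm n a) * (2 / zval C (gauss_norm n a) * lform (gform (map gconj a)) w
    * gval (gdot n r a)) = 2 * gval (gdot n r a) * lform (gform (map gconj a)) w.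
  by field.
rewrite !lformE !mulr_sumr -sumrB; apply: eq_bigr => j _.
rewrite !mxE nth_mkseq // gvalD !gval_scale gvalM nth_map_g0 //.
have -> : zval C (Zneg (xO xH)) = - 2 by [].
by ring.
Qed.

End Reflect.

Lemma lform_grotate r w : lform (gform (grotate r)) w ^+ 4 = lform (gform r) w ^+ 4.
Proof.
have step s : lform (gform (map (gmul gI) s)) w = I * lform (gform s) w.
  rewrite !lformE mulr_sumr; apply: eq_bigr => j _.
  rewrite !mxE nth_map_g0 // gvalM mulrA; congr (_ * _ * _).
  by rewrite /gval /= /zval /= mulr1 add0r.
have I4 : I ^+ 4 = 1 by ring: I2.
rewrite /grotate; move: (find _ _) => k.
have [k4|k4] := ltnP k 4; last by rewrite nth_default // size_traject.
rewrite (nth_traject _ k4); elim: k {k4} => [|k IH]; first exact: erefl.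
by rewrite iterS step exprMn I4 mul1r IH.
Qed.

End GaussianValues.

Definition groot_units : seq gaussian := [:: g1; gI; gscale (Zneg xH) g1; gscale (Zneg xH) gI].
Definition groots : seq (seq gaussian) :=
  let u k := nth g0 groot_units (k %% 4) in
  [seq mkseq (fun l => if l == j then gadd g1 g1 else g0) 4 | j <- iota 0 4] ++
  [seq mkseq (fun l => if l == p.1 then gadd g1 gI else
     if l == p.2 then gmul (gadd g1 gI) (u k) else g0) 4 |
     p <- [:: (0, 1); (0, 2); (0, 3); (1, 2); (1, 3); (2, 3)]%N, k <- iota 0 4] ++
  [seq [:: g1; u q.1; u q.2; u m] | q <- [seq (k, l) | k <- iota 0 4, l <- iota 0 4],
     m <- [seq m <- iota 0 4 | ~~ odd (q.1 + q.2 + m)]].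
Definition ggens : seq (seq gaussian) :=
  let m1 := gscale (Zneg xH) g1 in
  [:: [:: g1; m1; g0; g0]; [:: g0; g1; m1; g0]; [:: g0; g0; g0; g1];
      [:: g1; gscale (Zneg xH) gI; g0; g0]; [:: g1; g1; g1; g1]].

Lemma groots_closed : all (fun a =>
  [&& Z.eqb (gdot 4 a (map gconj a)).2 Z0, ~~ Z.eqb (gauss_norm 4 a) Z0 &
     perm_eq [seq grotate (greflect 4 a r) | r <- groots]
             [seq grotate (map (gscale (gauss_norm 4 a)) r) | r <- groots]]) ggens.
Proof. by vm_compute. Qed.

Section Embedding.
Variables (R : realType) (n : nat) (z : R[i]) (cs w : seq Z).
Local Notation C := R[i].
Local Notation V := 'cV[C]_n.
Hypothesis zcs : z ^+ size cs = zp_val z cs.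
Hypotheses (cs_gt0 : (0 < size cs)%N) (zw : zp_val z w = 'i%C).

(** Gaussian integers among the polynomials in z, by w(z) = i. *)
Definition gembed (x : gaussian) : seq Z := zp_add [:: x.1] (zp_scale x.2 w).
Definition cform (r : seq gaussian) v := zp_dot cs n (map gembed r) v.
Definition cvec (v : seq (seq Z)) : V := \col_j zp_val z (nth [::] v j).
Definition creflect (a : seq gaussian) (v : seq (seq Z)) :=
  mkseq (fun j => zp_add (zp_scale (gauss_norm n a) (nth [::] v j))
    (zp_scale (Zneg (xO xH)) (zp_mul cs (cform (map gconj a) v) (gembed (nth g0 a j))))) n.
Definition csum_forms rs u k vs := zp_sum
  [seq foldr (zp_mul cs) (zp_exp cs (cform r u) k) [seq cform r v | v <- vs] | r <- rs].

Lemma zp_val_embed x : zp_val z (gembed x) = gval R x.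
Proof. by rewrite zp_valD zp_val_scale zw /gval /= mulr0 addr0; ring. Qed.

Lemma lform_cvec r v : lform (gform R n r) (cvec v) = zp_val z (cform r v).
Proof.
rewrite lformE zp_val_dot //; apply: eq_bigr => j _; rewrite !mxE; congr (_ * _).
have [jr|jr] := ltnP j (size r); first by rewrite (nth_map g0) // zp_val_embed.
by rewrite !nth_default ?size_map // gval0.
Qed.

Lemma zp_val_sum_forms rs u k vs : zp_val z (csum_forms rs u k vs) =
  \sum_(r <- rs) lform (gform R n r) (cvec u) ^+ k *
    \prod_(v <- vs) lform (gform R n r) (cvec v).
Proof.
rewrite /csum_forms zp_val_sum big_map; apply: eq_bigr => r _.
elim: vs => [|v vs IH] /=.
  by rewrite big_nil mulr1 zp_val_exp // lform_cvec.
rewrite zp_valM // IH big_cons lform_cvec (lform_cvec r v); exact: mulrCA.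
Qed.

Section Reflect.
Variable a : seq gaussian.
Hypothesis a_norm : (gdot n a (map gconj a)).2 = Z0.
Hypothesis a_neq0 : gauss_norm n a <> Z0.

Lemma cvec_creflect v :
  cvec (creflect a v) = zval C (gauss_norm n a) *: (root_reflection (gvec R n a) *m cvec v).
Proof.
have N0 := zval_neq0 R a_neq0.
rewrite root_reflection_mul gauss_normE // gvec_adj lform_cvec scalerBr scalerA.
apply/colP => j; rewrite !mxE nth_mkseq // zp_valD !zp_val_scale zp_valM // zp_val_embed.
have -> : zval C (Zneg (xO xH)) = - 2 by [].
by field.
Qed.

End Reflect.

Definition cword rs v := foldr creflect v rs.
Definition gword rs : 'M[C]_n :=
  foldr (fun a g => root_reflection (gvec R n a) *m g) 1%:M rs.
Definition norm_word rs : Z := foldr (fun a N => Z.mul (gauss_norm n a) N) (Zpos xH) rs.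

(** The eigenvalue equation, multiplied by the norms of the roots. *)
Lemma gword_eigenvector rs v mu :
  (forall a, a \in rs -> (gdot n a (map gconj a)).2 = Z0 /\ gauss_norm n a <> Z0) ->
  all (fun j => zp_zero (zp_add (nth [::] (cword rs v) j)
    (zp_scale (Z.opp (norm_word rs)) (zp_mul cs mu (nth [::] v j))))) (iota 0 n) ->
  gword rs *m cvec v = zp_val z mu *: cvec v.
Proof.
move=> rsN Hv.
have E : cvec (cword rs v) = zval C (norm_word rs) *: (gword rs *m cvec v).
  elim: rs rsN {Hv} => [|a rs IH] rsN; first by rewrite /= mul1mx scale1r.
  have [aN aN0] := rsN a (mem_head _ _).
  rewrite [LHS](cvec_creflect aN aN0) IH => [|b brs]; last first.
    by apply: rsN; rewrite inE brs orbT.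
  by rewrite -scalemxAr scalerA mulmxA /= zvalM.
have N0 : zval C (norm_word rs) != 0.
  elim: rs rsN {Hv E} => [|a rs IH] rsN; first by rewrite /zval /= oner_eq0.
  rewrite /= zvalM mulf_neq0 //; last first.
    by apply: IH => b brs; apply: rsN; rewrite inE brs orbT.
  by apply: zval_neq0; case: (rsN a (mem_head _ _)).
apply: (scalerI N0); rewrite -E; apply/colP => j.
have /allP/(_ j) := Hv; rewrite mem_iota ltn_ord => /(_ isT)/(zp_val_zero z).
rewrite zp_valD zp_val_scale zp_valM // zvalN => /eqP; rewrite mulNr subr_eq0 => /eqP H.
by rewrite !mxE H.
Qed.

End Embedding.

Section G31.
Variable R : realType.
Local Notation C := R[i].
Local Notation V := 'cV[C]_4.
Local Notation I := ('i%C : C).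
Let I2 : I ^+ 2 = -1 := sqr_i R.
Let s : seq 'M[C]_4 := [seq root_reflection (gvec R 4 a) | a <- ggens].

Lemma G31_generators : [seq root_reflection (\col_i nth 0 r i) | r : seq C <-
       [:: [:: 1; -1;   0; 0];
           [:: 0;  1;  -1; 0];
           [:: 0;  0;   0; 1];
           [:: 1; 0 -i* 1; 0; 0];
           [:: 1;  1;   1; 1]]] = s.
Proof.
have e0 : gval R g0 = 0 := gval0 R.
have e1 : gval R g1 = 1 by rewrite /gval /= mulr0 addr0.
have em : gval R (gscale (Zneg xH) g1) = -1 by rewrite /gval /= mulr0 addr0.
have ei : gval R (gscale (Zneg xH) gI) = 0 -i* 1.
  rewrite /gval /= add0r /zval; apply/eqP; rewrite eq_complex /=.
  by apply/andP; split; apply/eqP; ring.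
transitivity [seq root_reflection (\col_i nth 0 r i : V) |
    r : seq C <- [seq [seq gval R x | x <- a] | a <- ggens]].
  by rewrite /ggens !map_cons e0 e1 em ei.
rewrite -map_comp; apply: eq_map => a /=; congr root_reflection.
apply/colP => i; rewrite !mxE; have [ia|ia] := ltnP i (size a); first exact: nth_map.
by rewrite !nth_default ?size_map.
Qed.

Lemma ggens_norm a : a \in ggens -> (gdot 4 a (map gconj a)).2 = Z0 /\ gauss_norm 4 a <> Z0.
Proof.
move=> /(allP groots_closed)/and3P[/Z.eqb_spec aN /negP aN0 _]; split=> // E.
by apply: aN0; apply/Z.eqb_spec.
Qed.

Lemma gauss_norm_neq0 a : a \in ggens ->
  ((map_mx conjc (gvec R 4 a))^T *m gvec R 4 a) 0 0 != 0.
Proof. by move=> /ggens_norm[aN aN0]; rewrite gauss_normE // zval_neq0. Qed.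

Lemma G31_gens_unit g : g \in s -> g \in unitmx.
Proof. by case/mapP => a /gauss_norm_neq0 aN ->; exact: root_reflection_unit. Qed.

Lemma G31_gens_det g : g \in s -> (\det g) ^+ 2 = 1.
Proof. by case/mapP => a /gauss_norm_neq0 aN ->; exact: root_reflection_det. Qed.

(** A reflection permutes the roots up to units, of which a sum of 4m-th powers
    does not depend. *)
Lemma root_sum_invariant m g u : g \in s ->
  \sum_(r <- groots) lform (gform R 4 r) (g *m u) ^+ (4 * m) =
  \sum_(r <- groots) lform (gform R 4 r) u ^+ (4 * m).
Proof.
case/mapP => a ag ->; have [aN aN0] := ggens_norm ag.
have N0 := zval_neq0 R aN0; have /(allP groots_closed)/and3P[_ _ pr] := ag.
have sumE (T : seq gaussian -> seq gaussian) (F : seq gaussian -> V) :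
    (forall r, lform (gform R 4 (T r)) u =
               zval C (gauss_norm 4 a) * lform (gform R 4 r) (F r)) ->
    \sum_(r <- groots) lform (gform R 4 r) (F r) ^+ (4 * m) =
    (zval C (gauss_norm 4 a) ^+ (4 * m))^-1 *
      \sum_(r <- [seq grotate (T r) | r <- groots]) lform (gform R 4 r) u ^+ (4 * m).
  move=> TF; rewrite big_map mulr_sumr; apply: eq_bigr => r _.
  by rewrite (exprM (lform (gform R 4 (grotate (T r))) u)) lform_grotate -exprM TF exprMn mulKf // expf_neq0.
rewrite (sumE (greflect 4 a) (fun=> root_reflection (gvec R 4 a) *m u)); last first.
  by move=> r; rewrite lform_greflect.
rewrite (perm_big _ pr) (sumE (map (gscale (gauss_norm 4 a))) (fun=> u)) // => r.
rewrite !lformE mulr_sumr; apply: eq_bigr => j _.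
rewrite !mxE nth_map_g0 ?gval_scale ?mulrA //.
by rewrite /gscale /= Z.mul_0_r.
Qed.

End G31.

(** * Jets of the invariants of G31 *)

Section G31Jets.
Variable R : realType.
Local Notation C := R[i].
Local Notation V := 'cV[C]_4.
Local Notation I := ('i%C : C).
Let I2 : I ^+ 2 = -1 := sqr_i R.
Variable P : 'M[C]_4.
Hypothesis Pu : P \in unitmx.
Let s : seq 'M[C]_4 := [seq root_reflection (gvec R 4 a) | a <- ggens].
Let G : set 'M[C]_4 := [set P *m h *m invmx P | h in mxgroup_gen s].

Definition root_sum k : mpoly 4 C :=
  power_sum [seq (1, gform R 4 r *m invmx P) | r <- groots] k.

Lemma eval_root_sum k u :
  mxpoly_eval (root_sum k) u = \sum_(r <- groots) lform (gform R 4 r) (invmx P *m u) ^+ k.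
Proof.
rewrite /mxpoly_eval eval_power_sum big_map; apply: eq_bigr => r _ /=.
by rewrite mul1r /lform mulmxA.
Qed.

Lemma root_sum_invariant_mpoly m : invariant_mpoly G (root_sum (4 * m)).
Proof.
apply: (conj_invariant Pu (@G31_gens_unit R)
  (phi := fun u => \sum_(r <- groots) lform (gform R 4 r) u ^+ (4 * m))).
  by move=> g u gs; exact: root_sum_invariant.
exact: eval_root_sum.
Qed.

Let lform_P r v : lform (gform R 4 r *m invmx P) (P *m v) = lform (gform R 4 r) v.
Proof. by rewrite /lform -mulmxA mulKmx. Qed.

Section Sums.
Variables (z : C) (cs w : seq Z) (u : seq (seq Z)).
Hypothesis zcs : z ^+ size cs = zp_val z cs.
Hypotheses (cs_gt0 : (0 < size cs)%N) (zw : zp_val z w = 'i%C).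
Local Notation vec v := (P *m cvec 4 z v).
Let S k vs := zp_val z (csum_forms 4 cs w groots u k vs).
Let SE k vs : S k vs = \sum_(r <- groots) lform (gform R 4 r) (cvec 4 z u) ^+ k *
    \prod_(v <- vs) lform (gform R 4 r) (cvec 4 z v) :=
  zp_val_sum_forms 4 zcs cs_gt0 zw groots u k vs.

Lemma pdiff_root_sum k v :
  pdiff (root_sum k.+1) (vec u) (vec v) = k.+1%:R * S k [:: v].
Proof.
rewrite pdiff_power_sum SE big_map; congr (_ * _); apply: eq_bigr => r _ /=.
by rewrite !lform_P big_seq1 mul1r.
Qed.

Lemma pdiff2_root_sum k v1 v2 :
  pdiff2 (root_sum k.+2) (vec u) (vec v1) (vec v2) =
    k.+2%:R * k.+1%:R * S k [:: v1; v2].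
Proof.
rewrite pdiff2_power_sum SE big_map; congr (_ * _); apply: eq_bigr => r _ /=.
by rewrite !lform_P !big_cons big_nil mulr1 mul1r mulrA.
Qed.

Lemma pdiff3_root_sum k v1 v2 v3 :
  pdiff3 (root_sum k.+3) (vec u) (vec v1) (vec v2) (vec v3) =
    k.+3%:R * k.+2%:R * k.+1%:R * S k [:: v1; v2; v3].
Proof.
rewrite pdiff3_power_sum SE big_map; congr (_ * _); apply: eq_bigr => r _ /=.
by rewrite !lform_P !big_cons big_nil mulr1 mul1r !mulrA.
Qed.

End Sums.
End G31Jets.

Section CyclotomicData.
#[local] Number Notation Z Z.of_num_int Z.to_num_int : Z_scope.
Local Open Scope Z_scope.

(** z^8 = z^4 - 1, for z a primitive 24th root of unity, and z^6 = i. *)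
Definition reduction24 : seq Z := [:: -1; 0; 0; 0; 1; 0; 0; 0].
Definition i24 : seq Z := [:: 0; 0; 0; 0; 0; 0; 1].

(** z^8 = z^6 - z^4 + z^2 - 1, for z a primitive 20th root of unity, and z^5 = i. *)
Definition reduction20 : seq Z := [:: -1; 0; 1; 0; -1; 0; 1; 0].
Definition i20 : seq Z := [:: 0; 0; 0; 0; 0; 1].

Definition regular_word24 : seq (seq gaussian) :=
  [seq nth [::] ggens j | j <- [:: 1; 4; 2; 3; 0; 1; 3]%N].
Definition eigenvector24 : seq (seq Z) :=
  [:: [:: 0; 0; 1; 0; 1]; [:: 1; 1; 0; 1; 0; -1]; [:: 0; -1; -1; -1; -1; -1]; [:: 1]].

Lemma eigenvector24P : all (fun j => zp_zero (zp_add
    (nth [::] (cword 4 reduction24 i24 regular_word24 eigenvector24) j)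
    (zp_scale (Z.opp (norm_word 4 regular_word24))
      (zp_mul reduction24 [:: 0; 0; 0; 0; 0; 0; 0; 1] (nth [::] eigenvector24 j))))) (iota 0 4).
Proof. by vm_compute. Qed.

(** The eigenvectors of a regular element of order 20, for the eigenvalues
    z^17, z, z^9 and z^13; the second of them is the base point. *)
Definition eigenvectors20 : seq (seq (seq Z)) :=
  [:: [:: [:: -1; 2; 0; -1; -1; 1; 1; -1]; [:: 0; -1; 1; 0; 0; -1; 1; 1];
          [:: 2; -1; -1; 1; 1; 0; -2; 2]; [:: 1]];
      [:: [:: 0; 0; 0; -1; 1; 0; -1; 1]; [:: 1; -1; -1; 1; 1; -1];
          [:: 0; -1; 1; 0; -2; 1; 1; -1]; [:: 1]];
      [:: [:: 0; 0; 0; 1; 1; 0; -1; -1]; [:: 0; 1; 1; -1; -1];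
          [:: 1; 1; -1; -2; 0; 2; 1; -1]; [:: 1]];
      [:: [:: -1; -2; 0; 1; -1; -1; 1; 1]; [:: 1; 1; -1; 0; 0; 0; -1; -1];
          [:: 1; 1; 1; 1; 1; 1]; [:: 1]]].
Let v j := nth [::] eigenvectors20 j.
Definition jet20 k vs := csum_forms 4 reduction20 i20 groots (v 1) k vs.

(** Multiples of the inverses of the derivatives at the base point of the
    invariants of degrees 24, 20, 12 and 8, each along its own eigenvector. *)
Definition gradient20_inverses : seq (seq Z) :=
  [:: [:: 2230495; 2345218; 0; -447706; 1378746; 1172609; -1378746; -1897512];
      [:: -170013; -178740; 0; 34080; -105140; -89370; 105140; 144660];
      [:: 510; 540; 0; -105; 313; 270; -313; -435];
      [:: 17; 14; 0; 2; 16; 7; -16; -16]].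
(** The degrees less one: the powers of linear forms left by a derivative. *)
Definition gradient20_exponents : seq nat := [:: 23; 19; 11; 7]%N.

Lemma gradient20P : all (fun a => all (fun b =>
    let p := jet20 (nth 0%N gradient20_exponents a) [:: v b] in
    if a == b then zp_invertible reduction20 p (nth [::] gradient20_inverses a)
    else zp_zero p) (iota 0 4)) (iota 0 4).
Proof. by vm_compute. Qed.

(** Degrees 20 and 12; the exponents are the degrees less two. *)
Lemma hessian20P :
  all (fun b => zp_zero (jet20 18 [:: v 0; v b])) (iota 0 4) &&
  zp_zero (jet20 10 [:: v 0; v 0]).
Proof. by vm_compute. Qed.

(** The value that jet_obstruction in degree 20 forces to vanish, with the
    coefficient of the last eigenvector eliminated by its equation in degree 8;
    144 = 18 * 8 and 56 = 8 * 7. *)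
Definition obstruction20 := zp_add
  (zp_scale 144 (zp_mul reduction20 (jet20 17 [:: v 0; v 2; v 0]) (jet20 7 [:: v 3])))
  (zp_scale (-56) (zp_mul reduction20 (jet20 6 [:: v 0; v 0]) (jet20 18 [:: v 3; v 2]))).

Lemma obstruction20P : zp_invertible reduction20 obstruction20
  (nth [::] gradient20_inverses 0).
Proof. by vm_compute. Qed.

End CyclotomicData.

(** * The group G31 *)

Section G31Theorem.
Variable R : realType.
Local Notation C := R[i].
Local Notation V := 'cV[C]_4.
Local Notation I := ('i%C : C).
Let I2 : I ^+ 2 = -1 := sqr_i R.

Let zval0 : zval C Z0 = 0. Proof. by []. Qed.
Let zval1 : zval C (Zpos xH) = 1. Proof. by []. Qed.
Let zvalN1 : zval C (Zneg xH) = -1. Proof. by []. Qed.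
Let zval144 : zval C (Zpos (xO (xO (xO (xO (xI (xO (xO xH)))))))) = 144.
Proof.
by rewrite /zval (_ : int_of_Z _ = Posz 144) -?pmulrn //; vm_compute.
Qed.
Let zvalN56 : zval C (Zneg (xO (xO (xO (xI (xI xH)))))) = - 56.
Proof.
by rewrite -[Zneg _]/(Z.opp (Zpos (xO (xO (xO (xI (xI xH))))))) zvalN; congr (- _).
Qed.
Let zvalE := (zval0, zval1, zvalN1).

Lemma root20 : exists z : C,
  z ^+ size reduction20 = zp_val z reduction20 /\ zp_val z i20 = I.
Proof.
have two := natr_neq0 R 1.
have [tau Ht] := quadratic_root (-1 : C) (-1).
have [om Ho] := quadratic_root tau 1.
(* om is a primitive fifth root of unity and tau = om + om^-1. *)
have tau2 : tau ^+ 2 = 1 - tau.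
  by transitivity (tau ^+ 2 - -1 * tau + -1 + 1 - tau); [ring | rewrite Ht add0r].
have om2 : om ^+ 2 = tau * om - 1.
  by transitivity (om ^+ 2 - tau * om + 1 + tau * om - 1); [ring | rewrite Ho add0r].
have om5 : om ^+ 5 = 1 by ring: om2 tau2.
exists (I * om); rewrite /reduction20 /i20 /zp_val /= !zvalE.
by split; ring: I2 om2 tau2.
Qed.

Lemma root24 : exists z : C,
  z ^+ size reduction24 = zp_val z reduction24 /\ zp_val z i24 = I.
Proof.
have [y Hy] := quadratic_root I (-1 : C).
(* y is a primitive twelfth root of unity with y^3 = i. *)
have y2 : y ^+ 2 = I * y + 1.
  by transitivity (y ^+ 2 - I * y + -1 + I * y + 1); [ring | rewrite Hy add0r].
have [z Hz] := quadratic_root 0 (- y).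
have z2 : z ^+ 2 = y.
  by transitivity (z ^+ 2 - 0 * z + - y + y); [ring | rewrite Hz add0r].
exists z; rewrite /reduction24 /i24 /zp_val /= !zvalE.
by split; ring: I2 z2 y2.
Qed.

Section Obstruction.
Variable P : 'M[C]_4.
Hypothesis Pu : P \in unitmx.
Let s : seq 'M[C]_4 := [seq root_reflection (gvec R 4 a) | a <- ggens].
Let G : set 'M[C]_4 := [set P *m h *m invmx P | h in mxgroup_gen s].
Variables (d : 'I_4 -> nat) (x : 'I_4 -> mpoly 4 C).
Variables (r : C) (Gam mul : V -> V -> V -> V) (e : V -> V).
Hypotheses (basic : basic_invariants G d x)
  (natural : natural_almost_saito G d x r Gam mul e).

Let F := root_sum P.
Let Finv m : invariant_mpoly G (F (4 * m)) := root_sum_invariant_mpoly Pu m.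
Let Fhomog k : F k \is ishomog1 k mdeg := power_sum_homog _ k.

Lemma gword_mem rs : {subset rs <= ggens} -> mxgroup_gen s (gword R 4 rs).
Proof.
have Gs := mxgroup_gen_group (@G31_gens_unit R).
elim: rs => [|a rs IH] sub /=; first exact: mxgroup1 Gs.
apply: (mxgroupM Gs); last by apply: IH => b brs; apply: sub; rewrite inE brs orbT.
by apply: mxgroup_gen_mem; apply/mapP; exists a => //; apply: sub; rewrite mem_head.
Qed.

(** The word has an eigenvalue of order 24, and no nonzero vector is orthogonal to
    all roots. *)
Lemma G31_largest_degree : (24 <= d ord0)%N.
Proof.
have [z [zcs zi]] := root24.
set v : V := cvec 4 z eigenvector24.
have wsub : {subset regular_word24 <= ggens} by apply/allP; vm_compute.
have gv : gword R 4 regular_word24 *m v = z ^+ 7 *: v.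
  rewrite (gword_eigenvector zcs isT zi _ eigenvector24P); last first.
    by move=> a /wsub; exact: ggens_norm.
  by congr (_ *: _); rewrite /zp_val /= !zvalE; ring.
have z6 : z ^+ 6 = I by rewrite -zi /zp_val /= !zvalE; ring.
have z8 : z ^+ 8 = z ^+ 4 - 1.
  by rewrite zcs /zp_val /= !zvalE; ring.
have prim : 24.-primitive_root (z ^+ 7).
  have z12 : z ^+ 12 = -1.
    by rewrite -[12%N]/((6 * 2)%N) exprM z6 I2.
  have z24 : z ^+ 24 = 1 by rewrite -[24%N]/((12 * 2)%N) exprM z12 sqrrN expr1n.
  apply: primitive_rootP => //.
    by rewrite -exprM mulnC exprM z24 expr1n.
  move=> p; rewrite -[primes 24]/[:: 2%N; 3%N] !inE => /orP[] /eqP ->.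
    rewrite -[(24 %/ 2)%N]/12%N -exprM mulnC exprM z12.
    rewrite -[(-1) ^+ 7]signr_odd /=; exact: oppr1_neq1.
  rewrite -[(24 %/ 3)%N]/8%N -exprM -[(7 * 8)%N]/((24 + 24 + 8)%N) !exprD z24 !mul1r.
  rewrite z8; apply/eqP => E.
  have z4 : z ^+ 4 = 2 by rewrite -[LHS](subrK 1) E.
  have : (9 : C) = 0.
    transitivity (z ^+ 4 * (z ^+ 4 * z ^+ 4) + 1); first by rewrite z4; ring.
    by rewrite -!exprD z12 addNr.
  by move/eqP; rewrite (negbTE (natr_neq0 R 8)).
have [k Fk] : exists k, \sum_(q <- groots) lform (gform R 4 q) v ^+ (4 * k.+1) != 0.
  apply: contrapT => /forallNP H.
  have s0 k : \sum_(b <- [seq lform (gform R 4 q) v ^+ 4 | q <- groots]) b ^+ k.+1 = 0.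
    have /negP := H k; rewrite negbK => /eqP Hk.
    by rewrite big_map -[RHS]Hk; apply: eq_bigr => q _; rewrite exprM.
  pose q : seq gaussian := mkseq (fun l => if l == 3 then gadd g1 g1 else g0) 4.
  have qR : q \in groots by vm_compute.
  have := power_sums_eq0 s0 (map_f (fun q => lform (gform R 4 q) v ^+ 4) qR).
  have -> : lform (gform R 4 q) v = 2.
    rewrite (lform_cvec 4 zcs isT zi).
    have -> : cform 4 reduction24 i24 q eigenvector24 =
        [:: Zpos (xO xH); Z0; Z0; Z0; Z0; Z0; Z0; Z0] by vm_compute.
    by rewrite /zp_val /= !zvalE /zval; ring.
  by move=> /eqP; rewrite expf_eq0 /= (negbTE (natr_neq0 R 1)).
apply: (@degree_bound _ _ _ _ _ basic (P *m gword R 4 regular_word24 *m invmx P)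
    (P *m v) (z ^+ 7) 24 (F (4 * k.+1))) => //.
- by apply: conj_mem; exact: gword_mem.
- by rewrite -mulmxA mulKmx // -mulmxA gv scalemxAr.
- rewrite !eval_root_sum mulKmx // mulmx0 [X in _ != X](_ : _ = 0) //.
  rewrite big1 // => q _; rewrite /lform mulmx0 mxE.
  by rewrite expr0n.
Qed.

Let v j := nth [::] eigenvectors20 j.

(** At the base point, an eigenvector of a regular element of order 20, the
    equations in degrees 20, 12 and 8 make the unit field a multiple of the first
    eigenvector and its derivative a combination of the first and the last one.
    The row of the Hessian in degree 20 vanishes there, but its derivative along
    the unit field does not. *)
Lemma G31_contradiction : False.
Proof.
have [z [zcs zi]] := root20.
pose vec (j : nat) : V := P *m cvec 4 z (v j).
pose J k vs := zp_val z (jet20 k vs).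
have D1 k j : pdiff (F k.+1) (vec 1) (vec j) = k.+1%:R * J k [:: v j] :=
  pdiff_root_sum Pu (v 1) zcs isT zi k (v j).
have D2 k i j : pdiff2 (F k.+2) (vec 1) (vec i) (vec j) =
  k.+2%:R * k.+1%:R * J k [:: v i; v j] := pdiff2_root_sum Pu (v 1) zcs isT zi k (v i) (v j).
have D3 k i j l : pdiff3 (F k.+3) (vec 1) (vec i) (vec j) (vec l) =
  k.+3%:R * k.+2%:R * k.+1%:R * J k [:: v i; v j; v l] :=
  pdiff3_root_sum Pu (v 1) zcs isT zi k (v i) (v j) (v l).
have lin a b p1 q1 p2 q2 : zp_val z (zp_add
    (zp_scale a (zp_mul reduction20 p1 q1)) (zp_scale b (zp_mul reduction20 p2 q2))) =
    zval C a * (zp_val z p1 * zp_val z q1) + zval C b * (zp_val z p2 * zp_val z q2).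
  by rewrite zp_valD !zp_val_scale !(zp_valM zcs isT).
have nz p q : zp_invertible reduction20 p q -> zp_val z p != 0.
  by move=> /(zp_val_neq0 zcs isT).
pose deg a := nth 0%N gradient20_exponents a.
have grad (a b : 'I_4) : (a == b -> J (deg a) [:: v b] != 0) /\
    (a != b -> J (deg a) [:: v b] = 0).
  have mem4 (i : 'I_4) : nat_of_ord i \in iota 0 4 by rewrite mem_iota ltn_ord.
  have /allP/(_ _ (mem4 a))/allP/(_ _ (mem4 b)) := gradient20P.
  cbv zeta => H; split=> ab; move: H.
    by rewrite val_eqE ab; exact: nz.
  by rewrite val_eqE (negbTE ab); exact: zp_val_zero.
have /andP[/allP h20 h12] := hessian20P.
have {}h20 j : (j < 4)%N -> J 18 [:: v 0; v j] = 0.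
  by move=> j4; apply: zp_val_zero; apply: h20; rewrite mem_iota.
have {}h12 : J 10 [:: v 0; v 0] = 0 by exact: zp_val_zero.
have obE : zp_val z obstruction20 =
    zval C (Zpos (xO (xO (xO (xO (xI (xO (xO xH)))))))) *
      (J 17 [:: v 0; v 2; v 0] * J 7 [:: v 3]) +
    zval C (Zneg (xO (xO (xO (xI (xI xH)))))) *
      (J 6 [:: v 0; v 0] * J 18 [:: v 3; v 2]) := lin _ _ _ _ _ _.
have ob := nz _ _ obstruction20P.
rewrite {}obE in ob.
have D2f20 : forall i j, pdiff2 (F (4 * 5)) (vec 1) (vec i) (vec j) =
  20 * 19 * J 18 [:: v i; v j] := D2 18%N.
have D2f12 : forall i j, pdiff2 (F (4 * 3)) (vec 1) (vec i) (vec j) =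
  12 * 11 * J 10 [:: v i; v j] := D2 10%N.
have D2f8 : forall i j, pdiff2 (F (4 * 2)) (vec 1) (vec i) (vec j) =
  8 * 7 * J 6 [:: v i; v j] := D2 6%N.
have D3f20 : forall i j l, pdiff3 (F (4 * 5)) (vec 1) (vec i) (vec j) (vec l) =
  20 * 19 * 18 * J 17 [:: v i; v j; v l] := D3 17%N.
clearbody vec J.
rewrite zval144 zvalN56 in ob.
pose FF (a : 'I_4) := F (deg a).+1.
pose dg (a : 'I_4) := (deg a).+1%:R * J (deg a) [:: v a].
have dg0 a : dg a != 0.
  by rewrite mulf_neq0 ?natr_neq0 //; have [/(_ (eqxx a))] := grad a a.
pose M : 'M[C]_4 := \matrix_(i, j) vec j i 0.
have JM : pjac FF (vec 1) *m M = diag_mx (\row_a dg a).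
  apply/matrixP => a b.
  have -> : (pjac FF (vec 1) *m M) a b = (pjac FF (vec 1) *m vec b) a 0.
    by rewrite !mxE; apply: eq_bigr => i _; rewrite [M _ _]mxE.
  rewrite pjac_mul mxE D1 [RHS]mxE mxE /dg.
  have [_] := grad a b; case: eqP => [-> _|_ -> //]; first by rewrite mulr1n.
  by rewrite mulr0n mulr0.
have JMu : pjac FF (vec 1) *m M \in unitmx.
  rewrite JM unitmxE unitfE det_diag; apply/prodf_neq0 => a _.
  by rewrite mxE dg0.
have /andP[Ju Mu] : (pjac FF (vec 1) \in unitmx) && (M \in unitmx).
  by rewrite -unitmx_mul.
pose o1 : 'I_4 := @Ordinal 4 1 isT; pose o2 : 'I_4 := @Ordinal 4 2 isT.
pose o3 : 'I_4 := @Ordinal 4 3 isT.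
have cases4 (a : 'I_4) : [\/ a = ord0, a = o1, a = o2 | a = o3].
  by case: a => [[|[|[|[|//]]]] i]; [constructor 1 | constructor 2 | constructor 3 |
    constructor 4]; exact: val_inj.
have FF0 : FF ord0 = F (4 * 6) by rewrite /FF; congr F.
have FF1 : FF o1 = F (4 * 5) by rewrite /FF; congr F.
have FF2 : FF o2 = F (4 * 3) by rewrite /FF; congr F.
have FF3 : FF o3 = F (4 * 2) by rewrite /FF; congr F.
have FFinv a : invariant_mpoly G (FF a).
  by case: (cases4 a) => ->; rewrite ?FF0 ?FF1 ?FF2 ?FF3; exact: Finv.
have dg3 : dg o3 = 8 * J 7 [:: v 3] by rewrite /dg; congr (_ * J _ _).
clearbody FF dg.
have Wu : regular_locus G x (vec 1).
  exact: (regular_point basic (conj_det Pu (@G31_gens_unit R) (@G31_gens_det R)) FFinv Ju).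
have [X [X1 [X0 jet]]] := jet_obstruction basic natural Wu.
have coord (y : V) : exists t : 'I_4 -> C, y = \sum_j t j *: vec j /\
    forall a, pdiff (FF a) (vec 1) y = dg a * t a.
  exists (fun j => (invmx M *m y) j 0); split.
    rewrite -[LHS](mulKVmx Mu); apply/colP => i; rewrite mxE summxE.
    by apply: eq_bigr => j _; rewrite [M _ _]mxE [RHS]mxE mulrC.
  move=> a; have -> : pdiff (FF a) (vec 1) y = (pjac FF (vec 1) *m y) a 0.
    by rewrite pjac_mul mxE.
  have -> : pjac FF (vec 1) *m y = diag_mx (\row_a dg a) *m (invmx M *m y).
    by rewrite -JM -mulmxA mulKVmx.
  by rewrite mul_diag_mx mxE [X in X * _]mxE.
have below k : (k < 24)%N -> (k < d ord0)%N.
  by move=> k24; apply: leq_trans G31_largest_degree.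
have [t [Xt tX]] := coord X; have [t1 [X1t tX1]] := coord X1.
have jetF k := jet (F (4 * k)) _ (Finv k) (Fhomog (4 * k)).
have degF (a : 'I_4) : a != ord0 -> exists2 k, FF a = F (4 * k) & (4 * k < 24)%N.
  case: (cases4 a) => -> //; [exists 5%N | exists 3%N | exists 2%N] => //.
have ta a : a != ord0 -> t a = 0.
  move=> a0; have [k Fk k24] := degF a a0; have [X1h _ _] := jetF k (below _ k24).
  by apply: (mulfI (dg0 a)); rewrite -tX Fk X1h mulr0.
have XE : X = t ord0 *: vec 0.
  by rewrite Xt (bigD1 ord0) //= big1 ?addr0 // => a /ta ->; rewrite scale0r.
have xi0 : t ord0 != 0 by apply: contraNneq X0; rewrite XE => ->; rewrite scale0r.
have [_ X1f20 row20] := jetF 5 (below (4 * 5)%N isT).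
have [_ X1f12 _] := jetF 3 (below (4 * 3)%N isT).
have [_ X1f8 _] := jetF 2 (below (4 * 2)%N isT).
rewrite XE pdiff2Zl pdiff2Zr D2f20 h20 // !mulr0 add0r in X1f20.
rewrite XE pdiff2Zl pdiff2Zr D2f12 h12 !mulr0 add0r in X1f12.
rewrite XE pdiff2Zl pdiff2Zr D2f8 in X1f8.
have t1a a : a != ord0 -> a != o3 -> t1 a = 0.
  move=> a0 a3; apply: (mulfI (dg0 a)); rewrite -tX1 mulr0.
  case: (cases4 a) => aE.
  - by case/eqP: a0.
  - by rewrite aE FF1 X1f20.
  - by rewrite aE FF2 X1f12.
  - by case/eqP: a3.
have X1E : X1 = t1 ord0 *: vec 0 + t1 o3 *: vec 3.
  rewrite X1t (bigD1 ord0) //= (bigD1 o3) //= big1 ?addr0 // => a /andP[a0 a3].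
  by rewrite t1a // scale0r.
have row0 y : pdiff2 (F (4 * 5)) (vec 1) X y = 0.
  have [ty [-> _]] := coord y.
  apply: (big_ind (fun y => pdiff2 (F (4 * 5)) (vec 1) X y = 0)).
  - by have := pdiff2Zr (F (4 * 5)) (vec 1) X 0 0; rewrite scale0r mul0r.
  - by move=> y1 y2 E1 E2; rewrite pdiff2Dr E1 E2 addr0.
  - by move=> b _; rewrite pdiff2Zr XE pdiff2Zl D2f20 h20 // !mulr0.
have := row20 row0 (vec 2).
rewrite XE X1E pdiff3Zl pdiff3Zr D3f20 pdiff2Dl !pdiff2Zl !D2f20 h20 //.
have y4 : 8 * J 7 [:: v 3] * t1 o3 =
    - (t ord0 * (t ord0 * (8 * 7 * J 6 [:: v 0; v 0]))).
  by apply/eqP; rewrite -addr_eq0 -dg3 -tX1 FF3 addrC X1f8.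
move=> E; move/eqP: ob; apply.
have c0 : t ord0 * t ord0 * 20 * 19 != 0 by rewrite !mulf_neq0 ?natr_neq0.
apply: (mulfI c0); rewrite mulr0.
transitivity (8 * J 7 [:: v 3] * (t ord0 * (t ord0 *
  (20 * 19 * 18 * J 17 [:: v 0; v 2; v 0])) + (t1 ord0 * (20 * 19 * 0) +
   t1 o3 * (20 * 19 * J 18 [:: v 3; v 2]))) - 20 * 19 * J 18 [:: v 3; v 2] *
  (8 * J 7 [:: v 3] * t1 o3 + t ord0 * (t ord0 * (8 * 7 * J 6 [:: v 0; v 0])))).
  by ring.
by rewrite E y4 addNr !mulr0 subr0.
Qed.

End Obstruction.
End G31Theorem.

Lemma G31_no_natural_almost_saito (R : realType) (G : set 'M[R[i]]_4) :
  is_G31 G -> ~ admits_natural_almost_saito G.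
Proof.
move=> [P Pu ->] [d [x [r [Gam [mul [e [basic natural]]]]]]].
rewrite G31_generators in basic natural.
exact: (G31_contradiction Pu basic natural).
Qed.

Lemma no_natural_saito (R : realType) n (G : set 'M[R[i]]_n.+1) :
  ~ admits_natural_almost_saito G -> ~ admits_natural_saito G.
Proof.
move=> H [d [x [N [Gam [mul [e [E [basic natural]]]]]]]]; apply: H.
by exists d, x; do 4![eexists]; split; [exact: basic | exact: ns_dual natural].
Qed.

Theorem mainTheorem6 (R : realType) :
  (forall G : set 'M[R[i]]_2, is_G12 G \/ is_G13 G \/ is_G22 G ->
     ~ admits_natural_almost_saito G /\ ~ admits_natural_saito G) /\
  (forall G : set 'M[R[i]]_4, is_G31 G ->
     ~ admits_natural_almost_saito G /\ ~ admits_natural_saito G).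
Proof.
split=> G HG.
  have H : ~ admits_natural_almost_saito G.
    case: HG => [|[|]]; [exact: G12_no_natural_almost_saito |
      exact: G13_no_natural_almost_saito | exact: G22_no_natural_almost_saito].
  by split=> //; exact: no_natural_saito.
have H := G31_no_natural_almost_saito HG.
by split=> //; exact: no_natural_saito.
Qed.
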